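(* Let $p\ge 1$ and let $U^p(\Gamma)$ be an $H^1$-conforming polynomial basis on the reference triangle $\Gamma$, split into vertex, edge and cell base functions $\mathcal V^p_i$, $\mathcal E^p_j$, $\mathcal C^p_{123}$. Let $$\mathcal T_1=\{\mathbf e_1,\mathbf e_2\},\quad \mathcal T_2=\{\mathbf e_1+\mathbf e_2,\mathbf e_1\},\quad \mathcal T_3=\{\mathbf e_1+\mathbf e_2,-\mathbf e_2\},$$ $$\mathcal T_{12}=\{\mathbf e_2,-\mathbf e_1\},\quad \mathcal T_{13}=\{\mathbf e_1,\mathbf e_2\},\quad \mathcal T_{23}=\{\tfrac12(\mathbf e_1-\mathbf e_2),\mathbf e_1+\mathbf e_2\},\quad \mathcal T_{123}=\{\mathbf e_1,\mathbf e_2\}.$$ Then the element on the reference triangle with base functions $$\Big\{\bigoplus_{i=1}^3\mathcal V^p_i\otimes\mathcal T_i\Big\}\oplus\Big\{\bigoplus_{j\in\mathcal J}\mathcal E^p_j\otimes\mathcal T_j\Big\}\oplus\{\mathcal C^p_{123}\otimes\mathcal T_{123}\},\qquad \mathcal J=\{(1,2),(1,3),(2,3)\},$$ is $H(\mathrm{curl})$-conforming under covariant Piola transformations of the base functions.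
   Context: $\Gamma=\{(\xi,\eta)\in[0,1]^2 \mid \xi+\eta\le 1\}$ has vertices $v_1=(0,0)$, $v_2=(0,1)$, $v_3=(1,0)$, edges $e_{12},e_{13},e_{23}$ ($e_{ij}$ joins $v_i$ and $v_j$; its tangent points from the lower to the higher index) and cell $c_{123}$. $\mathbf e_1,\mathbf e_2$ is the Cartesian basis. $P^p(\Gamma)$ denotes the polynomials of total degree at most $p$. $H^1$-conforming polynomial basis $U^p(\Gamma)$: linearly independent polynomials in $P^p(\Gamma)$ with $\dim U^p(\Gamma)=\dim P^p(\Gamma)=(p+2)(p+1)/2$, each associated with one polytope: one vertex base function for each vertex ($\mathcal V^p_i$), $p-1$ edge base functions for each edge ($\mathcal E^p_j$), $(p-2)(p-1)/2$ cell base functions ($\mathcal C^p_{123}$). A vertex base function vanishes at all other vertices and on the non-neighbouring edge; an edge base function vanishes on all other edges; a cell base function vanishes on the boundary. Being $H^1$-conforming means that, after mapping to the elements of a mesh by $n\mapsto n\circ\mathbf x_e^{-1}$ and identifying corresponding base functions of shared vertices and edges, the assembled functions are continuous across element interfaces. $\mathcal S\otimes\mathcal T_\ast$ denotes all products $n\boldsymbol\ell$ with $n\in\mathcal S$, $\boldsymbol\ell\in\mathcal T_\ast$. Association of the products $n\boldsymbol\ell$: to an edge $e_{ij}$ belong the products with $n\in\mathcal V^p_i,\ \boldsymbol\ell\in\mathcal T_i$, or $n\in\mathcal V^p_j,\ \boldsymbol\ell\in\mathcal T_j$, or $n\in\mathcal E^p_{ij},\ \boldsymbol\ell\in\mathcal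 T_{ij}$, where in each case $\boldsymbol\ell$ has non-vanishing tangential component on $e_{ij}$; to the cell belong the products with $n\in\mathcal E^p_{ij}$ and $\boldsymbol\ell\in\mathcal T_{ij}$ of vanishing tangential component on $e_{ij}$, and those with $n\in\mathcal C^p_{123}$, $\boldsymbol\ell\in\mathcal T_{123}$. Meshes: $A\subset\mathbb R^2$ is decomposed into a conforming triangulation with elements $A_e=\mathbf x_e(\Gamma)$, with invertible element maps $\mathbf x_e$ (e.g. affine) with Jacobian matrix $\mathbf J_e$, chosen so that the local vertex order agrees on shared edges. The covariant Piola transformation maps a reference field $\boldsymbol\vartheta$ to $\boldsymbol\theta=\mathbf J_e^{-T}\boldsymbol\vartheta\circ\mathbf x_e^{-1}$. $H(\mathrm{curl},A)=\{\mathbf u\in[L^2(A)]^2 \mid u_{2,x}-u_{1,y}\in L^2(A)\}$. ''$H(\mathrm{curl})$-conforming'' means: identifying corresponding mapped base functions of shared edges (and extending cell base functions by zero), the resulting piecewise space is a subspace of $H(\mathrm{curl},A)$, equivalently the jump of the tangential trace $\langle\mathbf t,\mathbf u\rangle$ vanishes on every element interface. *)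

(* Defs.v *)
From HB Require Import structures.
From mathcomp Require Import all_boot all_order all_algebra.
From mathcomp Require Import all_classical all_reals all_analysis.
Import Order.TTheory GRing.Theory Num.Theory.
Import numFieldNormedType.Exports.

Set Implicit Arguments.
Unset Strict Implicit.
Unset Printing Implicit Defensive.

Local Open Scope classical_set_scope.
Local Open Scope ring_scope.

(* Points of the plane live in R * R, which carries the product Lebesgue      *)
(* measure; values of vector fields live in 'cV[R]_2.                         *)

Inductive vertex := V1 | V2 | V3.
Inductive edge := E12 | E13 | E23.

Definition ord_of_vertex (i : vertex) : 'I_3 :=
  match i with
  | V1 => @Ordinal 3 0 isT
  | V2 => @Ordinal 3 1 isT
  | V3 => @Ordinal 3 2 isT
  end.
Definition vertex_of_ord (k : 'I_3) : vertex :=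
  match val k with 0 => V1 | 1 => V2 | _ => V3 end.
Lemma ord_of_vertexK : cancel ord_of_vertex vertex_of_ord.
Proof. by case. Qed.

Definition ord_of_edge (j : edge) : 'I_3 :=
  match j with
  | E12 => @Ordinal 3 0 isT
  | E13 => @Ordinal 3 1 isT
  | E23 => @Ordinal 3 2 isT
  end.
Definition edge_of_ord (k : 'I_3) : edge :=
  match val k with 0 => E12 | 1 => E13 | _ => E23 end.
Lemma ord_of_edgeK : cancel ord_of_edge edge_of_ord.
Proof. by case. Qed.

HB.instance Definition _ := Countable.copy vertex (can_type ord_of_vertexK).
HB.instance Definition _ := Countable.copy edge (can_type ord_of_edgeK).

Lemma vertex_enumP : Finite.axiom [:: V1; V2; V3].
Proof. by case. Qed.
Lemma edge_enumP : Finite.axiom [:: E12; E13; E23].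
Proof. by case. Qed.

HB.instance Definition _ := fintype.isFinite.Build vertex vertex_enumP.
HB.instance Definition _ := fintype.isFinite.Build edge edge_enumP.

Definition lo (j : edge) : vertex :=
  match j with E12 => V1 | E13 => V1 | E23 => V2 end.
Definition hi (j : edge) : vertex :=
  match j with E12 => V2 | E13 => V3 | E23 => V3 end.

Section ReferenceTriangle.
Variable R : realType.

Definition Gamma : set (R * R) :=
  [set x | [/\ 0 <= x.1, 0 <= x.2 & x.1 + x.2 <= 1]].

Definition vpt (i : vertex) : R * R :=
  match i with V1 => (0, 0) | V2 => (0, 1) | V3 => (1, 0) end.

Definition edge_param (j : edge) (t : R) : R * R :=
  (1 - t) *: vpt (lo j) + t *: vpt (hi j).

Definition edge_set (j : edge) : set (R * R) := edge_param j @` `[0, 1].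

Definition vec (x : R * R) : 'cV[R]_2 :=
  \col_i (if i == 0 then x.1 else x.2).

Definition dotv (u v : 'cV[R]_2) : R := (u^T *m v) 0 0.

Definition tangent (j : edge) : 'cV[R]_2 := vec (vpt (hi j) - vpt (lo j)).

Definition Ppoly (p : nat) (f : R * R -> R) : Prop :=
  exists a : nat -> nat -> R, forall x,
    f x = \sum_(i < p.+1) \sum_(j < p.+1 | (i + j <= p)%N)
            a i j * x.1 ^+ i * x.2 ^+ j.

Definition lin_indep (I : finType) (V : lmodType R) (f : I -> R * R -> V) :=
  forall c : I -> R,
    (forall x, Gamma x -> \sum_i c i *: f i x = 0) -> forall i, c i = 0.

End ReferenceTriangle.

(* Indices of the scalar base functions: one per vertex, p - 1 per edge and   *)
(* (p - 2)(p - 1)/2 for the cell.  On a fixed edge the k-th base functions of *)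
(* different elements are the corresponding ones.                             *)
Definition scalar_idx (p : nat) : Type :=
  (vertex + edge * 'I_p.-1 + 'I_((p.-2 * p.-1)./2))%type.

Definition vertex_idx p (i : vertex) : scalar_idx p := inl (inl i).
Definition edge_idx p (j : edge) (k : 'I_p.-1) : scalar_idx p :=
  inl (inr (j, k)).
Definition cell_idx p (k : 'I_((p.-2 * p.-1)./2)) : scalar_idx p := inr k.

Section Meshes.
Variable R : realType.

Definition C1_on (D : set (R * R)) (f : R * R -> R * R) :=
  forall x, D x ->
    differentiable f x /\ forall v, {for x, continuous ('D_v f)}.

Definition Jacobian (f : R * R -> R * R) (x : R * R) : 'M[R]_2 :=
  \matrix_(i, k) vec ('D_(if k == 0 then (1, 0) else (0, 1)) f x) i 0.

(* The element maps are C^1 diffeomorphisms of a neighbourhood of Gamma onto  *)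
(* an open set; affine maps are a special case and both orientations of the   *)
(* elements occur.  On a shared edge the two parametrisations from the lower  *)
(* to the higher local vertex agree: for affine maps this just says that the  *)
(* local vertex orders agree.                                                 *)
Record mesh := Mesh {
  nelt : nat;
  dom : 'I_nelt -> set (R * R);
  emap : 'I_nelt -> R * R -> R * R;
  einv : 'I_nelt -> R * R -> R * R;
  dom_open : forall e, open (dom e);
  dom_Gamma : forall e, @Gamma R `<=` dom e;
  emap_open : forall e, open (emap e @` dom e);
  emapK : forall e x, dom e x -> einv e (emap e x) = x;
  emap_C1 : forall e, C1_on (dom e) (emap e);
  einv_C1 : forall e, C1_on (emap e @` dom e) (einv e);
  mesh_conforming : forall e e', e <> e' ->
    let I := emap e @` @Gamma R `&` emap e' @` @Gamma R in
    [\/ I = set0,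
        (exists i i', I = [set emap e (vpt R i)] /\
                      I = [set emap e' (vpt R i')]) |
        (exists j j', I = emap e @` edge_set j /\
                      I = emap e' @` edge_set j')];
  mesh_order : forall e j e' j',
    emap e @` edge_set j = emap e' @` edge_set j' ->
    forall t, 0 <= t <= 1 ->
      emap e (edge_param j t) = emap e' (edge_param j' t)
}.

Variable M : mesh.

Definition element (e : 'I_(nelt M)) : set (R * R) := emap e @` @Gamma R.

Definition mesh_domain : set (R * R) := \bigcup_e element e.

Definition shared_edge (e : 'I_(nelt M)) (j : edge) (e' : 'I_(nelt M))
    (j' : edge) : Prop :=
  emap e @` edge_set j = emap e' @` edge_set j'.

Definition piola (e : 'I_(nelt M)) (theta : R * R -> 'cV[R]_2) (x : R * R) :
    'cV[R]_2 :=
  (invmx (Jacobian (emap e) (einv e x)))^T *m theta (einv e x).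

End Meshes.

Section H1.
Variables (R : realType) (p : nat).

(* Scalar base functions of two elements that are identified on the mesh. *)
Definition same_scalar (M : mesh R) (e : 'I_(nelt M)) (s : scalar_idx p)
    (e' : 'I_(nelt M)) (s' : scalar_idx p) : Prop :=
  match s, s' with
  | inl (inl i), inl (inl i') => emap e (vpt R i) = emap e' (vpt R i')
  | inl (inr (j, k)), inl (inr (j', k')) => shared_edge e j e' j' /\ k = k'
  | inr k, inr k' => e = e' /\ k = k'
  | _, _ => False
  end.

Variable U : scalar_idx p -> R * R -> R.

(* Assembled functions are represented by their coefficients on each element, *)
(* which must coincide for identified base functions.                         *)
Definition H1_conforming :=
  forall (M : mesh R) (c : 'I_(nelt M) -> scalar_idx p -> R),
  (forall e s e' s', same_scalar e s e' s' -> c e s = c e' s') ->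
  forall e e' x, (element e `&` element e') x ->
    \sum_s c e s * U s (einv e x) = \sum_s c e' s * U s (einv e' x).

Record H1_conforming_basis : Prop := {
  basis_poly : forall s, Ppoly p (U s);
  basis_indep : lin_indep (U : scalar_idx p -> R * R -> R^o);
  basis_vertex_vertex : forall i i', i <> i' ->
    U (vertex_idx p i) (vpt R i') = 0;
  basis_vertex_edge : forall i j, i <> lo j -> i <> hi j ->
    forall x, edge_set j x -> U (vertex_idx p i) x = 0;
  basis_edge : forall j k j', j <> j' ->
    forall x, edge_set j' x -> U (edge_idx j k) x = 0;
  basis_cell : forall k j x, edge_set j x -> U (cell_idx k) x = 0;
  basis_conforming : H1_conforming
}.

End H1.

Section Hcurl.
Variable R : realType.

Definition plane_measure := (@lebesgue_measure R \x @lebesgue_measure R)%E.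

Fixpoint Ck (n : nat) (f : R * R -> R) : Prop :=
  match n with
  | 0 => continuous f
  | n'.+1 => (forall x, differentiable f x) /\ forall v, Ck n' ('D_v f)
  end.

Definition test_function (A : set (R * R)) (phi : R * R -> R) : Prop :=
  [/\ forall n, Ck n phi, compact (closure [set x | phi x != 0]) &
      closure [set x | phi x != 0] `<=` A°].

Definition L2 (A : set (R * R)) (f : R * R -> R) : Prop :=
  f \_ A \in Lfun plane_measure 2%:E.

(* w = u_{2,x} - u_{1,y} in the sense of distributions *)
Definition weak_curl (A : set (R * R)) (u : R * R -> 'cV[R]_2)
    (w : R * R -> R) : Prop :=
  forall phi, test_function A phi ->
    \int[plane_measure]_(x in A)
      (u x 0 0 * 'D_(0, 1) phi x - u x 1 0 * 'D_(1, 0) phi x)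
    = \int[plane_measure]_(x in A) (w x * phi x).

Definition Hcurl (A : set (R * R)) (u : R * R -> 'cV[R]_2) : Prop :=
  [/\ L2 A (fun x => u x 0 0), L2 A (fun x => u x 1 0) &
      exists2 w, L2 A w & weak_curl A u w].

End Hcurl.

Section Element.
Variables (R : realType) (p : nat).

Local Notation e1 := (delta_mx 0 0 : 'cV[R]_2).
Local Notation e2 := (delta_mx 1 0 : 'cV[R]_2).

Definition template (s : scalar_idx p) : 2.-tuple 'cV[R]_2 :=
  match s with
  | inl (inl V1) => [tuple e1; e2]
  | inl (inl V2) => [tuple e1 + e2; e1]
  | inl (inl V3) => [tuple e1 + e2; - e2]
  | inl (inr (E12, _)) => [tuple e2; - e1]
  | inl (inr (E13, _)) => [tuple e1; e2]
  | inl (inr (E23, _)) => [tuple 2^-1 *: (e1 - e2); e1 + e2]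
  | inr _ => [tuple e1; e2]
  end.

(* The index (s, k) stands for the product of the s-th scalar base function   *)
(* with the k-th vector of its template set.                                  *)
Definition idx : Type := (scalar_idx p * 'I_2)%type.

Definition base_function (U : scalar_idx p -> R * R -> R) (b : idx)
    (x : R * R) : 'cV[R]_2 :=
  U b.1 x *: tnth (template b.1) b.2.

(* Products belonging to the edge j; all the others belong to the cell. *)
Definition on_edge (j : edge) (b : idx) : Prop :=
  match b.1 with
  | inl (inl i) => i = lo j \/ i = hi j
  | inl (inr (j', _)) => j' = j
  | inr _ => False
  end /\ dotv (tangent R j) (tnth (template b.1) b.2) != 0.

Definition same_idx (M : mesh R) (e : 'I_(nelt M)) (b : idx)
    (e' : 'I_(nelt M)) (b' : idx) : Prop :=
  exists j j', [/\ shared_edge e j e' j', on_edge j b, on_edge j' b' &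
                   same_scalar e b.1 e' b'.1].

(* The piecewise field with coefficients c, set to zero on the element        *)
(* boundaries, which form a null set.                                         *)
Definition assembled (U : scalar_idx p -> R * R -> R) (M : mesh R)
    (c : 'I_(nelt M) -> idx -> R) (x : R * R) : 'cV[R]_2 :=
  \sum_e \1_((element e)°) x *:
    (\sum_b c e b *: piola e (base_function U b) x).

Definition Hcurl_conforming (U : scalar_idx p -> R * R -> R) :=
  forall (M : mesh R) (c : 'I_(nelt M) -> idx -> R),
  (forall e b e' b', same_idx e b e' b' -> c e b = c e' b') ->
  Hcurl (mesh_domain M) (assembled U c).

End Element.

(* Main.v *)
Require Import Defs.
From mathcomp Require Import all_boot all_order all_algebra.
From mathcomp Require Import all_classical all_reals all_analysis.
From mathcomp Require Import measurable_realfun.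
From mathcomp Require Import ring lra.
Import Order.TTheory GRing.Theory Num.Theory.
Import numFieldNormedType.Exports.

Set Implicit Arguments.
Unset Strict Implicit.
Unset Printing Implicit Defensive.

Local Open Scope classical_set_scope.
Local Open Scope ring_scope.

(** On one element with map [F], the Jacobian [J] pulls the pairing of the
    Piola field [u] with a test function [phi] back to the reference triangle:
    [(u x grad phi) o F * det J = theta x grad (phi o F)].  As [F] is only C^1,
    [u] itself cannot be differentiated, but Green's formula for the C^1 field
    [(phi o F) theta] yields the weak curl [(curl theta / det J) o F^-1] and
    boundary terms that involve only the tangential traces of [theta].  On an
    edge only the products belonging to it contribute to the trace, and the
    tangential component of their vectors is always 1; hence the traces agree
    on shared edges because the scalar base functions do.  Finally, an interior
    point of an edge that is interior to the domain lies on exactly two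
    elements, one on each side, so the boundary terms cancel in pairs;
    elsewhere on the edges [phi] vanishes.

    The change of variables under [F] is proved by bisection: the defect of the
    formula is additive over the four half-size triangles that form a triangle,
    so it vanishes as soon as it is of smaller order than the area at every
    point; there [F] maps a small triangle between two affine images of nearly
    the same area. *)

(** * The plane Lebesgue measure and affine maps *)

(** The mesh only prescribes how two elements may intersect. That an edge has one element on each
    side is therefore derived: a small step along the normal stays in the domain, hence in some
    element, and the first-order expansion of the inverse map tells on which side of the edge that
    element lies. Elements may have either orientation; [\det J] keeps its sign on the connected
    triangle, and this sign times that of the edge in the boundary of [Gamma] records the side. The
    cancellation is proved for each edge parameter [t] separately, under one integral, because
    whether an edge point is interior to the domain depends on [t]; the vertices, where many
    elements may meet, are the null set [t = 0, 1]. The change of variables needs similar care: the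
    assembled field lives on the open elements, whereas bisection needs half-open triangles for
    exact additivity. Both are covered by area estimates for every measurable set between the open
    and the closed triangle. *)

Section PlaneMeasure.
Variable R : realType.
Local Notation mR := (measurableTypeR R).

(** The sigma-algebra of the plane is generated by rectangles, so [O] is written as the countable
    union of the rational squares that it contains. *)
Lemma open_plane_measurable (O : set (R * R)) :
  open O -> measurable (O : set (mR * mR)).
Proof.
move=> oO.
pose box (q : rat * rat * rat) : set (mR * mR) :=
  ball (ratr q.1.1 : R) (ratr q.2) `*` ball (ratr q.1.2 : R) (ratr q.2).
have -> : O = \bigcup_q (if `[< box q `<=` O >] then box q else set0).
  apply/seteqP; split => [x Ox|x [q _]]; last first.
    by case: ifPn => // /asboolP; exact.
  have /nbhs_ballP[e /= e0 xe] := open_nbhs_nbhs (conj oO Ox).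
  have [r re] : exists r : rat, 0 < (ratr r : R) < e / 2.
    have [r] := @rat_in_itvoo R 0 (e / 2) (divr_gt0 e0 (ltr0Sn _ _)).
    by rewrite in_itv/= => re; exists r.
  have /andP[r0 re2] := re.
  have [q1] := @rat_in_itvoo R (x.1 - ratr r) (x.1 + ratr r) ltac:(lra).
  rewrite in_itv/= => /andP[q1l q1r].
  have [q2] := @rat_in_itvoo R (x.2 - ratr r) (x.2 + ratr r) ltac:(lra).
  rewrite in_itv/= => /andP[q2l q2r].
  exists (q1, q2, r) => //; case: ifPn => [_|/asboolP[]].
    split; rewrite /ball/= ltr_norml; lra.
  move=> y [/= y1 y2]; apply: xe; split.
    by move: y1; rewrite /ball/= !ltr_norml; lra.
  by move: y2; rewrite /ball/= !ltr_norml; lra.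
apply: countable_bigcupT_measurable; first exact: countableP.
move=> q; case: ifPn => // _.
by apply: measurableX; exact: measurable_ball.
Qed.

Lemma closed_plane_measurable (A : set (R * R)) :
  closed A -> measurable (A : set (mR * mR)).
Proof. by move/closed_openC/open_plane_measurable/measurableC;
  rewrite setCK. Qed.


Lemma continuous_measurable_fun_on (O : set (R * R)) (g : R * R -> R) :
  open O -> (forall x, O x -> {for x, continuous g}) ->
  measurable_fun (O : set (mR * mR)) g.
Proof.
move=> oO cg; apply: (measurability _ (RGenOpens.measurableE R)).
move=> _ [_ [a [b ->] <-]]; apply: open_plane_measurable.
rewrite openE => x [Ox /= gx]; apply: filterI.
  exact: open_nbhs_nbhs.
by apply: cg => //; apply: open_nbhs_nbhs; split=> //; exact: interval_open.
Qed.

Lemma continuous_measurable_pair_on (O : set (R * R)) (g : R * R -> R * R) :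
  open O -> (forall x, O x -> {for x, continuous g}) ->
  forall B : set (mR * mR), measurable B ->
  measurable (O `&` g @^-1` B : set (mR * mR)).
Proof.
move=> oO cg B mB.
(* Extending [g] by a constant off [O] gives a map on the whole plane, whose measurability can be
   checked on each coordinate; the intersection with [O] hides the chosen value. *)
pose h x := if `[< O x >] then g x else (0, 0).
have mO := open_plane_measurable oO.
have mh : measurable_fun setT (h : mR * mR -> mR * mR).
  have mk (k : R * R -> R) : k (0, 0) = 0 -> continuous k ->
      measurable_fun setT ((k \o h) : mR * mR -> mR).
    move=> k0 ck; rewrite (_ : _ \o _ = (k \o g) \_ O).
      apply/(measurable_restrictT (k \o g) mO).
      apply: continuous_measurable_fun_on => // x Ox.
      by apply: continuous_comp; [exact: cg|exact: ck].
    apply/funext => x; rewrite /= /h patchE.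
    by case: asboolP => Ox; [rewrite mem_set|rewrite memNset].
  apply/measurable_fun_pairP; split.
    by apply: (mk fst) => // x; exact: cvg_fst.
  by apply: (mk snd) => // x; exact: cvg_snd.
have -> : O `&` g @^-1` B = O `&` (h @^-1` B).
  apply/seteqP; split => x [Ox] /=; rewrite /h; case: asboolP => //.
by apply: measurableI => //; rewrite -[X in measurable X]setTI; exact: mh.
Qed.

End PlaneMeasure.

Section AffineMeasure.
Variable R : realType.
Local Notation mu := (@plane_measure R).
Local Notation lam := (@lebesgue_measure R).
Local Notation mR := (measurableTypeR R).

Lemma measurable_affine (a b : R) :
  measurable_fun setT ((fun x => a * x + b) : mR -> mR).
Proof.
by apply: continuous_measurable_fun => x; apply: cvgD; [apply: cvgM|];
  [exact: cvg_cst|exact: cvg_id|exact: cvg_cst].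
Qed.

(** The pushforward scaled by [|a|] gives each half-open interval its length, so it is Lebesgue
    measure. For [a < 0] the preimage of []c, d]] is open at the other end, which leaves its length
    unchanged. *)
Lemma lebesgue_measure_affine (a b : R) (B : set mR) : a != 0 ->
  measurable B ->
  lam ((fun x => a * x + b) @^-1` B) = ((`|a|^-1)%:E * lam B)%E.
Proof.
move=> a0 mB.
pose g : mR -> mR := fun x => a * x + b.
have mg : measurable_fun setT g := measurable_affine a b.
pose m : {measure set mR -> \bar R} :=
  measure_function_pushforward__canonical__measure_function_Measure lam mg.
have an0 : 0 < `|a| by rewrite normr_gt0.
have key : forall A, measurable A ->
    mscale `|a|%:nng m A = lam A.
  move=> A mA; apply/esym/lebesgue_measure_unique => //= _ [[c d] cd <-].
  rewrite /mscale/= /pushforward lebesgue_measure_itv/= lte_fin.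
  have [a_gt0|a_lt0|/eqP] := ltgtP 0 a; last by rewrite eq_sym (negbTE a0).
  - have -> : (fun x => a * x + b) @^-1` `]c, d] =
        `](c - b) / a, (d - b) / a]%classic.
      apply/seteqP; split => x /=; rewrite !in_itv/=.
        by rewrite ltr_pdivrMr// ler_pdivlMr//; lra.
      by rewrite ltr_pdivrMr// ler_pdivlMr//; lra.
    rewrite lebesgue_measure_itv/= lte_fin ltr_pM2r ?invr_gt0// ltrBlDr subrK.
    case: ifP => cd'; last by rewrite mule0.
    by rewrite gtr0_norm// -!EFinB -EFinM; congr EFin; field.
  - have -> : (fun x => a * x + b) @^-1` `]c, d] =
        `[(d - b) / a, (c - b) / a[%classic.
      apply/seteqP; split => x /=; rewrite !in_itv/=.
        by rewrite ltr_ndivlMr// ler_ndivrMr//; lra.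
      by rewrite ltr_ndivlMr// ler_ndivrMr//; lra.
    rewrite lebesgue_measure_itv/= lte_fin ltr_nM2r ?invr_lt0// ltrBlDr subrK.
    case: ifP => cd'; last by rewrite mule0.
    by rewrite ltr0_norm// -!EFinB -EFinM; congr EFin; field.
by rewrite -(key _ mB) /mscale/= muleA -EFinM mulVf ?mul1e// gt_eqF.
Qed.

(** Stated for preimages, which compose without any inverse map; [c] is the factor for images, hence
    the [c^-1]. *)
Definition scales_area (c : R) (f : R * R -> R * R) :=
  forall A : set (mR * mR), measurable A ->
  measurable (f @^-1` A : set (mR * mR)) /\
  mu (f @^-1` A) = ((c^-1)%:E * mu A)%E.

Lemma scales_area_comp c d f g :
  scales_area c f -> scales_area d g -> scales_area (c * d) (f \o g).
Proof.
move=> cf dg A mA; have [mfA fA] := cf A mA; have [mgA gA] := dg _ mfA.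
split; rewrite comp_preimage //.
by rewrite gA fA invfM muleA -EFinM mulrC.
Qed.

Lemma measurable_affine2 (a b c : R) :
  measurable_fun setT ((fun x => a * x.1 + b * x.2 + c) : mR * mR -> mR).
Proof.
apply: continuous_measurable_fun_on; first exact: openT.
move=> x _; apply: cvgD; last exact: cvg_cst.
by apply: cvgD; apply: cvgM; [exact: cvg_cst|exact: cvg_fst|
  exact: cvg_cst|exact: cvg_snd].
Qed.

(** By uniqueness of the product measure, areas can be computed from horizontal sections too, on
    which a map that changes only the first coordinate acts as a one-dimensional affine map. *)
Lemma plane_measure2E (A : set (mR * mR)) : measurable A ->
  mu A = (\int[lam]_y lam (ysection A y))%E.
Proof.
move=> mA; apply: (@product_measure_unique _ _ _ _ _ lam lam
  (product_measure2 lam lam)) => // B C mB mC.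
exact: product_measure2E.
Qed.

Lemma scales_area_fst (a b c : R) : a != 0 ->
  scales_area `|a| (fun x => (a * x.1 + b * x.2 + c, x.2)).
Proof.
move=> a0 A mA.
have mf : measurable_fun setT
    ((fun x => (a * x.1 + b * x.2 + c, x.2)) : mR * mR -> mR * mR).
  by apply: measurable_fun_pair; [exact: measurable_affine2|exact:
    measurable_snd].
have mfA : measurable ((fun x => (a * x.1 + b * x.2 + c, x.2)) @^-1` A
    : set (mR * mR)).
  by rewrite -[X in measurable X]setTI; exact: mf.
split => //; rewrite !plane_measure2E// -ge0_integralZl//; last first.
- exact: measurable_fun_ysection.
apply: eq_integral => y _.
rewrite -(@lebesgue_measure_affine a (b * y + c))//;
  last exact: measurable_ysection.
congr (lam _); apply/seteqP; split => x /=.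
  by move=> /ysectionP/= h; apply/ysectionP; rewrite addrA.
by move=> /ysectionP/= h; apply/ysectionP; rewrite /= -addrA.
Qed.

Lemma scales_area_snd (a b c : R) : a != 0 ->
  scales_area `|a| (fun x => (x.1, b * x.1 + a * x.2 + c)).
Proof.
move=> a0 A mA.
have mf : measurable_fun setT
    ((fun x => (x.1, b * x.1 + a * x.2 + c)) : mR * mR -> mR * mR).
  by apply: measurable_fun_pair; [exact: measurable_fst|exact:
    measurable_affine2].
have mfA : measurable ((fun x => (x.1, b * x.1 + a * x.2 + c)) @^-1` A
    : set (mR * mR)).
  by rewrite -[X in measurable X]setTI; exact: mf.
split => //; rewrite /plane_measure /product_measure1 -ge0_integralZl//;
  last first.
- exact: measurable_fun_xsection.
apply: eq_integral => x _ /=.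
rewrite -(@lebesgue_measure_affine a (b * x + c))//;
  last exact: measurable_xsection.
congr (lam _); apply/seteqP; split => y /=.
  by move=> /xsectionP/= h; apply/xsectionP; rewrite /= addrCA addrA.
by move=> /xsectionP/= h; apply/xsectionP; rewrite /= -addrA addrCA.
Qed.

(* A matrix with non-zero upper left entry is a product of two maps that change
   one coordinate only; otherwise a shear is applied first. *)
Lemma scales_area_affine (a b c d u v : R) : a * d - b * c != 0 ->
  scales_area `|a * d - b * c|
    (fun x => (a * x.1 + b * x.2 + u, c * x.1 + d * x.2 + v)).
Proof.
have main a' b' c' d' : a' != 0 -> a' * d' - b' * c' != 0 ->
    scales_area `|a' * d' - b' * c'|
      (fun x => (a' * x.1 + b' * x.2 + u, c' * x.1 + d' * x.2 + v)).
  move=> a0 det0.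
  have := scales_area_comp
    (@scales_area_snd ((a' * d' - b' * c') / a') (c' / a') (v - c' * u / a') _)
    (@scales_area_fst a' b' u a0).
  rewrite -normrM divfK// mulf_neq0 ?invr_eq0// => /(_ isT).
  congr (scales_area _ _); apply/funext => x /=; congr pair.
  by field.
have [->|a0 det0] := eqVneq a 0; last exact: main.
rewrite mul0r sub0r oppr_eq0 normrN => bc0.
have [b0 c0] : b != 0 /\ c != 0 by apply/andP; rewrite -negb_or -mulf_eq0.
have := scales_area_comp (@main b b (c + d) d b0 _)
    (@scales_area_snd 1 (-1) 0 (oner_neq0 _)).
have -> : b * d - b * (c + d) = - (b * c) by ring.
rewrite oppr_eq0 normrN normr1 mulr1 => /(_ bc0).
by congr (scales_area _ _); apply/funext => x /=; congr pair; ring.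
Qed.

Lemma plane_measure_affine_image (a b c d u v : R) (A : set (mR * mR)) :
  a * d - b * c != 0 -> measurable A ->
  let f x : mR * mR := (a * x.1 + b * x.2 + u, c * x.1 + d * x.2 + v) in
  measurable (f @` A) /\ mu (f @` A) = (`|a * d - b * c|%:E * mu A)%E.
Proof.
move=> D0 mA f; set D := _ - _ in D0 *.
(* The inverse map by Cramer's rule; it turns the image under [f] into a preimage. *)
pose g (y : R * R) : R * R := (d / D * y.1 + (- b / D) * y.2 + (b * v - d * u)
  / D,
   (- c / D) * y.1 + (a / D) * y.2 + (c * u - a * v) / D).
have gf x : g (f x) = x.
  by rewrite /g /f/= [RHS]surjective_pairing; congr pair; rewrite /D; field.
have fg x : f (g x) = x.
  by rewrite /g /f/= [RHS]surjective_pairing; congr pair; rewrite /D; field.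
have -> : f @` A = g @^-1` A.
  apply/seteqP; split => [_ [x Ax <-]|y /= Ay]; first by rewrite /= gf.
  by exists (g y).
have det : d / D * (a / D) - (- b / D) * (- c / D) = D^-1 by rewrite /D; field.
have := @scales_area_affine (d / D) (- b / D) (- c / D) (a / D)
  ((b * v - d * u) / D) ((c * u - a * v) / D).
rewrite det invr_eq0 => /(_ D0 A mA); rewrite -/g.
by rewrite normfV invrK.
Qed.

End AffineMeasure.

(** * Change of variables for C^1 diffeomorphisms *)

Section Bisection.
Variable R : realType.
Local Notation Gamma := (@Gamma R).
Implicit Types (a x z : R * R) (s : R).

Lemma closed_Gamma : closed Gamma.
Proof.
have -> : Gamma = (fst @^-1` [set t : R | 0 <= t] `&` snd @^-1` [set t : R | 0
  <= t])
   `&` (fun x : R * R => x.1 + x.2) @^-1` [set t : R | t <= 1].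
  by apply/seteqP; split => x /=; [case|case=> -[]].
apply: closedI; first apply: closedI.
- by apply: closed_comp => [x _|]; [exact: cvg_fst|exact: closed_ge].
- by apply: closed_comp => [x _|]; [exact: cvg_snd|exact: closed_ge].
- apply: closed_comp => [x _|]; last exact: closed_le.
  by apply: cvgD; [exact: cvg_fst|exact: cvg_snd].
Qed.

Lemma compact_Gamma : compact Gamma.
Proof.
apply: (subclosed_compact closed_Gamma
  (compact_setX (@segment_compact R 0 1) (@segment_compact R 0 1))).
by move=> x [x1 x2 x12]; split; rewrite /= in_itv/=; lra.
Qed.

(** All triangles of the bisection have the form [a + s *: Gamma]; a negative [s] gives those that
    are turned upside down. *)
Definition tri_coord a s x : R * R := ((x.1 - a.1) / s, (x.2 - a.2) / s).

Definition closed_tri a s : set (R * R) := tri_coord a s @^-1` Gamma.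

(* Half-open so that the four half-size parts of a triangle are disjoint. *)
Definition tri a s : set (R * R) := [set x |
  if 0 < s then [&& a.1 <= x.1, a.2 <= x.2 & x.1 + x.2 < a.1 + a.2 + s]
  else [&& x.1 < a.1, x.2 < a.2 & a.1 + a.2 + s <= x.1 + x.2]].

(** The last part is the middle triangle: its right-angled corner is the midpoint of the hypotenuse,
    and its scale has the opposite sign. *)
Definition subtri (k : 'I_4) a s : (R * R) * R :=
  match val k with
  | 0 => (a, s / 2)
  | 1 => ((a.1 + s / 2, a.2), s / 2)
  | 2 => ((a.1, a.2 + s / 2), s / 2)
  | _ => ((a.1 + s / 2, a.2 + s / 2), - (s / 2))
  end.

Lemma subtri_scale k a s : `|(subtri k a s).2| = `|s| / 2.
Proof.
have h : `|s / 2| = `|s| / 2 by rewrite normrM normfV (ger0_norm (ler0n _ 2)).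
by case: k => -[|[|[|k]]] ? //=; rewrite normrN.
Qed.

Lemma subtri_scale_neq0 k a s : s != 0 -> (subtri k a s).2 != 0.
Proof. by rewrite -!normr_gt0 subtri_scale => ?; exact: divr_gt0. Qed.

Lemma closed_tri_closed a s : closed (closed_tri a s).
Proof.
apply: closed_comp; last exact: closed_Gamma.
move=> x _; apply: (@cvg_pair _ _ _ _ (nbhs ((x.1 - a.1) / s)) (nbhs ((x.2 -
  a.2) / s))).
  by apply: cvgMl; apply: cvgB; [exact: cvg_fst|exact: cvg_cst].
by apply: cvgMl; apply: cvgB; [exact: cvg_snd|exact: cvg_cst].
Qed.

Lemma subtri_closed_tri k a s : s != 0 ->
  closed_tri (subtri k a s).1 (subtri k a s).2 `<=` closed_tri a s.
Proof.
move=> s0 x; rewrite /closed_tri/=.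
have E u v : (u - v) / s = (((u - v) / (s / 2)) / 2) by field.
have E1 u v : (u - v) / s = (((u - (v + s / 2)) / (s / 2)) / 2) + 2^-1 by field.
have E2 u v : (u - v) / s = 2^-1 - (((u - (v + s / 2)) / (- (s / 2))) / 2).
  by field.
case: k => -[|[|[|k]]] ? [] /=; rewrite /tri_coord/=.
- rewrite /tri_coord /= (E x.1) (E x.2) => *; split => /=; lra.
- rewrite /tri_coord /= (E1 x.1) (E x.2) => *; split => /=; lra.
- rewrite /tri_coord /= (E x.1) (E1 x.2) => *; split => /=; lra.
- rewrite /tri_coord /= (E2 x.1) (E2 x.2) => *; split => /=; lra.
Qed.

(* As in Goursat's lemma: otherwise nested triangles of defect at least
   proportional to their area shrink to a point. *)
Lemma bisection (E : R * R -> R -> R) :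
  (forall a s, s != 0 -> closed_tri a s `<=` Gamma ->
    E a s = \sum_k E (subtri k a s).1 (subtri k a s).2) ->
  (forall x0, Gamma x0 -> forall e : R, 0 < e -> exists2 d : R, 0 < d &
    forall a s, s != 0 -> `|s| < d -> closed_tri a s `<=` Gamma ->
      closed_tri a s x0 -> `|E a s| <= e * s ^+ 2) ->
  E (0, 0) 1 = 0.
Proof.
move=> Eadd Esmall; apply/eqP/negPn/negP => E0.
pose e := `|E (0, 0) 1|; have e0 : 0 < e by rewrite normr_gt0.
pose P (q : (R * R) * R) := [/\ q.2 != 0, closed_tri q.1 q.2 `<=` Gamma &
   e * q.2 ^+ 2 <= `|E q.1 q.2|].
(* The existential stands outside the implication so that [choice] yields a total selector. *)
have step q : exists k, P q -> P (subtri k q.1 q.2).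
  have [[q0 qG qE]|nP] := pselect (P q); last by exists ord0.
  apply: contrapT => /forallNP noP.
  have : `|E q.1 q.2| < \sum_(k < 4) (e * q.2 ^+ 2 / 4).
    rewrite Eadd//; apply: (le_lt_trans (ler_norm_sum _ _ _)).
    apply: ltr_sum; first by apply/hasP; exists ord0; rewrite ?mem_index_enum.
    move=> k _; rewrite ltNge; apply/negP => le; apply: (noP k) => _; split.
    + exact: subtri_scale_neq0.
    + by apply: subset_trans qG; exact: subtri_closed_tri.
    + apply: le_trans le; rewrite -[_ ^+ 2]real_normK ?num_real// subtri_scale.
      by rewrite expr_div_n real_normK ?num_real//; lra.
  by rewrite sumr_const card_ord -mulr_natr; lra.
have [h hP] := choice step.
pose q := fix q n := if n is n'.+1 then subtri (h (q n')) (q n').1 (q n').2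
                     else ((0, 0), 1) : (R * R) * R.
have Pq n : P (q n).
  elim: n => [|n IH] /=; last exact: hP.
  split => //=; first by move=> x;
    rewrite /closed_tri/= /tri_coord/= !subr0 !divr1.
  by rewrite expr1n mulr1.
have qs n : `|(q n).2| = 2^-1 ^+ n.
  elim: n => [|n IH] /=; first by rewrite normr1 expr0.
  by rewrite subtri_scale IH exprSr.
pose T n := closed_tri (q n).1 (q n).2.
have TS m n : (m <= n)%N -> T n `<=` T m.
  elim: n => [|n IH]; first by rewrite leqn0 => /eqP ->.
  rewrite leq_eqVlt => /predU1P[->//|/IH]; apply: subset_trans.
  by apply: subtri_closed_tri; case: (Pq n).
have Tn0 n : T n !=set0.
  have [s0 _ _] := Pq n; exists (q n).1.
  by rewrite /T /closed_tri/= /tri_coord !subrr !mul0r; split => //=;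
    rewrite addr0.
(* The nested triangles generate a proper filter; a cluster point of it in the compact [Gamma] lies
   in all of them, since they are closed. *)
pose F := filter_from setT T.
have FF : ProperFilter F.
  apply: filter_from_proper; last by move=> n _; exact: Tn0.
  apply: filter_from_filter; first by exists 0%N.
  move=> m n _ _; exists (maxn m n) => // x Tx.
  by split; apply: TS Tx; rewrite ?leq_maxl ?leq_maxr.
have [|x0 [Gx0 x0F]] := @compact_Gamma F FF.
  by exists 0%N => //; case: (Pq 0%N).
have Tx0 n : T n x0.
  apply: closed_tri_closed; move: x0F; rewrite clusterE => /(_ (T n)); apply.
  by exists n.
have [d d0 small] := Esmall _ Gx0 _ (divr_gt0 e0 (ltr0Sn R 1)).
have [n nd] : exists n, (2^-1 : R) ^+ n < d.
  have /cvgrPdist_lt /(_ _ d0) [n _ /(_ n (leqnn n))] :=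
    @cvg_expr R 2^-1 ltac:(rewrite ger0_norm ?invr_ge0//; lra).
  by rewrite sub0r normrN ger0_norm ?exprn_ge0 ?invr_ge0// => ?; exists n.
have [s0 sG sE] := Pq n.
have := small (q n).1 _ s0; rewrite qs => /(_ nd sG (Tx0 n)).
move/(le_trans sE); apply/negP; rewrite -ltNge.
have : 0 < (q n).2 ^+ 2 by rewrite exprn_even_gt0.
by move=> h2; rewrite ltr_pM2r//; lra.
Qed.

End Bisection.

(** * Differentials of plane maps as matrices *)

Section PlaneDifferential.
Variable R : realType.
Implicit Types (f g : R * R -> R * R) (x y v : R * R).

(** Matrices act on [R * R], the type of points, which carries the norm and the measure, instead of
    on column vectors. *)
Definition mxapp (J : 'M[R]_2) v : R * R :=
  (J 0 0 * v.1 + J 0 1 * v.2, J 1 0 * v.1 + J 1 1 * v.2).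

Lemma det_mx22 (J : 'M[R]_2) : \det J = J 0 0 * J 1 1 - J 0 1 * J 1 0.
Proof.
rewrite (expand_det_row _ ord0) !big_ord_recl big_ord0 addr0.
rewrite /cofactor !det_mx11 !mxE /= expr0 expr1 mul1r mulN1r.
by rewrite mulrN; congr (_ * J _ _ - J _ _ * J _ _); apply/val_inj.
Qed.

Lemma pair_decomp v : v = v.1 *: ((1, 0) : R * R) + v.2 *: ((0, 1) : R * R).
Proof.
case: v => a b; rewrite /GRing.scale/= /GRing.add/=.
by rewrite /add_pair/= /scale_pair/= /GRing.scale/= !mulr0 !mulr1 addr0 add0r.
Qed.

Lemma JacobianE f x :
  [/\ Jacobian f x 0 0 = ('D_(1, 0) f x).1, Jacobian f x 1 0 = ('D_(1, 0) f
    x).2,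
      Jacobian f x 0 1 = ('D_(0, 1) f x).1 & Jacobian f x 1 1 = ('D_(0, 1) f
        x).2].
Proof. by split; rewrite /Jacobian /vec mxE /= mxE. Qed.

Lemma scale_pairE (c : R) v : c *: v = (c * v.1, c * v.2).
Proof. by []. Qed.

Lemma add_pairE v x : v + x = (v.1 + x.1, v.2 + x.2).
Proof. by []. Qed.

Lemma diff_mxapp f x v : differentiable f x -> 'd f x v = mxapp (Jacobian f x)
  v.
Proof.
move=> df; have [J00 J10 J01 J11] := JacobianE f x.
rewrite {1}(pair_decomp v) linearD !linearZZ -!deriveE// /mxapp J00 J10 J01 J11.
move: ('D_(1, 0) f x) ('D_(0, 1) f x) => a b.
by rewrite !scale_pairE add_pairE /= !(mulrC v.1) !(mulrC v.2).
Qed.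

Lemma diff_approx f x (e : R) : differentiable f x -> 0 < e ->
  \forall y \near x, `|f y - f x - mxapp (Jacobian f x) (y - x)| <= e * `|y -
    x|.
Proof.
move=> df e0; have /diff_locally/eqaddoP/(_ _ e0) := df.
move=> H.
have : \forall h \near (0 : R * R), `|f (h + x) - f x - mxapp (Jacobian f x) h|
  <= e * `|h|.
  near=> h; rewrite -diff_mxapp// -addrA -opprD.
  by near: h.
rewrite [X in _ -> X](near_shift 0 x) subr0.
by apply: filterS => h /=; rewrite addrK.
Unshelve. all: by end_near. Qed.

End PlaneDifferential.

Section MxApp.
Variable R : realType.
Implicit Types (J : 'M[R]_2) (v w : R * R).

Lemma norm_pair_le v (c : R) : `|v| <= c <-> `|v.1| <= c /\ `|v.2| <= c.
Proof. by rewrite prod_normE ge_max; split => /andP. Qed.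

Lemma norm_pair_lt v (c : R) : `|v| < c <-> `|v.1| < c /\ `|v.2| < c.
Proof. by rewrite prod_normE gt_max; split => /andP. Qed.

Lemma mxapp_mul J J' v : mxapp J (mxapp J' v) = mxapp (J *m J') v.
Proof.
rewrite /mxapp !mxE !big_ord_recl !big_ord0 /=.
have -> : lift ord0 ord0 = 1 :> 'I_2 by apply/val_inj.
by congr pair; ring.
Qed.

Lemma mxapp1 v : mxapp 1%:M v = v.
Proof. by rewrite /mxapp !mxE /= !mul1r !mul0r addr0 add0r -surjective_pairing.
  Qed.

Lemma mxappD J v w : mxapp J (v + w) = mxapp J v + mxapp J w.
Proof. by rewrite /mxapp !add_pairE /=; congr pair; ring. Qed.

Lemma mxappZ J (c : R) v : mxapp J (c *: v) = c *: mxapp J v.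
Proof. by rewrite /mxapp !scale_pairE /=; congr pair; ring. Qed.

(** A crude bound of the operator norm for the maximum norm; the summand 1 keeps it positive, so
    that tolerances can be divided by it. *)
Definition mxbound J : R := 1 + \sum_i \sum_j `|J i j|.

Lemma mxbound_gt0 J : 0 < mxbound J.
Proof.
by rewrite ltr_pwDl// sumr_ge0// => i _; rewrite sumr_ge0.
Qed.

Lemma mxapp_bound J v : `|mxapp J v| <= mxbound J * `|v|.
Proof.
have [v1 v2] := (norm_pair_le v _).1 (lexx _).
have B (i : 'I_2) : `|J i 0 * v.1 + J i 1 * v.2| <= mxbound J * `|v|.
  apply: (@le_trans _ _ (`|J i 0| * `|v| + `|J i 1| * `|v|)).
    by rewrite (le_trans (ler_normD _ _))// !normrM lerD// ler_wpM2l.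
  rewrite -mulrDl ler_wpM2r// /mxbound.
  have -> : `|J i 0| + `|J i 1| = \sum_j `|J i j|.
    by rewrite !big_ord_recl big_ord0 addr0; congr (_ + `|J _ _|);
      apply/val_inj.
  rewrite [X in _ <= 1 + X](bigD1 i)//= addrCA lerDl addr_ge0// sumr_ge0// => k
    _.
  by rewrite sumr_ge0.
by apply/norm_pair_le; split; exact: B.
Qed.

Lemma Jacobian_inverse (F G : R * R -> R * R) (x : R * R) :
  differentiable F x -> differentiable G (F x) ->
  (\forall y \near x, G (F y) = y) ->
  Jacobian G (F x) *m Jacobian F x = 1%:M.
Proof.
move=> dF dG GF.
have dGF : differentiable (G \o F) x by exact: differentiable_comp.
have H v : mxapp (Jacobian G (F x) *m Jacobian F x) v = v.
  rewrite -mxapp_mul -!diff_mxapp//.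
  rewrite -[LHS]/(('d G (F x) \o 'd F x) v) -diff_comp// -deriveE//.
  have [->|v0] := eqVneq v 0; first by rewrite derive0.
  by rewrite (@near_eq_derive _ _ _ _ id)// deriveE// diff_val.
move: (_ *m _) H => M H; apply/matrixP => i j.
have := H (1, 0); have := H (0, 1).
rewrite /mxapp !mxE/= !mulr0 !mulr1 !add0r !addr0 => -[h01 h11] [h00 h10].
have : i = 0 \/ i = 1 by case: i => -[|[|//]] ?; [left|right]; apply/val_inj.
have : j = 0 \/ j = 1 by case: j => -[|[|//]] ?; [left|right]; apply/val_inj.
by case=> -> [] ->; rewrite ?h00 ?h01 ?h10 ?h11.
Qed.

End MxApp.

(** * Images of small triangles under a diffeomorphism *)

Section Diffeomorphism.
Variable R : realType.
Local Notation mu := (@plane_measure R).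
Local Notation Gamma := (@Gamma R).
Local Notation mR := (measurableTypeR R).

Definition C1_diffeo (D : set (R * R)) (F G : R * R -> R * R) : Prop :=
  [/\ open D, open (F @` D), (forall x, D x -> G (F x) = x), C1_on D F &
      C1_on (F @` D) G].

Definition open_Gamma : set (R * R) :=
  [set x | [/\ 0 < x.1, 0 < x.2 & x.1 + x.2 < 1]].

Definition open_tri (a : R * R) (s : R) := tri_coord a s @^-1` open_Gamma.

Lemma tri_coordK (a : R * R) (s : R) x : s != 0 -> x = a + s *: tri_coord a s x.
Proof.
move=> s0; rewrite scale_pairE add_pairE /tri_coord/= [LHS]surjective_pairing.
by congr pair; field.
Qed.

Lemma tri_coord_inv (a : R * R) (s : R) z : s != 0 -> tri_coord a s (a + s *:
  z) = z.
Proof.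
move=> s0; rewrite scale_pairE add_pairE /tri_coord/= [RHS]surjective_pairing.
by congr pair; field.
Qed.

Lemma closed_triP (a : R * R) (s : R) x : s != 0 ->
  closed_tri a s x -> exists2 z, Gamma z & x = a + s *: z.
Proof. by move=> s0 ax; exists (tri_coord a s x) => //; exact: tri_coordK. Qed.

Lemma open_tri_tri (a : R * R) (s : R) : s != 0 -> open_tri a s `<=` tri a s.
Proof.
move=> s0 x; rewrite {2}(tri_coordK a x s0) /open_tri /=.
move: (tri_coord a s x) => z [z1 z2 z12]; rewrite scale_pairE add_pairE /tri/=.
have z12' : 0 < 1 - (z.1 + z.2) by rewrite subr_gt0.
have [s_gt0|s_lt0] := ltP 0 s.
  have := mulr_gt0 s_gt0 z1; have := mulr_gt0 s_gt0 z2.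
  have := mulr_gt0 s_gt0 z12' => *; apply/and3P; split; nra.
have {s0}s_lt0 : 0 < - s by rewrite oppr_gt0 lt_neqAle s0.
have := mulr_gt0 s_lt0 z1; have := mulr_gt0 s_lt0 z2.
have := mulr_gt0 s_lt0 z12' => *; apply/and3P; split; nra.
Qed.

Lemma tri_closed_tri (a : R * R) (s : R) : s != 0 -> tri a s `<=` closed_tri a
  s.
Proof.
move=> s0 x; rewrite {1}(tri_coordK a x s0) /closed_tri /=.
move: (tri_coord a s x) => z; rewrite scale_pairE add_pairE /tri/=.
have [s_gt0|s_lt0] := ltP 0 s.
  move=> /and3P[h1 h2 h3]; split.
  - by rewrite -(pmulr_rge0 _ s_gt0); lra.
  - by rewrite -(pmulr_rge0 _ s_gt0); lra.
  - by rewrite -(ler_pM2l s_gt0); lra.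
have {s0}s_lt0 : s < 0 by rewrite lt_neqAle s0.
move=> /and3P[h1 h2 h3]; split.
- by rewrite -(nmulr_rle0 _ s_lt0); lra.
- by rewrite -(nmulr_rle0 _ s_lt0); lra.
- by rewrite -(ler_nM2l s_lt0); lra.
Qed.

Lemma open_triS (a : R * R) (s : R) : open_tri a s `<=` closed_tri a s.
Proof. by move=> x [x1 x2 x12]; split; rewrite ltW. Qed.

Lemma Gamma_dist (z w : R * R) : Gamma z -> Gamma w -> `|z - w| <= 1.
Proof.
move=> [z1 z2 z12] [w1 w2 w12]; apply/norm_pair_le.
by split; rewrite ler_norml /=; lra.
Qed.

(* Contains, if [0 < e], the [e]-neighbourhood of [Gamma] and, if [e < 0], only
   points at distance at least [- e] from the boundary of [Gamma]. *)
Definition dilated_Gamma (e : R) : set (R * R) :=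
  (fun z : R * R => (- e, - e) + (1 + 4 * e) *: z) @` Gamma.

(** The [4 * e] comes from the hypotenuse: a move by [e] in the maximum norm changes the sum of the
    coordinates by up to [2 * e], and shifting the corner to [(- e, - e)] costs another [2 * e]. *)
Lemma dilated_GammaS (e : R) z w : 0 < e -> Gamma z -> `|w| <= e ->
  dilated_Gamma e (z + w).
Proof.
move=> e0 [z1 z2 z12] /norm_pair_le;
  rewrite !ler_norml => -[/andP[? ?] /andP[? ?]].
have e4 : 1 + 4 * e != 0 by lra.
exists (((z.1 + w.1) + e) / (1 + 4 * e), ((z.2 + w.2) + e) / (1 + 4 * e)).
  split => /=; [apply: divr_ge0; lra|apply: divr_ge0; lra|].
  by rewrite -mulrDl ler_pdivrMr; lra.
rewrite scale_pairE !add_pairE/=; congr pair; field; exact: e4.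
Qed.

Lemma dilated_GammaN (e : R) z w : 0 < e -> e < 4^-1 -> dilated_Gamma (- e) z ->
  `|w| < e -> open_Gamma (z + w).
Proof.
move=> e0 e4 [v [v1 v2 v12] <-] /norm_pair_lt.
rewrite !ltr_norml => -[/andP[? ?] /andP[? ?]].
by rewrite scale_pairE !add_pairE/=; split => /=; nra.
Qed.

Lemma dilated_GammaNS (e : R) : 0 < e -> e < 4^-1 -> dilated_Gamma (- e) `<=`
  Gamma.
Proof.
move=> e0 e4 _ [v [v1 v2 v12] <-].
by rewrite scale_pairE !add_pairE/=; split => /=; nra.
Qed.

Variables (D : set (R * R)) (F G : R * R -> R * R).
Hypothesis FG : C1_diffeo D F G.

Let oD : open D. Proof. by case: FG. Qed.
Let oFD : open (F @` D). Proof. by case: FG. Qed.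
Let FK x : D x -> G (F x) = x. Proof. by case: FG => ? ? H _ _; exact: H. Qed.
Let dF x : D x -> differentiable F x.
Proof. by case: FG => ? ? _ H _ /H[]. Qed.
Let dG x : D x -> differentiable G (F x).
Proof. by case: FG => ? ? _ _ H Dx; case: (H (F x)) => //; exists x. Qed.

Lemma diffeo_image S : S `<=` D -> F @` S = F @` D `&` G @^-1` S.
Proof.
move=> SD; apply/seteqP; split => [_ [x Sx <-]|_ [[x Dx <-]] /=].
  by split; [exists x => //; exact: SD|rewrite /= FK//; exact: SD].
by rewrite FK// => Sx; exists x.
Qed.

Lemma diffeo_measurable_image (S : set (mR * mR)) : S `<=` D -> measurable S ->
  measurable (F @` S : set (mR * mR)).
Proof.
move=> SD mS; rewrite diffeo_image//.
apply: continuous_measurable_pair_on => // y [x Dx <-].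
exact: differentiable_continuous (dG Dx).
Qed.

Lemma diffeo_Jacobian_inverse x : D x ->
  Jacobian G (F x) *m Jacobian F x = 1%:M.
Proof.
move=> Dx; apply: Jacobian_inverse; [exact: dF|exact: dG|].
by near=> y; apply: FK; near: y; exact: open_nbhs_nbhs.
Unshelve. all: by end_near. Qed.

Lemma diffeo_det_neq0 x : D x -> \det (Jacobian F x) != 0.
Proof.
move=> /diffeo_Jacobian_inverse; move: (Jacobian F x) (Jacobian G _) => M N.
by move=> /mulmx1C/mulmx1_unit[+ _]; rewrite unitmxE unitfE.
Qed.

Lemma diffeo_sandwich x0 (e : R) : D x0 -> 0 < e -> e < 4^-1 ->
  exists2 d : R, 0 < d &
  forall a s, s != 0 -> `|s| < d -> closed_tri a s x0 ->
  forall S, open_tri a s `<=` S -> S `<=` closed_tri a s -> S `<=` D ->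
  let aff z := F x0 + mxapp (Jacobian F x0) (a + s *: z - x0) in
  aff @` dilated_Gamma (- e) `<=` F @` S /\ F @` S `<=` aff @` dilated_Gamma e.
Proof.
move=> Dx0 e0 e4.
have JiJ0 := diffeo_Jacobian_inverse Dx0.
have apF (c : R) : 0 < c -> exists2 d : R, 0 < d & forall x, `|x0 - x| < d ->
    `|F x - F x0 - mxapp (Jacobian F x0) (x - x0)| <= c * `|x - x0|.
  move=> c0; have /nbhs_ballP[d /= d0 H] := diff_approx (dF Dx0) c0.
  by exists d => // x xd; apply: H; rewrite -ball_normE.
have apG (c : R) : 0 < c -> exists2 d : R, 0 < d & forall y, `|F x0 - y| < d ->
    (F @` D) y /\
    `|G y - G (F x0) - mxapp (Jacobian G (F x0)) (y - F x0)| <= c * `|y - F x0|.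
  move=> c0.
  have nD : nbhs (F x0) (F @` D) by apply: open_nbhs_nbhs; split => //;
    exists x0.
  have : nbhs (F x0) (F @` D `&` [set y | `|G y - G (F x0) -
      mxapp (Jacobian G (F x0)) (y - F x0)| <= c * `|y - F x0|]).
    by apply: filterI => //; exact: diff_approx (dG Dx0) c0.
  move=> /nbhs_ballP[d /= d0 H].
  by exists d => // y yd; apply: H; rewrite -ball_normE.
move: (Jacobian F x0) (Jacobian G (F x0)) JiJ0 apF apG => J Ji JiJ0 apF apG.
have JiJ v : mxapp Ji (mxapp J v) = v by rewrite mxapp_mul JiJ0 mxapp1.
have JJi v : mxapp J (mxapp Ji v) = v.
  by rewrite mxapp_mul (mulmx1C JiJ0) mxapp1.
have [C C0 HC] : exists2 C : R, 0 < C & forall v, `|mxapp J v| <= C * `|v|.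
  by exists (mxbound J); [exact: mxbound_gt0|exact: mxapp_bound].
have [Ci Ci0 HCi] : exists2 C : R, 0 < C & forall v, `|mxapp Ji v| <= C * `|v|.
  by exists (mxbound Ji); [exact: mxbound_gt0|exact: mxapp_bound].
(* For the outer inclusion the remainder of [F] is pulled back by [Ji], at the cost of a factor
   [Ci]. For the inner one the argument of [G] moves by up to [C * |s|]; the extra 2 in the
   tolerance makes the final bound strict. *)
have [d1 d10 H1] := apF _ (divr_gt0 e0 Ci0).
have [d2 d20 H2] := apG _ (divr_gt0 e0 (mulr_gt0 (ltr0Sn R 1) C0)).
exists (Num.min d1 (d2 / C)); first by rewrite lt_min d10 divr_gt0.
move=> a s s0; rewrite lt_min => /andP[sd1 sd2] x0T S oS Sc SD aff.
have [z0 Gz0 x0E] := closed_triP s0 x0T.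
have near_x0 z : Gamma z -> `|a + s *: z - x0| <= `|s|.
  move=> Gz; rewrite x0E opprD addrACA subrr add0r -scalerBr normrZ.
  by rewrite ler_piMr// Gamma_dist.
split => [_ [z' dz' <-]|_ [x Sx <-]].
  have Gz' := dilated_GammaNS e0 e4 dz'.
  have yx0 : `|aff z' - F x0| <= C * `|s|.
    rewrite /aff addrC addKr; apply: (le_trans (HC _)).
    by rewrite ler_pM2l// near_x0.
  have [|[x Dx xE]] := H2 (aff z').
    by rewrite distrC (le_lt_trans yx0)// mulrC -ltr_pdivlMr.
  have -> : mxapp Ji (aff z' - F x0) = a + s *: z' - x0.
    by rewrite /aff addrC addKr JiJ.
  rewrite -xE !FK// xE => H; exists x => //.
  apply: oS; rewrite /open_tri/=.
  pose w := s^-1 *: (x - (a + s *: z')).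
  have -> : tri_coord a s x = z' + w.
    rewrite -[RHS](tri_coord_inv a _ s0); congr tri_coord.
    by rewrite /w scalerDr scalerA mulfV// scale1r addrA addrC subrK.
  apply: (dilated_GammaN e0 e4 dz').
  rewrite /w normrZ normfV ltr_pdivrMl ?normr_gt0// mulrC.
  have -> : x - (a + s *: z') = x - x0 - (a + s *: z' - x0) by rewrite opprB
    addrA subrK.
  apply: (le_lt_trans H).
  apply: (@le_lt_trans _ _ (e / (2 * C) * (C * `|s|))).
    by rewrite ler_wpM2l// divr_ge0// ?ltW// mulr_gt0.
  have -> : e / (2 * C) * (C * `|s|) = e / 2 * `|s| by field; rewrite gt_eqF.
  by rewrite ltr_pM2r ?normr_gt0//; lra.
have [z Gz xE] := closed_triP s0 (Sc _ Sx).
have xx0 : `|x - x0| <= `|s| by rewrite xE near_x0.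
have H := H1 x; rewrite distrC in H.
have {}H := H (le_lt_trans xx0 sd1).
pose r := F x - F x0 - mxapp J (x - x0).
exists (z + s^-1 *: mxapp Ji r).
  apply: dilated_GammaS => //; rewrite normrZ normfV ler_pdivrMl ?normr_gt0//.
  apply: (le_trans (HCi _)).
  apply: (@le_trans _ _ (Ci * (e / Ci * `|s|))).
    rewrite ler_pM2l//; apply: (le_trans H).
    by rewrite ler_wpM2l// divr_ge0 ?ltW.
  by rewrite mulrA mulrCA mulfV ?gt_eqF// mulr1 mulrC.
rewrite /aff scalerDr scalerA mulfV// scale1r addrA -xE addrAC mxappD JJi /r.
by rewrite [X in _ + X]addrC subrK addrC subrK.
Qed.

End Diffeomorphism.

(** * Integrals of real-valued functions *)

Section RintegralExtra.
Context d {T : measurableType d} {R : realType}.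
Variable mu : {measure set T -> \bar R}.

Lemma Rintegral_sum (I : Type) (s : seq I) (D : set T) (f : I -> T -> R) :
  measurable D -> (forall i, mu.-integrable D (EFin \o f i)) ->
  \int[mu]_(x in D) (\sum_(i <- s) f i x) = \sum_(i <- s) \int[mu]_(x in D) f i
    x.
Proof.
move=> mD fi; rewrite /Rintegral.
under eq_integral do rewrite -sumEFin.
rewrite integral_sum//.
rewrite sum_fine// => i _; apply: integrable_fin_num => //; exact: fi.
Qed.

Lemma Rintegral_partition (I : finType) (D : set T) (F : I -> set T) (f : T ->
  R) :
  (forall i, measurable (F i)) -> (forall x, D x <-> exists i, F i x) ->
  (forall i j x, F i x -> F j x -> i = j) ->
  mu.-integrable D (EFin \o f) ->
  \int[mu]_(x in D) f x = \sum_i \int[mu]_(x in F i) f x.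
Proof.
move=> mF DF Finj fi.
have FD i : F i `<=` D by move=> x Fx; apply/DF; exists i.
have E : D = \big[setU/set0]_(i <- index_enum I) F i.
  rewrite -bigcup_seq; apply/seteqP; split => [x /DF[i Fx]|x [i _ Fx]].
    by exists i => //=; rewrite mem_index_enum.
  exact: FD Fx.
have mD : measurable D by rewrite E; exact: bigsetU_measurable.
rewrite /Rintegral {1}E integral_bigsetU_EFin //.
- by rewrite sum_fine// => i _; apply: integrable_fin_num => //;
    exact: integrableS fi.
- exact: index_enum_uniq.
- by move=> i j _ _ [x [Fi Fj]]; exact: Finj Fi Fj.
- by rewrite -E; exact: measurable_int fi.
Qed.

Lemma Rintegral_near_cst (D : set T) (f : T -> R) (c e : R) :
  measurable D -> (mu D < +oo)%E -> mu.-integrable D (EFin \o f) ->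
  (forall x, D x -> `|f x - c| <= e) ->
  `|\int[mu]_(x in D) f x - c * fine (mu D)| <= e * fine (mu D).
Proof.
move=> mD muD fi fc.
have ci (k : R) : mu.-integrable D (EFin \o cst k).
  apply: measurable_bounded_integrable => //; exact: bounded_cst.
have fci : mu.-integrable D (EFin \o (fun x => f x - c)).
  exact: (integrableB mD fi (ci c)).
rewrite -!Rintegral_cst// -RintegralB//; last exact: ci.
apply: le_trans (le_normr_Rintegral mD fci) _.
apply: le_Rintegral => //; last exact: ci.
exact: (integrable_norm fci).
Qed.

End RintegralExtra.

Section CompactIntegrable.
Variable R : realType.
Local Notation mu := (@plane_measure R).
Local Notation mR := (measurableTypeR R).

Lemma compact_plane_finite (K A : set (mR * mR)) : compact (K : set (R * R)) ->
  A `<=` K -> measurable A -> (mu A < +oo)%E.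
Proof.
move=> cK AK mA; have [M [_ KM]] := compact_bounded cK.
pose N := `|M| + 1; have MN : M < N by rewrite ltr_pwDr// ler_norm.
pose I : set mR := `[- N, N]%classic.
have KI : A `<=` I `*` I.
  move=> x /AK /(KM _ MN) /norm_pair_le; rewrite !ler_norml => -[h1 h2].
  by split; rewrite /I /= in_itv/=.
apply: (@le_lt_trans _ _ (mu (I `*` I))).
  have mI : measurable (I `*` I) by apply: measurableX; exact: measurable_itv.
  by apply: le_measure => //; rewrite inE.
rewrite /plane_measure product_measure1E//; [|exact: measurable_itv..].
have lI : (lebesgue_measure I < +oo)%E.
  exact: compact_finite_measure (@segment_compact R _ _).
by rewrite lte_mul_pinfty// ge0_fin_numE.
Qed.

(** Measurability comes from the open set [O] and boundedness from the compact set [K], so [A] can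
    be any measurable part of [K], such as a half-open triangle or an image of one. *)
Lemma compact_plane_integrable (O K A : set (mR * mR)) (f : R * R -> R) :
  open (O : set (R * R)) -> (forall x, O x -> {for x, continuous f}) ->
  compact (K : set (R * R)) -> K `<=` O -> A `<=` K -> measurable A ->
  mu.-integrable A (EFin \o f).
Proof.
move=> oO cf cK KO AK mA.
apply: measurable_bounded_integrable => //.
- exact: compact_plane_finite cK AK mA.
- apply: (@measurable_funS _ _ _ _ O) => //.
  + exact: open_plane_measurable.
  + exact: subset_trans AK KO.
  + exact: continuous_measurable_fun_on.
- have : {within (K : set (R * R)), continuous f}.
    by apply/continuous_in_subspaceT => x /set_mem /KO; exact: cf.
  move=> cfK; have /compact_bounded[M [_ mrt]] := continuous_compact cfK cK.
  exists M; split; rewrite ?num_real// => r Mr x Ax; apply: mrt => //.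
  by exists x => //; exact: AK.
Qed.

End CompactIntegrable.

(** * Half-open triangles and the areas of affine images *)

Section TriangleArea.
Variable R : realType.
Local Notation mu := (@plane_measure R).
Local Notation Gamma := (@Gamma R).
Local Notation mR := (measurableTypeR R).

Lemma tri_measurable (a : R * R) (s : R) : measurable (tri a s : set (mR * mR)).
Proof.
have m1 : measurable_fun setT (fun x : mR * mR => x.1 : mR) := measurable_fst.
have m2 : measurable_fun setT (fun x : mR * mR => x.2 : mR) := measurable_snd.
have m12 : measurable_fun setT (fun x : mR * mR => (x.1 : R) + x.2 : mR).
  exact: measurable_funD.
have pre (f : mR * mR -> mR) (i : interval R) : measurable_fun setT f ->
    measurable (f @^-1` [set` i]).
  by move=> mf; rewrite -[X in measurable X]setTI; apply: mf => //;
    exact: measurable_itv.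
case s_gt0 : (0 < s).
- have -> : tri a s = (fun x : mR * mR => x.1) @^-1` `[a.1, +oo[ `&`
    (fun x : mR * mR => x.2) @^-1` `[a.2, +oo[ `&`
    (fun x : mR * mR => (x.1 : R) + x.2) @^-1` `]-oo, (a.1 + a.2 + s)[.
    apply/seteqP; split => x; rewrite /tri /= s_gt0 !in_itv/= ?andbT.
      by move=> /and3P[].
    by move=> [[h1 h2] h3]; apply/and3P.
  by apply: measurableI; [apply: measurableI|]; exact: pre.
- have -> : tri a s = (fun x : mR * mR => x.1) @^-1` `]-oo, a.1[ `&`
    (fun x : mR * mR => x.2) @^-1` `]-oo, a.2[ `&`
    (fun x : mR * mR => (x.1 : R) + x.2) @^-1` `[(a.1 + a.2 + s), +oo[.
    apply/seteqP; split => x; rewrite /tri /= s_gt0 !in_itv/= ?andbT.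
      by move=> /and3P[].
    by move=> [[h1 h2] h3]; apply/and3P.
  by apply: measurableI; [apply: measurableI|]; exact: pre.
Qed.

Lemma tri_subtri (a : R * R) (s : R) x : s != 0 ->
  tri a s x <-> exists k, tri (subtri k a s).1 (subtri k a s).2 x.
Proof.
move=> s0; split.
- rewrite {1}/tri /=; have [s_gt0|s_le0] := ltP 0 s; move=> /and3P[h1 h2 h3].
  + have s2 : 0 < s / 2 by rewrite divr_gt0.
    have s2' : (0 < - (s / 2)) = false by apply/negbTE; rewrite -leNgt; lra.
    have [c1|c1] := leP (a.1 + s / 2) x.1.
      by exists (@Ordinal 4 1 isT); rewrite /tri/= s2; apply/and3P; split; lra.
    have [c2|c2] := leP (a.2 + s / 2) x.2.
      by exists (@Ordinal 4 2 isT); rewrite /tri/= s2; apply/and3P; split; lra.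
    have [c3|c3] := ltP (x.1 + x.2) (a.1 + a.2 + s / 2).
      by exists (@Ordinal 4 0 isT); rewrite /tri/= s2; apply/and3P; split; lra.
    by exists (@Ordinal 4 3 isT); rewrite /tri/= s2'; apply/and3P; split; lra.
  + have {s0}s_lt0 : s < 0 by rewrite lt_neqAle s0.
    have s2 : 0 < - (s / 2) by rewrite oppr_gt0; lra.
    have s2' : (0 < s / 2) = false by apply/negbTE; rewrite -leNgt; lra.
    have [c1|c1] := ltP x.1 (a.1 + s / 2).
      by exists (@Ordinal 4 1 isT); rewrite /tri/= s2'; apply/and3P; split; lra.
    have [c2|c2] := ltP x.2 (a.2 + s / 2).
      by exists (@Ordinal 4 2 isT); rewrite /tri/= s2'; apply/and3P; split; lra.
    have [c3|c3] := leP (a.1 + a.2 + s / 2) (x.1 + x.2).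
      by exists (@Ordinal 4 0 isT); rewrite /tri/= s2'; apply/and3P; split; lra.
    by exists (@Ordinal 4 3 isT); rewrite /tri/= s2; apply/and3P; split; lra.
- case=> -[k k4]; rewrite /tri /=; have [s_gt0|s_le0] := ltP 0 s.
  + have s2 : 0 < s / 2 by rewrite divr_gt0.
    have s2' : (0 < - (s / 2)) = false by apply/negbTE; rewrite -leNgt; lra.
    case: k k4 => [|[|[|[|//]]]] k4 /=; rewrite ?s2 ?s2' => /and3P[h1 h2 h3];
      apply/and3P; split; lra.
  + have {s0}s_lt0 : s < 0 by rewrite lt_neqAle s0.
    have s2 : 0 < - (s / 2) by rewrite oppr_gt0; lra.
    have s2' : (0 < s / 2) = false by apply/negbTE; rewrite -leNgt; lra.
    case: k k4 => [|[|[|[|//]]]] k4 /=; rewrite ?s2 ?s2' => /and3P[h1 h2 h3];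
      apply/and3P; split; lra.
Qed.

Lemma subtri_inj (a : R * R) (s : R) (k l : 'I_4) x : s != 0 ->
  tri (subtri k a s).1 (subtri k a s).2 x -> tri (subtri l a s).1 (subtri l a
    s).2 x ->
  k = l.
Proof.
move=> s0; rewrite /tri.
have [s_gt0|s_le0] := ltP 0 s.
  have s2 : 0 < s / 2 by rewrite divr_gt0.
  have s2' : (0 < - (s / 2)) = false by apply/negbTE; rewrite -leNgt; lra.
  case: k => -[|[|[|[|//]]]] ?; case: l => -[|[|[|[|//]]]] ?;
    rewrite /= ?s2 ?s2' => /and3P[h1 h2 h3] /and3P[h4 h5 h6];
    by [apply/val_inj|exfalso; lra].
have {s0}s_lt0 : s < 0 by rewrite lt_neqAle s0.
have s2 : 0 < - (s / 2) by rewrite oppr_gt0; lra.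
have s2' : (0 < s / 2) = false by apply/negbTE; rewrite -leNgt; lra.
case: k => -[|[|[|[|//]]]] ?; case: l => -[|[|[|[|//]]]] ?;
  rewrite /= ?s2 ?s2' => /and3P[h1 h2 h3] /and3P[h4 h5 h6];
  by [apply/val_inj|exfalso; lra].
Qed.

Lemma Gamma_measurable : measurable (Gamma : set (mR * mR)).
Proof. by apply: closed_plane_measurable; exact: closed_Gamma. Qed.

(** Left symbolic: both sides of the change of variables are compared with multiples of it. *)
Definition area_Gamma : R := fine (mu Gamma).

Lemma area_GammaE : mu Gamma = area_Gamma%:E.
Proof.
rewrite /area_Gamma fineK// ge0_fin_numE//.
exact: (compact_plane_finite (@compact_Gamma R) (@subset_refl _ _)
  Gamma_measurable).
Qed.

Lemma area_Gamma_ge0 : 0 <= area_Gamma.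
Proof. by rewrite fine_ge0. Qed.

Lemma dilated_affine_area (J : 'M[R]_2) (y0 a x0 : R * R) (s e : R) :
  \det J != 0 -> s != 0 -> 1 + 4 * e != 0 ->
  let aff z := y0 + mxapp J (a + s *: z - x0) in
  measurable (aff @` dilated_Gamma e : set (mR * mR)) /\
  mu (aff @` dilated_Gamma e) =
    (`|\det J| * (s * (1 + 4 * e)) ^+ 2 * area_Gamma)%:E.
Proof.
move=> dJ0 s0 e0 aff; pose t := s * (1 + 4 * e).
have t0 : t != 0 by rewrite mulf_neq0.
pose w := y0 + mxapp J (a + s *: ((- e, - e) : R * R) - x0).
pose f (x : R * R) : mR * mR := (t * J 0 0 * x.1 + t * J 0 1 * x.2 + w.1,
   t * J 1 0 * x.1 + t * J 1 1 * x.2 + w.2).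
have fE : f = aff \o (fun z => (- e, - e) + (1 + 4 * e) *: z).
  apply/funext => z; rewrite /f /w /aff /mxapp /t /comp.
  by rewrite !scale_pairE !add_pairE /=; congr pair; ring.
have {}fE : aff @` dilated_Gamma e = f @` Gamma.
  by rewrite fE /dilated_Gamma (image_comp _ aff).
have det : t * J 0 0 * (t * J 1 1) - t * J 0 1 * (t * J 1 0) = t ^+ 2 * \det J.
  by rewrite det_mx22; ring.
have := @plane_measure_affine_image R (t * J 0 0) (t * J 0 1) (t * J 1 0) (t *
  J 1 1)
  w.1 w.2 Gamma.
rewrite det mulf_neq0 ?expf_neq0// => /(_ isT Gamma_measurable).
rewrite fE => -[mf ->]; split=> //.
rewrite area_GammaE -EFinM normrM ger0_norm ?sqr_ge0//.
by rewrite [X in (X * _)%:E]mulrC.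
Qed.

End TriangleArea.

(** * The change of variables formula on the reference triangle *)

Section ChangeOfVariables.
Variable R : realType.
Local Notation mu := (@plane_measure R).
Local Notation Gamma := (@Gamma R).
Local Notation kappa := (@area_Gamma R).
Local Notation mR := (measurableTypeR R).

Lemma closed_tri_dist (a x x0 : R * R) (s : R) : s != 0 ->
  closed_tri a s x -> closed_tri a s x0 -> `|x - x0| <= `|s|.
Proof.
move=> s0 /(closed_triP s0)[z Gz ->] /(closed_triP s0)[z0 Gz0 ->].
rewrite opprD addrACA subrr add0r -scalerBr normrZ.
by rewrite ler_piMr// Gamma_dist.
Qed.

(** The upper deviation is [(1 + 4 * e) ^+ 2 - 1 = 8 * e + 16 * e ^+ 2], at most [16 * e] for such
    [e]; the lower one is smaller. *)
Lemma dilation_error (c m s e : R) : 0 <= c -> 0 < e -> e < 4^-1 ->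
  c * (s * (1 + 4 * - e)) ^+ 2 <= m -> m <= c * (s * (1 + 4 * e)) ^+ 2 ->
  `|m - c * s ^+ 2| <= 16 * e * (c * s ^+ 2).
Proof.
move=> c0 e0 e4 h1 h2; pose q := c * s ^+ 2.
have q0 : 0 <= q by rewrite mulr_ge0// sqr_ge0.
have {}h1 : q * (1 - 4 * e) ^+ 2 <= m.
  by rewrite /q -mulrA -exprMn -mulrN.
have {}h2 : m <= q * (1 + 4 * e) ^+ 2 by rewrite /q -mulrA -exprMn.
rewrite ler_norml -/q; apply/andP; split.
  apply: (@le_trans _ _ (q * (1 - 4 * e) ^+ 2 - q)); last by rewrite lerD2r.
  have : 0 <= q * (8 * e + 16 * e ^+ 2).
    by rewrite mulr_ge0// addr_ge0// mulr_ge0// ?sqr_ge0// ltW.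
  lra.
apply: (@le_trans _ _ (q * (1 + 4 * e) ^+ 2 - q)); first by rewrite lerD2r.
have : 0 <= q * (e * (8 - 16 * e)) by apply: mulr_ge0 => //; apply: mulr_ge0;
  lra.
lra.
Qed.

Lemma diffeo_area (D : set (R * R)) (F G : R * R -> R * R) x0 (e : R) :
  C1_diffeo D F G -> D x0 -> 0 < e -> e < 4^-1 ->
  exists2 d : R, 0 < d &
  forall a s, s != 0 -> `|s| < d -> closed_tri a s x0 ->
  forall S : set (mR * mR), measurable S ->
  open_tri a s `<=` S -> S `<=` closed_tri a s -> S `<=` D ->
  [/\ (mu (F @` S) < +oo)%E &
  `|fine (mu (F @` S)) - `|\det (Jacobian F x0)| * kappa * s ^+ 2|
    <= 16 * e * (`|\det (Jacobian F x0)| * kappa * s ^+ 2)].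
Proof.
move=> FG Dx0 e0 e4; have [d d0 sand] := diffeo_sandwich FG Dx0 e0 e4.
have J0 := diffeo_det_neq0 FG Dx0.
exists d => // a s s0 sd ax0 S mS oS Sc SD.
have [S1 S2] := sand a s s0 sd ax0 S oS Sc SD.
have mFS := diffeo_measurable_image FG SD mS.
move: (Jacobian F x0) J0 S1 S2 => J J0 S1 S2.
have ep : 1 + 4 * e != 0 by apply: lt0r_neq0; lra.
have em : 1 + 4 * - e != 0 by apply: lt0r_neq0; lra.
have [mp Ap] := dilated_affine_area (F x0) a x0 J0 s0 ep.
have [mm Am] := dilated_affine_area (F x0) a x0 J0 s0 em.
have fin : (mu (F @` S) < +oo)%E.
  have := ltry (`|\det J| * (s * (1 + 4 * e)) ^+ 2 * kappa).
  rewrite -Ap; apply: le_lt_trans.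
  by apply: le_measure => //; rewrite inE.
split => //; apply: dilation_error => //.
- by rewrite mulr_ge0// area_Gamma_ge0.
- rewrite mulrAC -lee_fin -Am fineK ?ge0_fin_numE//.
  by apply: le_measure => //; rewrite inE.
- rewrite mulrAC -lee_fin -Ap fineK ?ge0_fin_numE//.
  by apply: le_measure => //; rewrite inE.
Qed.

(** With the identity, [diffeo_area] also estimates the area of the small triangle itself, so that
    both integrals of the formula are measured in the same way. *)
Lemma C1_diffeo_id : C1_diffeo [set: R * R] id id.
Proof.
have C1 (A : set (R * R)) : C1_on A id.
  move=> x _; split => // v.
  have -> : 'D_v (id : R * R -> R * R) = cst v by apply/funext => y;
    rewrite derive_id.
  exact: cvg_cst.
by split => //; rewrite ?image_id; exact: openT.
Qed.

Lemma Jacobian_id (x : R * R) : Jacobian id x = 1%:M.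
Proof.
apply/matrixP => i j; rewrite /Jacobian mxE derive_id /vec mxE mxE.
by case: i => -[|[|//]] ?; case: j => -[|[|//]] ?.
Qed.

Lemma C1_det_continuous (D : set (R * R)) (F : R * R -> R * R) x :
  C1_on D F -> D x -> {for x, continuous (fun y => \det (Jacobian F y))}.
Proof.
move=> C1 Dx; have [_ cD] := C1 _ Dx.
have c1 v : {for x, continuous (fun y => ('D_v F y).1)}.
  by apply: (@continuous_comp _ _ _ ('D_v F) fst); [exact: cD|exact: cvg_fst].
have c2 v : {for x, continuous (fun y => ('D_v F y).2)}.
  by apply: (@continuous_comp _ _ _ ('D_v F) snd); [exact: cD|exact: cvg_snd].
have -> : (fun y => \det (Jacobian F y)) = (fun y =>
    ('D_(1, 0) F y).1 * ('D_(0, 1) F y).2 - ('D_(0, 1) F y).1 * ('D_(1, 0) F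
      y).2).
  by apply/funext => y; rewrite det_mx22; have [-> -> -> ->] := JacobianE F y.
by apply: continuousB; apply: continuousM; rewrite ?c1 ?c2.
Qed.

Lemma open_Gamma_open : open (@open_Gamma R).
Proof.
have -> : @open_Gamma R = (fst @^-1` [set t : R | 0 < t] `&` snd @^-1` [set t :
  R | 0 < t])
   `&` (fun x : R * R => x.1 + x.2) @^-1` [set t : R | t < 1].
  by apply/seteqP; split => x /=; [case|case=> -[]].
apply: openI; first apply: openI.
- by apply: open_comp => [x _|]; [exact: cvg_fst|exact: open_gt].
- by apply: open_comp => [x _|]; [exact: cvg_snd|exact: open_gt].
- apply: open_comp => [x _|]; last exact: open_lt.
  by apply: cvgD; [exact: cvg_fst|exact: cvg_snd].
Qed.

Lemma open_tri_open (a : R * R) (s : R) : open (open_tri a s).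
Proof.
apply: open_comp; last exact: open_Gamma_open.
move=> x _; apply: (@cvg_pair _ _ _ _ (nbhs ((x.1 - a.1) / s)) (nbhs ((x.2 -
  a.2) / s))).
  by apply: cvgMl; apply: cvgB; [exact: cvg_fst|exact: cvg_cst].
by apply: cvgMl; apply: cvgB; [exact: cvg_snd|exact: cvg_cst].
Qed.

Lemma interior_Gamma : Gamma° = @open_Gamma R.
Proof.
apply/seteqP; split => [x /nbhs_ballP[e /= e0 xe]|].
  have e2 : 0 <= e / 2 by rewrite divr_ge0// ltW.
  have xi (u v : R) : `|u| <= e / 2 -> `|v| <= e / 2 -> Gamma (x.1 + u, x.2 +
    v).
    move=> ue ve; apply: xe; rewrite -ball_normE /ball_/=.
    have -> : x - (x.1 + u, x.2 + v) = (- u, - v).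
      by rewrite add_pairE /=; congr pair; ring.
    by apply/norm_pair_lt; rewrite /= !normrN; split; lra.
  have n0 : `|0 : R| <= e / 2 by rewrite normr0.
  have ne : `|- (e / 2)| <= e / 2 by rewrite normrN ger0_norm.
  have pe : `|e / 2| <= e / 2 by rewrite ger0_norm.
  have [/= h1 _ _] := xi _ _ ne n0.
  have [/= _ h2 _] := xi _ _ n0 ne.
  have [/= _ _ h3] := xi _ _ pe n0.
  split; lra.
rewrite -((interior_id _).1 open_Gamma_open).
by apply: interiorS => x [x1 x2 x12]; split; exact: ltW.
Qed.

(** The left domain is the interior of an element, where the assembled field lives; the right one is
    the half-open triangle that bisection splits exactly. On a small triangle both integrands are
    nearly constant and both areas are known up to a small relative error. *)
Lemma change_of_variables (D : set (R * R)) (F G : R * R -> R * R)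
    (f : R * R -> R) : C1_diffeo D F G -> Gamma `<=` D ->
  (forall y, (F @` D) y -> {for y, continuous f}) ->
  \int[mu]_(y in F @` Gamma°) f y =
  \int[mu]_(x in tri (0, 0) 1) (f (F x) * `|\det (Jacobian F x)|).
Proof.
move=> FG GD cf.
pose h x := f (F x) * `|\det (Jacobian F x)|.
have [oD oFD FK CF CG] := FG.
have cfF x : D x -> {for x, continuous (f \o F)}.
  move=> Dx; apply: continuous_comp; last by apply: cf; exists x.
  by apply: differentiable_continuous; case: (CF x Dx).
have ch x : D x -> {for x, continuous h}.
  move=> Dx; apply: continuousM; first exact: cfF.
  apply: (@continuous_comp _ _ _ (fun y => \det (Jacobian F y)) (@Num.norm R
    R)).
    exact: C1_det_continuous Dx.
  exact: norm_continuous.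
have cFG : compact (F @` Gamma).
  apply: continuous_compact; last exact: compact_Gamma.
  apply/continuous_in_subspaceT => x /set_mem /GD Dx.
  by apply: differentiable_continuous; case: (CF x Dx).
have fint (S : set (mR * mR)) : S `<=` Gamma -> measurable S ->
    mu.-integrable (F @` S) (EFin \o f).
  move=> SG mS; apply: (compact_plane_integrable oFD cf cFG).
  - exact: image_subset.
  - exact: image_subset.
  - by apply: (diffeo_measurable_image FG) => //; exact: subset_trans GD.
have hint (S : set (mR * mR)) : S `<=` Gamma -> measurable S ->
    mu.-integrable S (EFin \o h).
  by move=> SG mS; apply: (compact_plane_integrable oD ch (@compact_Gamma R)
    GD).
have mGo : measurable (Gamma° : set (mR * mR)).
  by apply: open_plane_measurable; exact: open_interior.
pose P a s : set (mR * mR) := tri a s `&` Gamma°.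
have mP a s : measurable (P a s) by apply: measurableI => //;
  exact: tri_measurable.
have PG a s : P a s `<=` Gamma by move=> x [_ /interior_subset].
have mFP a s : measurable (F @` P a s : set (mR * mR)).
  by apply: (diffeo_measurable_image FG) => //; exact: subset_trans GD.
pose E a s := \int[mu]_(y in F @` P a s) f y - \int[mu]_(x in tri a s) h x.
suff : E (0, 0) 1 = 0.
  have -> : Gamma° = P (0, 0) 1.
    apply/seteqP; split => [x Gx|x []//]; split => //.
    move: Gx; rewrite interior_Gamma => -[x1 x2 x12].
    by rewrite /tri/= ltr01; apply/and3P; split; lra.
  by move/eqP; rewrite subr_eq0 => /eqP.
apply: bisection => [a s s0 aG|x0 Gx0 e e0].
- have tG : tri a s `<=` Gamma.
    by apply: subset_trans aG; exact: tri_closed_tri.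
  rewrite /E sumrB; congr (_ - _).
    apply: (@Rintegral_partition _ _ _ mu 'I_4 _ (fun k => F @` P _ _)) => //.
    - move=> y; split => [[x [ax Gx] <-]|[k [x [kx Gx] <-]]].
        by have /(tri_subtri a x s0)[k kx] := ax; exists k, x.
      by exists x => //; split => //; apply/(tri_subtri a x s0); exists k.
    - move=> k l y [x [kx Gx] <-] [x' [lx Gx'] xE].
      apply: (subtri_inj s0 kx).
      have Dx := GD _ (interior_subset Gx);
        have Dx' := GD _ (interior_subset Gx').
      by have := congr1 G xE; rewrite !FK// => <-.
    - exact: fint.
  apply: (@Rintegral_partition _ _ _ mu 'I_4) => //.
  - by move=> k; exact: tri_measurable.
  - by move=> x; exact: tri_subtri.
  - by move=> k l x; exact: subtri_inj.
  - by apply: hint => //; exact: tri_measurable.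
- have Dx0 := GD _ Gx0.
  pose d0 := `|\det (Jacobian F x0)|; pose f0 := f (F x0).
  have d00 : 0 <= d0 by exact: normr_ge0.
  have k0 := area_Gamma_ge0 R.
  (* With tolerance [c], the oscillation of the integrands costs [c] times the two areas, which are
     at most [3 * d0 * kappa * s ^+ 2] and [3 * kappa * s ^+ 2]; each area error, weighted by the
     values at [x0], costs [16 * c * |f0| * d0 * kappa * s ^+ 2]. The 5 in place of 3 is slack. *)
  pose K := kappa * (5 * d0 + 5 + 32 * `|f0| * d0).
  have K0 : 0 <= K.
    by rewrite mulr_ge0// !addr_ge0// ?mulr_ge0.
  have [c [c0 c8 cK]] : exists c : R, [/\ 0 < c, c <= 8^-1 & c * K <= e].
    (* The bound [8^-1] gives [16 * c <= 2], hence the factor 3 in the bounds of the areas; [K + 1]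
       is positive even if [K] is 0. *)
    exists (Num.min (8^-1) (e / (K + 1))); split.
    - by rewrite lt_min invr_gt0 ltr0n divr_gt0// ltr_wpDl.
    - by rewrite ge_min lexx.
    - apply: (@le_trans _ _ (e / (K + 1) * K)).
        by rewrite ler_wpM2r// ge_min lexx orbT.
      by rewrite mulrAC ler_pdivrMr ?ltr_wpDl// ler_pM2l// lerDl.
  have c4 : c < 4^-1 by lra.
  have [d1 d10 H1] := diffeo_area FG Dx0 c0 c4.
  have [d2 d20 H2] := diffeo_area C1_diffeo_id (I : setT x0) c0 c4.
  have [d3 d30 H3] : exists2 d : R, 0 < d & forall x, `|x - x0| < d ->
      `|f (F x) - f0| <= c /\ `|h x - f0 * d0| <= c.
    have /cvgrPdist_le/(_ _ c0) n1 := cfF _ Dx0.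
    have /cvgrPdist_le/(_ _ c0) n2 := ch _ Dx0.
    have : nbhs x0 ([set x | `|(f \o F) x0 - (f \o F) x| <= c] `&`
        [set x | `|h x0 - h x| <= c]) by exact: filterI n1 n2.
    move=> /nbhs_ballP[d /= dd0 H].
    exists d => // x xd; have [] := H x.
      by rewrite -ball_normE /ball_/= distrC.
    by move=> /= h1 h2; split; rewrite distrC; [exact: h1|exact: h2].
  exists (Num.min d1 (Num.min d2 d3)); first by rewrite !lt_min d10 d20.
  move=> a s s0; rewrite !lt_min => /and3P[sd1 sd2 sd3] aG ax0.
  have tG : tri a s `<=` Gamma.
    by apply: subset_trans aG; exact: tri_closed_tri.
  have oP : open_tri a s `<=` P a s.
    move=> x ax; split; first exact: open_tri_tri.
    have : (open_tri a s)° x.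
      rewrite (interior_id _).1//; exact: open_tri_open.
    by apply: interiorS; apply: subset_trans aG; exact: open_triS.
  have Pc : P a s `<=` closed_tri a s.
    by move=> x [ax _]; exact: tri_closed_tri.
  have [fin1 A1] := H1 a s s0 sd1 ax0 _ (mP a s) oP Pc (subset_trans (PG a s)
    GD).
  have [fin2 A2] := H2 a s s0 sd2 ax0 _ (tri_measurable a s) (open_tri_tri s0)
    (tri_closed_tri s0) (@subsetT _ _).
  rewrite image_id Jacobian_id det1 normr1 mul1r in fin2 A2.
  have close x : closed_tri a s x -> `|x - x0| < d3.
    by move=> ax; apply: le_lt_trans sd3; exact: closed_tri_dist ax ax0.
  have B1 : `|\int[mu]_(y in F @` P a s) f y - f0 * fine (mu (F @` P a s))|
      <= c * fine (mu (F @` P a s)).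
    apply: Rintegral_near_cst => //; first exact: fint.
    by move=> _ [x /Pc/close/H3[? _] <-].
  have B2 : `|\int[mu]_(x in tri a s) h x - (f0 * d0) * fine (mu (tri a s))|
      <= c * fine (mu (tri a s)).
    apply: Rintegral_near_cst => //; first exact: tri_measurable.
      by apply: hint => //; exact: tri_measurable.
    by move=> x /(tri_closed_tri s0)/close/H3[].
  rewrite -/d0 in A1.
  rewrite /E.
  move: (\int[mu]_(y in F @` P a s) f y) (\int[mu]_(x in tri a s) h x)
    (fine (mu (F @` P a s))) (fine (mu (tri a s))) A1 A2 B1 B2 => I1 I2 m1 m2.
  have q0 : 0 <= s ^+ 2 := sqr_ge0 s.
  move: (s ^+ 2) q0 => q q0 A1 A2 B1 B2.
  have kq : 0 <= kappa * q by rewrite mulr_ge0.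
  have dkq : 0 <= d0 * kappa * q by rewrite -mulrA mulr_ge0.
  have m1le : m1 <= 3 * (d0 * kappa * q).
    have : 16 * c * (d0 * kappa * q) <= 2 * (d0 * kappa * q).
      by rewrite ler_wpM2r//; lra.
    by move: A1; rewrite ler_norml; lra.
  have m2le : m2 <= 3 * (kappa * q).
    have : 16 * c * (kappa * q) <= 2 * (kappa * q) by rewrite ler_wpM2r//; lra.
    by move: A2; rewrite ler_norml; lra.
  have -> : I1 - I2 = (I1 - f0 * m1) + f0 * (m1 - d0 * kappa * q)
      + (- (f0 * d0 * (m2 - kappa * q)) - (I2 - f0 * d0 * m2)) by ring.
  apply: (@le_trans _ _ (c * m1 + `|f0| * (16 * c * (d0 * kappa * q)) +
      (`|f0| * d0 * (16 * c * (kappa * q)) + c * m2))).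
    apply: (le_trans (ler_normD _ _)); apply: lerD.
      by apply: (le_trans (ler_normD _ _)); rewrite lerD// normrM ler_wpM2l.
    apply: (le_trans (ler_normB _ _)); rewrite normrN lerD//.
    by rewrite !normrM (ger0_norm d00) ler_wpM2l// mulr_ge0.
  apply: (@le_trans _ _ (c * K * q)); last by rewrite ler_wpM2r.
  have := ler_wpM2l (ltW c0) m1le; have := ler_wpM2l (ltW c0) m2le.
  have : 0 <= c * (kappa * q) by rewrite mulr_ge0// ltW.
  have : 0 <= c * (d0 * kappa * q) by rewrite mulr_ge0// ltW.
  by rewrite /K => *; nra.
Qed.

End ChangeOfVariables.

(** * Green's formula on the reference triangle *)

Section Green.
Variable R : realType.
Local Notation mu := (@plane_measure R).
Local Notation lam := (@lebesgue_measure R).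
Local Notation Gamma := (@Gamma R).
Local Notation mR := (measurableTypeR R).
Local Notation T0 := (@tri R (0, 0) 1).

Lemma tri0P (x : R * R) : T0 x <-> [/\ 0 <= x.1, 0 <= x.2 & x.1 + x.2 < 1].
Proof. by rewrite /tri/= ltr01 !add0r; split => /and3P. Qed.

Lemma tri0_Gamma : T0 `<=` Gamma.
Proof. by move=> x /tri0P[x1 x2 x12]; split => //; exact: ltW. Qed.

Lemma derive_fst (a : R * R -> R) (x y : R) : differentiable a (x, y) ->
  derivable (fun t : R => a (t, y)) x 1 /\
  derive1 (fun t : R => a (t, y)) x = 'D_(1, 0) a (x, y).
Proof.
move=> da; have E : (fun h : R => h^-1 *: (((fun t : R => a (t, y)) \o shift x)
  (h *: (1 : R)) -
    a (x, y))) = (fun h : R => h^-1 *: ((a \o shift (x, y)) (h *: ((1, 0) : R *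
      R)) - a (x, y))).
  apply/funext => h /=; rewrite scale_pairE add_pairE /= mulr0 add0r.
  by rewrite /GRing.scale/= mulr1.
split; last by rewrite derive1E /derive E.
by rewrite /derivable E; exact: diff_derivable.
Qed.

Lemma derive_snd (a : R * R -> R) (x y : R) : differentiable a (x, y) ->
  derivable (fun t : R => a (x, t)) y 1 /\
  derive1 (fun t : R => a (x, t)) y = 'D_(0, 1) a (x, y).
Proof.
move=> da; have E : (fun h : R => h^-1 *: (((fun t : R => a (x, t)) \o shift y)
  (h *: (1 : R)) -
    a (x, y))) = (fun h : R => h^-1 *: ((a \o shift (x, y)) (h *: ((0, 1) : R *
      R)) - a (x, y))).
  apply/funext => h /=; rewrite scale_pairE add_pairE /= mulr0 add0r.
  by rewrite /GRing.scale/= mulr1.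
split; last by rewrite derive1E /derive E.
by rewrite /derivable E; exact: diff_derivable.
Qed.

(** The half-open interval is a section of the half-open reference triangle. The hypotheses hold up
    to the end points because they will be applied to functions that are C^1 around [Gamma]. *)
Lemma Rintegral_FTC2 (f F : R -> R) (b : R) : 0 < b ->
  (forall x, 0 <= x <= b -> {for x, continuous f}) ->
  (forall x, 0 <= x <= b -> derivable F x 1 /\ derive1 F x = f x) ->
  (\int[lam]_(x in `[0%R, b[) (f x)%:E = (F b - F 0)%:E)%E.
Proof.
move=> b0 cf dF.
have cF x : 0 <= x <= b -> {for x, continuous F}.
  by move=> /dF[/derivable1_diffP dFx _]; exact: differentiable_continuous.
have wf : {within `[0, b], continuous f}.
  by apply/continuous_in_subspaceT => x /set_mem/=; rewrite in_itv/= => /cf.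
rewrite integral_itv_bndo_bndc; last first.
  apply/measurable_EFinP.
  apply: (@measurable_funS _ _ _ _ `[0%R, b]) => //;
    first by apply: subset_itvl; rewrite bnd_simp.
  by apply: subspace_continuous_measurable_fun => //; exact: measurable_itv.
rewrite (@continuous_FTC2 _ f F)//.
- split.
  + by move=> x; rewrite in_itv/= => /andP[x0 xb]; have [|] := dF x;
      rewrite ?(ltW x0) ?(ltW xb).
  + by apply: cvg_at_right_filter; apply: cF; rewrite lexx ltW.
  + by apply: cvg_at_left_filter; apply: cF; rewrite lexx ltW.
- by move=> x; rewrite in_itv/= => /andP[x0 xb]; have [|] := dF x;
    rewrite ?(ltW x0) ?(ltW xb).
Qed.

Lemma measurable_cc (f : R -> R) (b : R) :
  (forall x, 0 <= x <= b -> {for x, continuous f}) ->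
  measurable_fun (`[0, b] : set mR) f.
Proof.
move=> cf; apply: subspace_continuous_measurable_fun;
  first exact: measurable_itv.
by apply/continuous_in_subspaceT => x /set_mem/=; rewrite in_itv/= => /cf.
Qed.

Lemma Rintegral_co_cc (f : R -> R) (b : R) :
  (forall x, 0 <= x <= b -> {for x, continuous f}) ->
  (\int[lam]_(x in `[0%R, b[) (f x)%:E = \int[lam]_(x in `[0%R, b]) (f x)%:E)%E.
Proof.
move=> /measurable_cc mf; apply: integral_itv_bndo_bndc.
apply/measurable_EFinP.
apply: (@measurable_funS _ _ _ _ `[0%R, b]) => //.
by apply: subset_itvl; rewrite bnd_simp.
Qed.

Lemma pair_continuous (u v : R -> R) (t : R) : {for t, continuous u} ->
  {for t, continuous v} -> {for t, continuous (fun t => (u t, v t) : R * R)}.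
Proof.
by move=> cu cv; apply: (@cvg_pair _ _ _ _ (nbhs (u t)) (nbhs (v t))).
Qed.

Section GreenOneForm.
Variables (D : set (R * R)) (a : R * R -> R).
Hypotheses (oD : open D) (GD : Gamma `<=` D).
Hypothesis da : forall x, D x -> differentiable a x.
Hypothesis ca : forall x, D x -> forall v, {for x, continuous ('D_v a)}.

Let comp_a (u v : R -> R) (t : R) : {for t, continuous u} ->
  {for t, continuous v} -> Gamma (u t, v t) ->
  {for t, continuous (fun t => a (u t, v t))}.
Proof.
move=> cu cv Guv; apply: (@continuous_comp _ _ _ (fun t => (u t, v t) : R * R)
  a).
  exact: pair_continuous.
exact/differentiable_continuous/da/GD.
Qed.

Let oneB (t : R) : {for t, continuous (fun t : R => 1 - t)}.
Proof. by apply: continuousB; [exact: cvg_cst|exact: cvg_id]. Qed.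

Let mT0 : measurable (T0 : set (mR * mR)). Proof. exact: tri_measurable. Qed.

Let integ v : mu.-integrable (T0 : set (mR * mR)) (EFin \o 'D_v a).
Proof.
apply: (compact_plane_integrable oD (fun x Dx => ca Dx (v := v))
  (@compact_Gamma R) GD) => //.
exact: tri0_Gamma.
Qed.

Let integT v : mu.-integrable setT ((EFin \o 'D_v a) \_ T0).
Proof. by apply/(integrable_mkcond _ mT0); exact: integ. Qed.

Lemma green_fst : \int[mu]_(x in T0) ('D_(1, 0) a x) =
  \int[lam]_(t in `[0, 1]) (a (1 - t, t) - a (0, t)).
Proof.
rewrite /Rintegral; congr fine.
rewrite [LHS]integral_mkcond -(integral21_prod_meas1 (integT _)).
(* The value 1 is dropped from the outer integral, so that the sections have positive length
   [1 - y]. *)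
rewrite -Rintegral_co_cc; last first.
  move=> t /andP[t0 t1]; apply: continuousB; apply: comp_a => //;
    try exact: cvg_id; try exact: cvg_cst; split => /=; lra.
rewrite [RHS]integral_mkcond; apply: eq_integral => y _.
rewrite patchE; case: ifPn => [/set_mem|]; last first.
  move=> yn; apply: integral0_eq => x _; rewrite patchE memNset//.
  move=> /tri0P[/= x0 y0 xy]; move/negP: yn; apply; apply/mem_set => /=.
  by rewrite in_itv/=; lra.
rewrite /= in_itv/= => /andP[y0 y1].
have y1' : 0 < 1 - y by lra.
rewrite -(@Rintegral_FTC2 (fun x => 'D_(1, 0) a (x, y)) (fun x => a (x, y)))//.
- rewrite [RHS]integral_mkcond; apply: eq_integral => x _.
  rewrite !patchE; congr (if _ then _ else _).
  apply/idP/idP => /set_mem.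
    by move=> /tri0P[/= x0 _ xy]; apply/mem_set; rewrite /= in_itv/=; lra.
  by rewrite /= in_itv/= => xy; apply/mem_set/tri0P; split => /=; lra.
- move=> x /andP[x0 xy].
  apply: (@continuous_comp _ _ _ (fun x => (x, y) : R * R) ('D_(1, 0) a)).
    by apply: pair_continuous; [exact: cvg_id|exact: cvg_cst].
  by apply: ca; apply: GD; split => /=; lra.
- by move=> x /andP[x0 xy]; apply: derive_fst; apply: da; apply: GD;
    split => /=; lra.
Qed.

Lemma green_snd : \int[mu]_(x in T0) ('D_(0, 1) a x) =
  \int[lam]_(t in `[0, 1]) (a (t, 1 - t) - a (t, 0)).
Proof.
rewrite /Rintegral; congr fine.
rewrite [LHS]integral_mkcond -(integral12_prod_meas1 (integT _)).
rewrite -Rintegral_co_cc; last first.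
  move=> t /andP[t0 t1]; apply: continuousB; apply: comp_a => //;
    try exact: cvg_id; try exact: cvg_cst; split => /=; lra.
rewrite [RHS]integral_mkcond; apply: eq_integral => x _.
rewrite patchE; case: ifPn => [/set_mem|]; last first.
  move=> xn; apply: integral0_eq => y _; rewrite patchE memNset//.
  move=> /tri0P[/= x0 y0 xy]; move/negP: xn; apply; apply/mem_set => /=.
  by rewrite in_itv/=; lra.
rewrite /= in_itv/= => /andP[x0 x1].
have x1' : 0 < 1 - x by lra.
rewrite -(@Rintegral_FTC2 (fun y => 'D_(0, 1) a (x, y)) (fun y => a (x, y)))//.
- rewrite [RHS]integral_mkcond; apply: eq_integral => y _.
  rewrite !patchE; congr (if _ then _ else _).
  apply/idP/idP => /set_mem.
    by move=> /tri0P[/= _ y0 xy]; apply/mem_set; rewrite /= in_itv/=; lra.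
  by rewrite /= in_itv/= => xy; apply/mem_set/tri0P; split => /=; lra.
- move=> y /andP[y0 xy].
  apply: (@continuous_comp _ _ _ (fun y => (x, y) : R * R) ('D_(0, 1) a)).
    by apply: pair_continuous; [exact: cvg_cst|exact: cvg_id].
  by apply: ca; apply: GD; split => /=; lra.
- by move=> y /andP[y0 xy]; apply: derive_snd; apply: da; apply: GD;
    split => /=; lra.
Qed.

End GreenOneForm.

Lemma sum_edge (V : nmodType) (f : edge -> V) :
  \sum_j f j = f E12 + f E13 + f E23.
Proof.
rewrite (bigD1 E12)//= (bigD1 E13)//= (bigD1 E23)//= big1; last by case.
by rewrite addr0 addrA.
Qed.

Lemma edge_paramE j (t : R) : edge_param j t =
  match j with E12 => (0, t) | E13 => (t, 0) | E23 => (t, 1 - t) end.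
Proof.
by rewrite /edge_param !scale_pairE add_pairE; case: j => /=; congr pair; ring.
Qed.

Lemma edge_param_Gamma j (t : R) : 0 <= t <= 1 -> Gamma (edge_param j t).
Proof. by rewrite edge_paramE => /andP[t0 t1]; case: j; split => /=; lra. Qed.

Lemma edge_param_continuous j (t : R) : {for t, continuous (@edge_param R j)}.
Proof.
have -> : @edge_param R j = fun t =>
    match j with E12 => (0, t) | E13 => (t, 0) | E23 => (t, 1 - t) end.
  by apply/funext => s; exact: edge_paramE.
case: j; apply: pair_continuous; try exact: cvg_id; try exact: cvg_cst.
by apply: continuousB; [exact: cvg_cst|exact: cvg_id].
Qed.

Lemma continuous01_integrable (f : R -> R) :
  (forall t : R, 0 <= t <= 1 -> {for t, continuous f}) ->
  lam.-integrable `[0, 1] (EFin \o f).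
Proof.
move=> cf; apply: continuous_compact_integrable; first exact: segment_compact.
by apply/continuous_in_subspaceT => x /set_mem/=; rewrite in_itv/= => /cf.
Qed.

Definition edge_vector (j : edge) : R * R := vpt R (hi j) - vpt R (lo j).

(* The boundary of [Gamma] run counterclockwise: 1 -> 3 -> 2 -> 1. *)
Definition edge_sign (j : edge) : R := if j is E13 then 1 else -1.

Lemma green (D : set (R * R)) (a1 a2 : R * R -> R) : open D -> Gamma `<=` D ->
  (forall x, D x -> differentiable a1 x) ->
  (forall x, D x -> forall v, {for x, continuous ('D_v a1)}) ->
  (forall x, D x -> differentiable a2 x) ->
  (forall x, D x -> forall v, {for x, continuous ('D_v a2)}) ->
  \int[mu]_(x in T0) ('D_(1, 0) a2 x) - \int[mu]_(x in T0) ('D_(0, 1) a1 x) =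
  \sum_j edge_sign j * \int[lam]_(t in `[0, 1])
    (a1 (edge_param j t) * (edge_vector j).1 +
     a2 (edge_param j t) * (edge_vector j).2).
Proof.
move=> oD GD d1 c1 d2 c2.
rewrite (green_fst oD GD d2 c2) (green_snd oD GD d1 c1) sum_edge.
have itr a j : (forall x, D x -> differentiable a x) ->
    lam.-integrable `[0, 1] (EFin \o (fun t => a (edge_param j t))).
  move=> da; apply: continuous01_integrable => t t01.
  apply: (@continuous_comp _ _ _ (@edge_param R j) a).
    exact: edge_param_continuous.
  exact/differentiable_continuous/da/GD/edge_param_Gamma.
have m01 : measurable (`[0, 1]%classic : set mR) by exact: measurable_itv.
have I12 := itr _ E12; have I13 := itr _ E13; have I23 := itr _ E23.
(* Integrating along horizontal lines runs the hypotenuse from [(1, 0)] to [(0, 1)], against the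
   direction of [edge_param E23]; this substitution reverses it. *)
have rev : \int[lam]_(t in `[0, 1]) a2 (1 - t, t) =
    \int[lam]_(t in `[0, 1]) a2 (edge_param E23 t).
  under [RHS]eq_Rintegral do rewrite edge_paramE.
  rewrite (@Rintegration_by_substitution_onem _ (fun t => a2 (t, 1 - t)) 1).
  - rewrite unstable.onem1; apply: eq_Rintegral => t _.
    by rewrite /unstable.onem subKr.
  - by rewrite ler01 lexx.
  - apply/continuous_in_subspaceT => t /set_mem/=; rewrite in_itv/= => t01.
    have -> : (fun t => a2 (t, 1 - t)) = (fun t => a2 (edge_param E23 t)).
      by apply/funext => s; rewrite edge_paramE.
    apply: (@continuous_comp _ _ _ (@edge_param R E23) a2).
      exact: edge_param_continuous.
    exact/differentiable_continuous/d2/GD/edge_param_Gamma.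
have irev : lam.-integrable `[0, 1] (EFin \o (fun t : R => a2 (1 - t, t))).
  apply: continuous01_integrable => t /andP[t0 t1].
  apply: (@continuous_comp _ _ _ (fun t : R => (1 - t, t) : R * R) a2).
    apply: pair_continuous; last exact: cvg_id.
    by apply: continuousB; [exact: cvg_cst|exact: cvg_id].
  by apply/differentiable_continuous/d2/GD; split => /=; lra.
have e12 (a : R * R -> R) : (fun t => a (0, t)) = (fun t => a (edge_param E12
  t)).
  by apply/funext => s; rewrite edge_paramE.
have e13 (a : R * R -> R) : (fun t => a (t, 0)) = (fun t => a (edge_param E13
  t)).
  by apply/funext => s; rewrite edge_paramE.
have e23 (a : R * R -> R) : (fun t => a (t, 1 - t)) = (fun t => a (edge_param
  E23 t)).
  by apply/funext => s; rewrite edge_paramE.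
rewrite RintegralB//; last by rewrite e12; exact: I12.
rewrite RintegralB//; [|by rewrite e23; exact: I23|by rewrite e13; exact: I13].
rewrite rev e12 e13 e23 /edge_sign /edge_vector /=.
have -> : \int[lam]_(t in `[0, 1]) (a1 (edge_param E12 t) * (0 - 0) +
    a2 (edge_param E12 t) * (1 - 0)) = \int[lam]_(t in `[0, 1]) a2 (edge_param
      E12 t).
  by apply: eq_Rintegral => t _; ring.
have -> : \int[lam]_(t in `[0, 1]) (a1 (edge_param E13 t) * (1 - 0) +
    a2 (edge_param E13 t) * (0 - 0)) = \int[lam]_(t in `[0, 1]) a1 (edge_param
      E13 t).
  by apply: eq_Rintegral => t _; ring.
have -> : \int[lam]_(t in `[0, 1]) (a1 (edge_param E23 t) * (1 - 0) +
    a2 (edge_param E23 t) * (0 - 1)) =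
    \int[lam]_(t in `[0, 1]) (a1 (edge_param E23 t) - a2 (edge_param E23 t)).
  by apply: eq_Rintegral => t _; ring.
rewrite RintegralB//; [ring|exact: I23|exact: I23].
Qed.

End Green.

(** * Calculus of C^1 functions on an open set *)

Section C1Functions.
Variable R : realType.
Variable D : set (R * R).
Hypothesis oD : open D.
Implicit Types f g : R * R -> R.

Definition C1_fun f := forall x, D x ->
  differentiable f x /\ forall v, {for x, continuous ('D_v f)}.

(** A formula for the derivative on [D] suffices: as [D] is open, it holds near each point of [D],
    which transfers continuity there. *)
Lemma derive_continuous f (g : R * R -> R * R -> R) :
  (forall x, D x -> differentiable f x) ->
  (forall v x, D x -> 'D_v f x = g v x) ->
  (forall v x, D x -> {for x, continuous (g v)}) -> C1_fun f.
Proof.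
move=> df dE cg x Dx; split; first exact: df.
move=> v; rewrite /prop_for /continuous_at dE//; apply: cvg_trans (cg v x Dx).
apply: near_eq_cvg; near=> y. rewrite dE//.
by near: y; exact: (open_nbhs_nbhs (conj oD Dx)).
Unshelve. all: by end_near. Qed.

Lemma C1_fun_cst (c : R) : C1_fun (cst c).
Proof.
apply: (derive_continuous (g := fun _ _ => 0)).
- by move=> x _; exact: differentiable_cst.
- by move=> v x _; rewrite derive_cst.
- by move=> v x _; exact: cvg_cst.
Qed.

Lemma C1_fun_linear (l : {linear (R * R)%type -> R^o}) :
  continuous l -> C1_fun l.
Proof.
move=> cl; apply: (derive_continuous (g := fun v _ => l v)).
- by move=> x _; exact: linear_differentiable.
- move=> v x _; rewrite deriveE; last exact: linear_differentiable.
  by rewrite diff_lin.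
- by move=> v x _; exact: cvg_cst.
Qed.

Lemma C1_fun_fst : C1_fun fst.
Proof. by apply: (C1_fun_linear (l := fst)) => x; exact: cvg_fst. Qed.

Lemma C1_fun_snd : C1_fun snd.
Proof. by apply: (C1_fun_linear (l := snd)) => x; exact: cvg_snd. Qed.

Lemma C1_funD f g : C1_fun f -> C1_fun g -> C1_fun (fun x => f x + g x).
Proof.
move=> cf cg; apply: (derive_continuous (g := fun v x => 'D_v f x + 'D_v g x)).
- by move=> x Dx; apply: differentiableD; [case: (cf x Dx)|case: (cg x Dx)].
- move=> v x Dx; rewrite deriveD//; apply: diff_derivable.
    by case: (cf x Dx).
  by case: (cg x Dx).
- by move=> v x Dx; apply: continuousD; [case: (cf x Dx)|case: (cg x Dx)].
Qed.

Lemma derive_mul f g v x : differentiable f x -> differentiable g x ->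
  'D_v (fun x => f x * g x) x = f x * 'D_v g x + g x * 'D_v f x.
Proof. by move=> df dg; rewrite deriveM//; exact: diff_derivable. Qed.

Lemma C1_funM f g : C1_fun f -> C1_fun g -> C1_fun (fun x => f x * g x).
Proof.
move=> cf cg.
apply: (derive_continuous (g := fun v x => f x * 'D_v g x + g x * 'D_v f x)).
- by move=> x Dx; apply: differentiableM; [case: (cf x Dx)|case: (cg x Dx)].
- by move=> v x Dx; apply: derive_mul; [case: (cf x Dx)|case: (cg x Dx)].
- move=> v x Dx; have [df cdf] := cf x Dx; have [dg cdg] := cg x Dx.
  by apply: continuousD; apply: continuousM => //;
    exact: differentiable_continuous.
Qed.

Lemma C1_fun_sum (I : Type) (s : seq I) (P : pred I) (f : I -> R * R -> R) :
  (forall i, P i -> C1_fun (f i)) -> C1_fun (fun x => \sum_(i <- s | P i) f i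
    x).
Proof.
move=> cf; elim: s => [|i s IH].
  rewrite (_ : (fun _ => _) = cst 0); first exact: C1_fun_cst.
  by apply/funext => x; rewrite big_nil.
case Pi : (P i); last first.
  rewrite (_ : (fun _ => _) = fun x => \sum_(i <- s | P i) f i x)//.
  by apply/funext => x; rewrite big_cons Pi.
rewrite (_ : (fun _ => _) = fun x => f i x + \sum_(i <- s | P i) f i x).
  by apply: C1_funD => //; exact: cf.
by apply/funext => x; rewrite big_cons Pi.
Qed.

Lemma C1_funX f n : C1_fun f -> C1_fun (fun x => f x ^+ n).
Proof.
move=> cf; elim: n => [|n IH].
  rewrite (_ : (fun _ => _) = cst 1); first exact: C1_fun_cst.
  by apply/funext => x; rewrite expr0.
rewrite (_ : (fun _ => _) = fun x => f x * f x ^+ n); first exact: C1_funM.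
by apply/funext => x; rewrite exprS.
Qed.

Lemma C1_fun_Ppoly p f : Ppoly p f -> C1_fun f.
Proof.
case=> a /funext ->; apply: C1_fun_sum => i _; apply: C1_fun_sum => j _.
apply: C1_funM; last by apply: C1_funX; exact: C1_fun_snd.
by apply: C1_funM; [exact: C1_fun_cst|apply: C1_funX; exact: C1_fun_fst].
Qed.

Lemma derive_comp (F : R * R -> R * R) (phi : R * R -> R) v x :
  differentiable F x -> differentiable phi (F x) ->
  'D_v (phi \o F) x = 'D_(1, 0) phi (F x) * ('D_v F x).1 +
                     'D_(0, 1) phi (F x) * ('D_v F x).2.
Proof.
move=> dF dphi; rewrite deriveE; last exact: differentiable_comp.
rewrite diff_comp// [LHS]/= -(deriveE v dF); move: ('D_v F x) => w.
rewrite {1}(pair_decomp w) linearD !linearZZ -!deriveE//.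
by rewrite /GRing.scale/= !(mulrC _.1) !(mulrC _.2).
Qed.

Lemma C1_fun_comp (F : R * R -> R * R) (phi : R * R -> R) :
  C1_on D F -> (forall y, differentiable phi y) ->
  (forall v, continuous ('D_v phi)) -> C1_fun (phi \o F).
Proof.
move=> cF dphi cphi.
apply: (derive_continuous (g := fun v x => 'D_(1, 0) phi (F x) * ('D_v F x).1 +
                     'D_(0, 1) phi (F x) * ('D_v F x).2)).
- by move=> x Dx; apply: differentiable_comp => //; case: (cF x Dx).
- by move=> v x Dx; apply: derive_comp => //; case: (cF x Dx).
- move=> v x Dx; have [dF cdF] := cF x Dx.
  have cFx := differentiable_continuous dF.
  have cc w : {for x, continuous (fun x => 'D_w phi (F x))}.
    by apply: (@continuous_comp _ _ _ F ('D_w phi)) => //; exact: cphi.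
  apply: continuousD; apply: continuousM; [exact: cc| |exact: cc|].
    by apply: (@continuous_comp _ _ _ ('D_v F) fst);
      [exact: cdF|exact: cvg_fst].
  by apply: (@continuous_comp _ _ _ ('D_v F) snd); [exact: cdF|exact: cvg_snd].
Qed.

End C1Functions.

(** * The weak curl on one element *)

Section Element.
Variable R : realType.
Local Notation mu := (@plane_measure R).
Local Notation lam := (@lebesgue_measure R).
Local Notation Gamma := (@Gamma R).
Local Notation mR := (measurableTypeR R).
Local Notation T0 := (@tri R (0, 0) 1).

Lemma dotvE (x : R * R) (v : 'cV[R]_2) : dotv (vec x) v = x.1 * v 0 0 + x.2 * v
  1 0.
Proof.
rewrite /dotv !mxE !big_ord_recl big_ord0 !mxE /= addr0.
by congr (_ + _ * v _ _); apply/val_inj.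
Qed.

Lemma mulmx_cV (M : 'M[R]_2) (v : 'cV[R]_2) i :
  (M *m v) i 0 = M i 0 * v 0 0 + M i 1 * v 1 0.
Proof.
rewrite !mxE !big_ord_recl big_ord0 addr0.
by congr (_ + M _ _ * v _ _); apply/val_inj.
Qed.

(** The first two equations are [J^T *m u = v], used to pull the pairing back; the other two are
    Cramer's rule, used for the continuity of the transformed field. *)
Lemma invmx_trE (J : 'M[R]_2) (v : 'cV[R]_2) : \det J != 0 ->
  let u := (invmx J)^T *m v in
  [/\ J 0 0 * u 0 0 + J 1 0 * u 1 0 = v 0 0,
      J 0 1 * u 0 0 + J 1 1 * u 1 0 = v 1 0,
      u 0 0 = (J 1 1 * v 0 0 - J 1 0 * v 1 0) / \det J &
      u 1 0 = (J 0 0 * v 1 0 - J 0 1 * v 0 0) / \det J].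
Proof.
move=> J0 u; have Ju : J^T *m u = v.
  by rewrite mulmxA -trmx_mul mulVmx ?trmx1 ?mul1mx// unitmxE unitfE.
clearbody u.
have h0 : J 0 0 * u 0 0 + J 1 0 * u 1 0 = v 0 0 by rewrite -Ju mulmx_cV !mxE.
have h1 : J 0 1 * u 0 0 + J 1 1 * u 1 0 = v 1 0 by rewrite -Ju mulmx_cV !mxE.
split; [exact: h0|exact: h1|..].
- by apply: (canRL (mulfK J0)); rewrite -h0 -h1 det_mx22; ring.
- by apply: (canRL (mulfK J0)); rewrite -h0 -h1 det_mx22; ring.
Qed.

(** A matrix multiplies plane cross products by its determinant. Here [J^T] sends [u] to [v] and, by
    the chain rule, the gradient [(p, q)] of a test function to that of its pullback; [s] will be
    the orientation. *)
Lemma cross_covariant (J : 'M[R]_2) (v : 'cV[R]_2) (s p q : R) : \det J != 0 ->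
  let u := (invmx J)^T *m v in
  (u 0 0 * q - u 1 0 * p) * (s * \det J) =
  s * (v 0 0 * (p * J 0 1 + q * J 1 1) - v 1 0 * (p * J 0 0 + q * J 1 0)).
Proof.
move=> J0 u; have [<- <- _ _] := invmx_trE v J0; rewrite -/u.
by rewrite det_mx22; ring.
Qed.

Lemma continuous_near_eq (f g : R * R -> R) (D : set (R * R)) x : open D -> D x
  ->
  (forall y, D y -> f y = g y) -> {for x, continuous f} -> {for x, continuous
    g}.
Proof.
move=> oD Dx fg cf; rewrite /prop_for /continuous_at -fg//; apply: cvg_trans cf.
apply: near_eq_cvg; near=> y; rewrite fg//.
by near: y; exact: (open_nbhs_nbhs (conj oD Dx)).
Unshelve. all: by end_near. Qed.

(** The intermediate value theorem along the segment from the origin to [x], which stays in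
    [Gamma]. *)
Lemma sgr_const_Gamma (k : R * R -> R) :
  (forall x, Gamma x -> {for x, continuous k}) -> (forall x, Gamma x -> k x !=
    0) ->
  forall x, Gamma x -> Num.sg (k x) = Num.sg (k (0, 0)).
Proof.
move=> ck kn0 x Gx.
have Gtx (t : R) : 0 <= t <= 1 -> Gamma (t * x.1, t * x.2).
  move=> /andP[t0 t1]; case: Gx => x1 x2 x12.
  split => /=; [exact: mulr_ge0|exact: mulr_ge0|].
  by rewrite -mulrDr mulr_ile1// addr_ge0.
pose g (t : R) := k (t * x.1, t * x.2).
have cg : {within `[0, 1], continuous g}.
  apply/continuous_in_subspaceT => t /set_mem/=; rewrite in_itv/= => t01.
  apply: (@continuous_comp _ _ _ (fun t : R => (t * x.1, t * x.2) : R * R) k).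
    by apply: pair_continuous; apply: continuousM;
      [exact: cvg_id|exact: cvg_cst|
      exact: cvg_id|exact: cvg_cst].
  exact/ck/Gtx.
have gn0 t : 0 <= t <= 1 -> g t != 0 by move=> /Gtx/kn0.
have g1 : g 1 = k x by rewrite /g !mul1r -surjective_pairing.
have g0 : g 0 = k (0, 0) by rewrite /g !mul0r.
rewrite -g1 -g0.
have g0n : g 0 != 0 by apply: gn0; rewrite lexx ler01.
have g1n : g 1 != 0 by apply: gn0; rewrite lexx ler01.
have noz : ~ (Num.min (g 0) (g 1) <= 0 <= Num.max (g 0) (g 1)).
  move=> h; have [t] := IVT ler01 cg h.
  by rewrite in_itv/= => /gn0/eqP.
move: (g 0) (g 1) noz g0n g1n => a b noz a0 b0.
have [a_gt0|a_lt0|/eqP] := ltgtP 0 a; last by rewrite eq_sym (negbTE a0).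
- have [b_gt0|b_lt0|/eqP] := ltgtP 0 b; last by rewrite eq_sym (negbTE b0).
    by rewrite !gtr0_sg.
  by exfalso; apply: noz; rewrite ge_min le_max !(ltW a_gt0) (ltW b_lt0) orbT.
- have [b_gt0|b_lt0|/eqP] := ltgtP 0 b; last by rewrite eq_sym (negbTE b0).
    by exfalso; apply: noz; rewrite ge_min le_max (ltW a_lt0) (ltW b_gt0) orbT.
  by rewrite !ltr0_sg.
Qed.

Variables (D : set (R * R)) (F G : R * R -> R * R).
Hypothesis FG : C1_diffeo D F G.
Hypothesis GD : Gamma `<=` D.
Variable theta : R * R -> 'cV[R]_2.
Hypothesis theta0 : C1_fun D (fun x => theta x 0 0).
Hypothesis theta1 : C1_fun D (fun x => theta x 1 0).

(** The field [piola] for a single pair of maps, without a mesh. *)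
Definition covariant (y : R * R) : 'cV[R]_2 :=
  (invmx (Jacobian F (G y)))^T *m theta (G y).

Definition ref_curl (x : R * R) : R :=
  'D_(1, 0) (fun x => theta x 1 0) x - 'D_(0, 1) (fun x => theta x 0 0) x.

Definition covariant_curl (y : R * R) : R :=
  ref_curl (G y) / \det (Jacobian F (G y)).

(** The origin is merely a sample point, as the determinant has constant sign on [Gamma]. *)
Definition orientation : R := Num.sg (\det (Jacobian F (0, 0))).

Let oD : open D. Proof. by case: FG. Qed.
Let oFD : open (F @` D). Proof. by case: FG. Qed.
Let FK x : D x -> G (F x) = x. Proof. by case: FG => ? ? H _ _; exact: H. Qed.
Let C1F : C1_on D F. Proof. by case: FG. Qed.

Let cG (k : R * R -> R) : (forall x, D x -> {for x, continuous k}) ->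
  forall y, (F @` D) y -> {for y, continuous (k \o G)}.
Proof.
move=> ck y [x Dx <-]; have [_ _ _ _ C1G] := FG.
apply: continuous_comp; last by rewrite FK//; exact: ck.
by apply: differentiable_continuous; case: (C1G (F x)) => //; exists x.
Qed.

Lemma Jacobian_continuous i j x : D x ->
  {for x, continuous (fun x => Jacobian F x i j)}.
Proof.
move=> Dx; have [_ cD] := C1F Dx.
have c1 v : {for x, continuous (fun y => ('D_v F y).1)}.
  by apply: (@continuous_comp _ _ _ ('D_v F) fst); [exact: cD|exact: cvg_fst].
have c2 v : {for x, continuous (fun y => ('D_v F y).2)}.
  by apply: (@continuous_comp _ _ _ ('D_v F) snd); [exact: cD|exact: cvg_snd].
have : i = 0 \/ i = 1 by case: i => -[|[|//]] ?; [left|right]; apply/val_inj.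
have : j = 0 \/ j = 1 by case: j => -[|[|//]] ?; [left|right]; apply/val_inj.
case=> -> [] ->.
- have -> : (fun x => Jacobian F x 0 0) = (fun y => ('D_(1, 0) F y).1).
    by apply/funext => y; have [-> _ _ _] := JacobianE F y.
  exact: c1.
- have -> : (fun x => Jacobian F x 1 0) = (fun y => ('D_(1, 0) F y).2).
    by apply/funext => y; have [_ -> _ _] := JacobianE F y.
  exact: c2.
- have -> : (fun x => Jacobian F x 0 1) = (fun y => ('D_(0, 1) F y).1).
    by apply/funext => y; have [_ _ -> _] := JacobianE F y.
  exact: c1.
- have -> : (fun x => Jacobian F x 1 1) = (fun y => ('D_(0, 1) F y).2).
    by apply/funext => y; have [_ _ _ ->] := JacobianE F y.
  exact: c2.
Qed.

Lemma continuous_div_det (k : R * R -> R) x : D x -> {for x, continuous k} ->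
  {for x, continuous (fun x => k x / \det (Jacobian F x))}.
Proof.
move=> Dx ck; apply: continuousM; first exact: ck.
apply: continuousV; first exact: (diffeo_det_neq0 FG Dx).
exact: C1_det_continuous C1F Dx.
Qed.

Let ctheta0 x : D x -> {for x, continuous (fun x => theta x 0 0)}.
Proof. by move=> /theta0[? _]; exact: differentiable_continuous. Qed.
Let ctheta1 x : D x -> {for x, continuous (fun x => theta x 1 0)}.
Proof. by move=> /theta1[? _]; exact: differentiable_continuous. Qed.

Lemma covariant_continuous i y : (F @` D) y ->
  {for y, continuous (fun y => covariant y i 0)}.
Proof.
apply: (cG (k := fun x => ((invmx (Jacobian F x))^T *m theta x) i 0)) => x Dx.
have : i = 0 \/ i = 1 by case: i => -[|[|//]] ?; [left|right]; apply/val_inj.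
case=> ->.
- apply: (@continuous_near_eq (fun x => (Jacobian F x 1 1 * theta x 0 0 -
    Jacobian F x 1 0 * theta x 1 0) / \det (Jacobian F x)) _ D) => //.
    by move=> z Dz; have [_ _ -> _] := invmx_trE (theta z) (diffeo_det_neq0 FG
      Dz).
  apply: continuous_div_det => //; apply: continuousB; apply: continuousM;
    [exact: Jacobian_continuous|exact: ctheta0|exact: Jacobian_continuous|
     exact: ctheta1].
- apply: (@continuous_near_eq (fun x => (Jacobian F x 0 0 * theta x 1 0 -
    Jacobian F x 0 1 * theta x 0 0) / \det (Jacobian F x)) _ D) => //.
    by move=> z Dz; have [_ _ _ ->] := invmx_trE (theta z) (diffeo_det_neq0 FG
      Dz).
  apply: continuous_div_det => //; apply: continuousB; apply: continuousM;
    [exact: Jacobian_continuous|exact: ctheta1|exact: Jacobian_continuous|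
     exact: ctheta0].
Qed.

Lemma ref_curl_continuous x : D x -> {for x, continuous ref_curl}.
Proof.
by move=> Dx; apply: continuousB; [case: (theta1 Dx)|case: (theta0 Dx)].
Qed.

Lemma covariant_curl_continuous y : (F @` D) y ->
  {for y, continuous covariant_curl}.
Proof.
apply: (cG (k := fun x => ref_curl x / \det (Jacobian F x))) => x Dx.
by apply: continuous_div_det => //; exact: ref_curl_continuous.
Qed.

Lemma orientationE x : Gamma x ->
  `|\det (Jacobian F x)| = orientation * \det (Jacobian F x).
Proof.
move=> Gx; rewrite /orientation.
rewrite -(@sgr_const_Gamma (fun z => \det (Jacobian F z)) _ _ x Gx).
- exact: normrEsg.
- by move=> z /GD; exact: (C1_det_continuous C1F).
- by move=> z /GD; exact: (diffeo_det_neq0 FG).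
Qed.

Lemma element_weak_curl (phi : R * R -> R) :
  (forall y, differentiable phi y) -> (forall v, continuous ('D_v phi)) ->
  \int[mu]_(y in F @` Gamma°)
     (covariant y 0 0 * 'D_(0, 1) phi y - covariant y 1 0 * 'D_(1, 0) phi y) =
  \int[mu]_(y in F @` Gamma°) (covariant_curl y * phi y) -
  orientation * \sum_j edge_sign R j * \int[lam]_(t in `[0, 1])
    (phi (F (edge_param j t)) * dotv (tangent R j) (theta (edge_param j t))).
Proof.
move=> dphi cphi.
pose psi := phi \o F.
have cpsi : C1_fun D psi by exact: C1_fun_comp.
rewrite (change_of_variables FG GD); last first.
  move=> y FDy; apply: continuousB; apply: continuousM;
    [exact: covariant_continuous|exact: cphi|
     exact: covariant_continuous|exact: cphi].
rewrite (change_of_variables FG GD); last first.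
  move=> y FDy; apply: continuousM; first exact: covariant_curl_continuous.
  exact: differentiable_continuous.
have psi1 (x : R * R) : D x -> 'D_(1, 0) psi x =
    'D_(1, 0) phi (F x) * Jacobian F x 0 0 + 'D_(0, 1) phi (F x) * Jacobian F x
      1 0.
  move=> Dx; have [-> -> _ _] := JacobianE F x.
  by apply: derive_comp => //; case: (C1F Dx).
have psi2 (x : R * R) : D x -> 'D_(0, 1) psi x =
    'D_(1, 0) phi (F x) * Jacobian F x 0 1 + 'D_(0, 1) phi (F x) * Jacobian F x
      1 1.
  move=> Dx; have [_ _ -> ->] := JacobianE F x.
  by apply: derive_comp => //; case: (C1F Dx).
have -> : \int[mu]_(x in T0)
   ((covariant (F x) 0 0 * 'D_(0, 1) phi (F x) -
     covariant (F x) 1 0 * 'D_(1, 0) phi (F x)) * `|\det (Jacobian F x)|) =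
  \int[mu]_(x in T0) (orientation *
     (theta x 0 0 * 'D_(0, 1) psi x - theta x 1 0 * 'D_(1, 0) psi x)).
  apply: eq_Rintegral => x /set_mem /tri0_Gamma Gx; have Dx := GD Gx.
  rewrite orientationE// psi1// psi2// /covariant FK//.
  by apply: cross_covariant; exact: (diffeo_det_neq0 FG Dx).
have -> : \int[mu]_(x in T0) (covariant_curl (F x) * phi (F x) *
    `|\det (Jacobian F x)|) = \int[mu]_(x in T0) (orientation *
     (ref_curl x * psi x)).
  apply: eq_Rintegral => x /set_mem /tri0_Gamma Gx; have Dx := GD Gx.
  rewrite orientationE// /covariant_curl FK// /psi [(_ \o _) x]/=.
  move: (\det _) (diffeo_det_neq0 FG Dx) (phi _) (ref_curl _) => d d0 p c.
  by field.
have mT0 : measurable (T0 : set (mR * mR)) by exact: tri_measurable.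
have int0 (k : R * R -> R) : (forall x, D x -> {for x, continuous k}) ->
    mu.-integrable (T0 : set (mR * mR)) (EFin \o k).
  move=> ck; apply: (compact_plane_integrable oD ck (@compact_Gamma R) GD) =>
    //.
  exact: tri0_Gamma.
have cpsi0 x : D x -> {for x, continuous psi}.
  by move=> /cpsi[? _]; exact: differentiable_continuous.
have cDpsi v x : D x -> {for x, continuous ('D_v psi)} by move=> /cpsi[].
have i1 : mu.-integrable (T0 : set (mR * mR)) (EFin \o (fun x =>
    theta x 0 0 * 'D_(0, 1) psi x - theta x 1 0 * 'D_(1, 0) psi x)).
  apply: int0 => x Dx; apply: continuousB; apply: continuousM;
    [exact: ctheta0|exact: cDpsi|exact: ctheta1|exact: cDpsi].
have i2 : mu.-integrable (T0 : set (mR * mR)) (EFin \o (fun x => ref_curl x *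
  psi x)).
  apply: int0 => x Dx; apply: continuousM; first exact: ref_curl_continuous.
  exact: cpsi0.
rewrite RintegralZl// RintegralZl// -mulrBr; congr (_ * _).
(* Green's formula for the field [psi * theta], whose curl is [ref_curl * psi] minus the pairing of
   [theta] with the gradient of [psi]. *)
have c1 := C1_funM oD cpsi theta0; have c2 := C1_funM oD cpsi theta1.
have /esym := @green R D _ _ oD GD (fun x Dx => (c1 x Dx).1) (fun x Dx => (c1 x
  Dx).2)
  (fun x Dx => (c2 x Dx).1) (fun x Dx => (c2 x Dx).2).
have -> : \sum_j edge_sign R j * \int[lam]_(t in `[0, 1])
     (psi (edge_param j t) * theta (edge_param j t) 0 0 * (edge_vector R j).1 +
      psi (edge_param j t) * theta (edge_param j t) 1 0 * (edge_vector R j).2) =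
  \sum_j edge_sign R j * \int[lam]_(t in `[0, 1])
    (phi (F (edge_param j t)) * dotv (tangent R j) (theta (edge_param j t))).
  apply: eq_bigr => j _; congr (_ * _); apply: eq_Rintegral => t _.
  by rewrite /tangent dotvE -/(edge_vector R j) /psi /=; ring.
move=> ->.
rewrite -RintegralB//; last 2 first.
- by apply: int0 => x Dx; case: (c2 x Dx).
- by apply: int0 => x Dx; case: (c1 x Dx).
rewrite -RintegralB//; last first.
  by apply: int0 => x Dx; apply: continuousB; [case: (c2 x Dx)|case: (c1 x Dx)].
apply: eq_Rintegral => x /set_mem /tri0_Gamma /GD Dx.
rewrite !derive_mul /ref_curl; [ring|..].
- by case: (cpsi x Dx).
- by case: (theta0 Dx).
- by case: (cpsi x Dx).
- by case: (theta1 Dx).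
Qed.

End Element.

(** * Traces on shared edges *)

Section Traces.
Variable R : realType.
Local Notation Gamma := (@Gamma R).

Lemma vpt_Gamma i : Gamma (vpt R i).
Proof. by case: i; split => /=; lra. Qed.

Lemma vpt_inj : injective (@vpt R).
Proof.
case=> -[] //= h; have := congr1 fst h; have := congr1 snd h;
  move=> {h} /= h1 h2; exfalso; lra.
Qed.

Lemma edge_param0 j : edge_param j (0 : R) = vpt R (lo j).
Proof. by rewrite edge_paramE; case: j => //=; rewrite subr0. Qed.

Lemma edge_param1 j : edge_param j (1 : R) = vpt R (hi j).
Proof. by rewrite edge_paramE; case: j => //=; rewrite subrr. Qed.

Lemma edge_setP j (x : R * R) :
  edge_set j x <-> exists2 t : R, 0 <= t <= 1 & x = edge_param j t.
Proof.
split => [[t /=]|[t t01 ->]]; first by rewrite in_itv/= => t01 <-; exists t.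
by exists t => //=; rewrite in_itv.
Qed.

Lemma edge_set_Gamma j : @edge_set R j `<=` Gamma.
Proof. by move=> _ /edge_setP[t t01 ->]; exact: edge_param_Gamma. Qed.

Lemma edge_param_inner_edge j j' (t : R) : 0 < t < 1 ->
  edge_set j' (edge_param j t) -> j' = j.
Proof.
move=> /andP[t0 t1] /edge_setP[s /andP[s0 s1]]; rewrite !edge_paramE.
by case: j; case: j' => // -[? ?]; exfalso; lra.
Qed.

Lemma edge_param_vertex j i (t : R) : 0 < t < 1 -> edge_param j t <> vpt R i.
Proof.
move=> /andP[t0 t1]; rewrite edge_paramE.
by case: j; case: i => h; have := congr1 fst h; have := congr1 snd h;
  move=> {h} /= h1 h2; lra.
Qed.

Variable M : mesh R.
Implicit Types e : 'I_(nelt M).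

Lemma mesh_diffeo e : C1_diffeo (dom e) (emap e) (einv e).
Proof.
by split; [exact: dom_open|exact: emap_open|exact: emapK|exact: emap_C1|
  exact: einv_C1].
Qed.

Lemma emap_inj e (x y : R * R) : Gamma x -> Gamma y -> emap e x = emap e y -> x
  = y.
Proof.
move=> /(@dom_Gamma R M e) ex /(@dom_Gamma R M e) ey xy.
by rewrite -(emapK ex) -(emapK ey) xy.
Qed.

(** The midpoint of [j] would lie on [j'] as well, but an inner point of an edge is on no other
    edge. *)
Lemma shared_edge_inj e j j' : shared_edge e j e j' -> j = j'.
Proof.
move=> jj'; apply/esym; apply: (@edge_param_inner_edge j j' 2^-1); first lra.
have jx : @edge_set R j (edge_param j 2^-1) by apply/edge_setP;
  exists 2^-1 => //; lra.
have : (emap e @` edge_set j) (emap e (edge_param j 2^-1)) by exists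
  (edge_param j 2^-1).
rewrite jj' => -[y jy] yx; rewrite -(emap_inj _ _ yx)//.
  exact: (edge_set_Gamma jy).
exact: (edge_set_Gamma jx).
Qed.

Variable p : nat.
Implicit Types s : scalar_idx p.

Lemma same_scalar_refl e s : same_scalar e s e s.
Proof. by case: s => [[i|[j k]]|k]. Qed.

Lemma same_scalar_sym e s e' s' :
  same_scalar e s e' s' -> same_scalar e' s' e s.
Proof.
case: s => [[i|[j k]]|k]; case: s' => [[i'|[j' k']]|k'] //=.
- by move=> [/esym ? ->].
- by move=> [-> ->].
Qed.

Lemma same_scalar_trans e s e' s' e'' s'' : same_scalar e s e' s' ->
  same_scalar e' s' e'' s'' -> same_scalar e s e'' s''.
Proof.
case: s => [[i|[j k]]|k]; case: s' => [[i'|[j' k']]|k'] //=;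
  case: s'' => [[i''|[j'' k'']]|k''] //=.
- by move=> ->.
- by move=> [jj' ->] [jj'' ->]; split => //; exact: eq_trans jj''.
- by move=> [-> ->] [-> ->].
Qed.

Lemma same_scalar_inj e s s' : same_scalar e s e s' -> s = s'.
Proof.
case: s => [[i|[j k]]|k]; case: s' => [[i'|[j' k']]|k'] //=.
- by move=> /emap_inj h; rewrite (vpt_inj (h (vpt_Gamma _) (vpt_Gamma _))).
- by move=> [/shared_edge_inj -> ->].
- by move=> [_ ->].
Qed.

Variable U : scalar_idx p -> R * R -> R.
Hypothesis U_basis : H1_conforming_basis U.

(* Conformity is applied to a single global base function: all coefficients are
   0 except those identified with [s]. *)
Lemma same_scalar_eq e s e' s' x : same_scalar e s e' s' ->
  (element e `&` element e') x -> U s (einv e x) = U s' (einv e' x).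
Proof.
move=> ss' ex.
pose c e1 s1 : R := if `[< same_scalar e s e1 s1 >] then 1 else 0.
have cE e1 s1 : same_scalar e s e1 s1 -> \sum_s2 c e1 s2 * U s2 (einv e1 x) = U
  s1 (einv e1 x).
  move=> es1; rewrite (bigD1 s1)//= big1 => [|s2 s21].
    by rewrite /c asboolT// mul1r addr0.
  rewrite /c asboolF ?mul0r// => es2.
  move/eqP: s21; apply; apply: same_scalar_inj (e1) _ _ _.
  exact: same_scalar_trans (same_scalar_sym es2) es1.
rewrite -cE; last exact: same_scalar_refl.
rewrite -(cE e')//.
apply: (basis_conforming U_basis) => // e1 s1 e2 s2 s12.
rewrite /c; congr (if _ then _ else _); apply: asbool_equiv_eq; split => h.
  exact: same_scalar_trans s12.
exact: same_scalar_trans (same_scalar_sym s12).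
Qed.

(* The position, in the template of the lower (resp. higher) vertex of [j], of the
   only vector that is not normal to [j]. *)
Definition lo_comp (j : edge) : 'I_2 := match j with E12 => 1 | E13 => 0 | E23
  => 1 end.
Definition hi_comp (j : edge) : 'I_2 := match j with E23 => 1 | _ => 0 end.

Local Notation tau j s k := (dotv (tangent R j) (tnth (@template R p s) k)).

Lemma tau_lo j k : tau j (vertex_idx p (lo j)) k = (k == lo_comp j)%:R.
Proof.
rewrite /tangent dotvE /vertex_idx.
by case: j; case: k => -[|[|//]] ?; rewrite /tnth /= !mxE /=; ring.
Qed.

Lemma tau_hi j k : tau j (vertex_idx p (hi j)) k = (k == hi_comp j)%:R.
Proof.
rewrite /tangent dotvE /vertex_idx.
by case: j; case: k => -[|[|//]] ?; rewrite /tnth /= !mxE /=; ring.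
Qed.

Lemma tau_edge j (l : 'I_p.-1) k : tau j (edge_idx j l) k = (k == 0)%:R.
Proof.
rewrite /tangent dotvE /edge_idx.
case: j; case: k => -[|[|//]] ?; rewrite /tnth /= !mxE /=; try ring.
by field.
Qed.

Lemma sum_vertex (V : nmodType) j (f : vertex -> V) :
  (forall i, i <> lo j -> i <> hi j -> f i = 0) -> \sum_i f i = f (lo j) + f
    (hi j).
Proof.
move=> f0; rewrite (bigD1 (lo j))//= (bigD1 (hi j))/=; last by case: j {f0}.
by rewrite big1 ?addr0// => i /andP[/eqP il /eqP ih]; exact: f0.
Qed.

Lemma sum_comp (f : 'I_2 -> R) (k0 : 'I_2) : \sum_k f k * (k == k0)%:R = f k0.
Proof.
rewrite (bigD1 k0)//= eqxx mulr1 big1 ?addr0// => k /negbTE ->.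
by rewrite mulr0.
Qed.

Definition elt_field (c : idx p -> R) (x : R * R) : 'cV[R]_2 :=
  \sum_b c b *: base_function U b x.

Lemma elt_fieldE (c : idx p -> R) x i :
  elt_field c x i 0 = \sum_s \sum_k (c (s, k) * U s x) * tnth (template R s) k
    i 0.
Proof.
rewrite /elt_field summxE pair_bigA/=; apply: eq_bigr => -[s k] _.
by rewrite !mxE mulrA.
Qed.

Lemma trace_expand (c : idx p -> R) j (t : R) : 0 <= t <= 1 ->
  let x := edge_param j t in
  dotv (tangent R j) (elt_field c x) =
    c (vertex_idx p (lo j), lo_comp j) * U (vertex_idx p (lo j)) x +
    c (vertex_idx p (hi j), hi_comp j) * U (vertex_idx p (hi j)) x +
    \sum_l c (edge_idx j l, 0) * U (edge_idx j l) x.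
Proof.
move=> t01 x.
have jx : edge_set j x by apply/edge_setP; exists t.
have -> : dotv (tangent R j) (elt_field c x) =
    \sum_s \sum_k (c (s, k) * U s x) * tau j s k.
  rewrite {1}/tangent dotvE !elt_fieldE !mulr_sumr -big_split/=.
  apply: eq_bigr => s _; rewrite !mulr_sumr -big_split/=; apply: eq_bigr => k _.
  by rewrite /tangent dotvE; ring.
rewrite big_sumType/= big_sumType/= [X in _ + X]big1 ?addr0; last first.
  move=> k _; apply: big1 => l _.
  by rewrite (basis_cell U_basis k jx) mulr0 mul0r.
congr (_ + _).
  rewrite (@sum_vertex _ j); last first.
    move=> i il ih; apply: big1 => k _.
    by rewrite (basis_vertex_edge U_basis il ih jx) mulr0 mul0r.
  congr (_ + _).
    by under eq_bigr do rewrite tau_lo; rewrite sum_comp.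
  by under eq_bigr do rewrite tau_hi; rewrite sum_comp.
have -> : \sum_(i : edge * 'I_p.-1) \sum_k (c (inl (inr i), k) *
     U (inl (inr i)) x) * tau j (inl (inr i)) k =
   \sum_j' \sum_l \sum_k (c (edge_idx j' l, k) * U (edge_idx j' l) x) *
     tau j (edge_idx j' l) k.
  by rewrite [RHS]pair_bigA/=; apply: eq_bigr => -[].
rewrite (bigD1 j)//= [X in _ + X]big1 ?addr0; last first.
  move=> j' /eqP j'j; apply: big1 => l _; apply: big1 => k _.
  by rewrite (basis_edge U_basis l j'j jx) mulr0 mul0r.
apply: eq_bigr => l _.
rewrite -(sum_comp (fun k => c (edge_idx j l, k) * U (edge_idx j l) x) 0).
by apply: eq_bigr => k _; rewrite tau_edge.
Qed.

Lemma trace_shared (c : 'I_(nelt M) -> idx p -> R) e j e' j' (t : R) :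
  (forall e b e' b', same_idx e b e' b' -> c e b = c e' b') ->
  shared_edge e j e' j' -> 0 <= t <= 1 ->
  dotv (tangent R j) (elt_field (c e) (edge_param j t)) =
  dotv (tangent R j') (elt_field (c e') (edge_param j' t)).
Proof.
move=> cc ee t01; have order := mesh_order ee.
have i01 : 0 <= (0 : R) <= 1 by rewrite lexx ler01.
have i11 : 0 <= (1 : R) <= 1 by rewrite lexx ler01.
rewrite !trace_expand//.
have UE s s' : same_scalar e s e' s' ->
    U s (edge_param j t) = U s' (edge_param j' t).
  move=> ss; rewrite -[in LHS](emapK (@dom_Gamma R M e _ (edge_param_Gamma j
    t01))).
  rewrite -[in RHS](emapK (@dom_Gamma R M e' _ (edge_param_Gamma j' t01))).
  rewrite -(order t t01); apply: same_scalar_eq ss _; split.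
    by exists (edge_param j t) => //; exact: edge_param_Gamma.
  by rewrite (order t t01); exists (edge_param j' t) => //;
    exact: edge_param_Gamma.
(* At [t = 0] and [t = 1] the common parametrisation matches lower with lower and higher with higher
   vertices. *)
have slo : same_scalar e (vertex_idx p (lo j)) e' (vertex_idx p (lo j')).
  by rewrite /same_scalar /= -!edge_param0; exact: order.
have shi : same_scalar e (vertex_idx p (hi j)) e' (vertex_idx p (hi j')).
  by rewrite /same_scalar /= -!edge_param1; exact: order.
rewrite (UE _ _ slo) (UE _ _ shi).
have oner : (1 : R) != 0 by rewrite oner_eq0.
(* The positions [lo_comp j] and [lo_comp j'] may differ: [same_idx] compares products by their
   non-zero tangential component, not by their place in the template. *)
congr (_ * _ + _ * _ + _).
- apply: cc; exists j, j'; split => //; split; [by left| |by left|];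
    by rewrite tau_lo eqxx.
- apply: cc; exists j, j'; split => //; split; [by right| |by right|];
    by rewrite tau_hi eqxx.
- apply: eq_bigr => l _; congr (_ * _); last by apply: UE; split.
  by apply: cc; exists j, j'; split => //; split => //; rewrite tau_edge eqxx.
Qed.

End Traces.

(** * The two sides of an edge *)

Section Sides.
Variable R : realType.
Local Notation Gamma := (@Gamma R).
Local Notation open_Gamma := (@open_Gamma R).

(** Barycentric coordinates, indexed by the edge opposite to the vertex that they belong to. *)
Definition bary (j : edge) (z : R * R) : R :=
  match j with E12 => z.1 | E13 => z.2 | E23 => 1 - z.1 - z.2 end.

Lemma Gamma_bary z : Gamma z <-> forall j, 0 <= bary j z.
Proof.
split => [[z1 z2 z12] [] /=|h]; try by lra.
have := h E12; have := h E13; have := h E23 => /= *; split; lra.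
Qed.

Lemma open_Gamma_bary z : open_Gamma z <-> forall j, 0 < bary j z.
Proof.
split => [[z1 z2 z12] [] /=|h]; try by lra.
have := h E12; have := h E13; have := h E23 => /= *; split; lra.
Qed.

Definition bary_lin (j : edge) (z : R * R) : R :=
  match j with E12 => z.1 | E13 => z.2 | E23 => - z.1 - z.2 end.

Lemma baryD j (z w : R * R) : bary j (z + w) = bary j z + bary_lin j w.
Proof. by rewrite add_pairE; case: j => /=; ring. Qed.

Lemma bary_lin_bound j (w : R * R) (c : R) : `|w| <= c -> `|bary_lin j w| <= 2
  * c.
Proof.
move=> /norm_pair_le; rewrite !ler_norml => -[/andP[? ?] /andP[? ?]].
by case: j => /=; apply/andP; split; lra.
Qed.

Lemma bary_linD j (z w : R * R) : bary_lin j (z + w) = bary_lin j z + bary_lin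
  j w.
Proof. by rewrite add_pairE; case: j => /=; ring. Qed.

Lemma bary_linZ j (c : R) (w : R * R) : bary_lin j (c *: w) = c * bary_lin j w.
Proof. by rewrite scale_pairE; case: j => /=; ring. Qed.

Lemma bary_edge j (t : R) : bary j (edge_param j t) = 0.
Proof. by rewrite edge_paramE; case: j => /=; ring. Qed.

Definition rot90 (v : R * R) : R * R := (- v.2, v.1).

Lemma bary_lin_normal (J Ji : 'M[R]_2) j : J *m Ji = 1%:M ->
  let tau := mxapp J (edge_vector R j) in
  bary_lin j (mxapp Ji (rot90 tau)) * \det J =
  edge_sign R j * (tau.1 ^+ 2 + tau.2 ^+ 2).
Proof.
move=> JJi tau; have /(congr1 (mxapp J)) := erefl (mxapp Ji (rot90 tau)).
rewrite [X in X = _ -> _]mxapp_mul JJi mxapp1.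
move: (mxapp Ji (rot90 tau)) => w h.
have h1 : - tau.2 = J 0 0 * w.1 + J 0 1 * w.2 by have := congr1 fst h.
have h2 : tau.1 = J 1 0 * w.1 + J 1 1 * w.2 by have := congr1 snd h.
have -> : tau.1 ^+ 2 + tau.2 ^+ 2 = tau.1 * (J 1 0 * w.1 + J 1 1 * w.2) -
    tau.2 * (J 0 0 * w.1 + J 0 1 * w.2) by rewrite -h1 -h2; ring.
rewrite /tau /mxapp /edge_vector det_mx22.
by case: j {tau h h1 h2} => /=; rewrite /edge_sign; ring.
Qed.

(* The barycentric coordinate that vanishes on the edge [j] grows along [nu] at
   the rate [edge_sign j * |tau|^2 / det J], where [tau] is the tangent of the
   edge in the mesh and [nu] is [tau] turned by a right angle. *)
Lemma side_of_edge (D : set (R * R)) (F G : R * R -> R * R) j (t : R) :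
  C1_diffeo D F G -> Gamma `<=` D -> 0 < t < 1 ->
  let x := edge_param j t in
  let nu := rot90 (mxapp (Jacobian F x) (edge_vector R j)) in
  \forall h \near (0 : R)^'+, forall k : R, `|k| = h ->
    (0 < k * (edge_sign R j * \det (Jacobian F x)) ->
       (F @` open_Gamma) (F x + k *: nu)) /\
    (k * (edge_sign R j * \det (Jacobian F x)) < 0 ->
       ~ (F @` Gamma) (F x + k *: nu)).
Proof.
move=> FG GD t01 x nu; have [oD oFD FK C1F C1G] := FG.
have t01' : 0 <= t <= 1 by case/andP: t01 => ? ?; apply/andP; split; exact: ltW.
have Gx : Gamma x := edge_param_Gamma j t01'.
have Dx := GD _ Gx.
have dG : differentiable G (F x) by case: (C1G (F x)) => //; exists x.
have JiJ := diffeo_Jacobian_inverse FG Dx.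
have J0 := diffeo_det_neq0 FG Dx.
have approx (c : R) : 0 < c -> exists2 d : R, 0 < d & forall y, `|F x - y| < d
  ->
    (F @` D) y /\
    `|G y - x - mxapp (Jacobian G (F x)) (y - F x)| <= c * `|y - F x|.
  move=> c0.
  have nD : nbhs (F x) (F @` D) by apply: open_nbhs_nbhs; split => //; exists x.
  have : nbhs (F x) (F @` D `&` [set y | `|G y - x -
      mxapp (Jacobian G (F x)) (y - F x)| <= c * `|y - F x|]).
    by apply: filterI => //; have := diff_approx dG c0; rewrite FK.
  move=> /nbhs_ballP[d /= d0 H].
  by exists d => // y yd; apply: H; rewrite -ball_normE.
rewrite /nu; move: (Jacobian F x) (Jacobian G (F x)) JiJ J0 approx => J Ji JiJ
  J0 approx.
have JJi := mulmx1C JiJ.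
pose tau := mxapp J (edge_vector R j).
have normal := bary_lin_normal j JJi; rewrite -/tau in normal *.
have tau0 : 0 < tau.1 ^+ 2 + tau.2 ^+ 2.
  rewrite lt_neqAle addr_ge0 ?sqr_ge0// andbT eq_sym.
  apply/negP => /eqP/eqP; rewrite paddr_eq0 ?sqr_ge0// !sqrf_eq0 => /andP[/eqP
    e1 /eqP e2].
  have : edge_vector R j = mxapp Ji tau by rewrite /tau mxapp_mul JiJ mxapp1.
  rewrite /mxapp e1 e2 !mulr0 addr0 /edge_vector => h.
  have := congr1 fst h; have := congr1 snd h; move=> {h} /=.
  by case: (j) => /= *; lra.
clearbody tau.
move: {J J0 JiJ JJi} (\det J) J0 normal => dJ dJ0 /=.
have Jiw (k : R) : mxapp Ji (k *: rot90 tau) = k *: mxapp Ji (rot90 tau) by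
  exact: mxappZ.
move: (mxapp Ji (rot90 tau)) Jiw => w Jiw normal.
pose S := edge_sign R j * dJ; pose kap := bary_lin j w.
have kapS : 0 < kap * S.
  rewrite /S /kap mulrCA normal mulrA mulr_gt0//.
  by case: (j); rewrite /edge_sign/=; lra.
have kap0 : 0 < `|kap|.
  by rewrite normr_gt0; apply/eqP => e; rewrite e mul0r ltxx in kapS.
pose N := `|rot90 tau|; have N0 : 0 <= N by exact: normr_ge0.
(* With this tolerance the remainder changes the coordinate of [j] by at most half of its linear
   growth [h * |kap|], so it cannot alter the sign. *)
have [c c0 cN] : exists2 c : R, 0 < c & 2 * (c * N) <= `|kap| / 2.
  have N1 : 0 < N + 1 by lra.
  exists (`|kap| / (4 * (N + 1))); first by rewrite divr_gt0// mulr_gt0.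
  rewrite mulrAC [2 * _]mulrA ler_pdivrMr ?mulr_gt0//.
  have : 0 <= `|kap| * N by rewrite mulr_ge0// ltW.
  by nra.
have [d d0 appr] := approx c c0.
(* A lower bound of the other two barycentric coordinates at [x]. They stay positive while
   [2 * (h * B) < m], where [h * B] bounds the displacement of [G]. *)
pose m := Num.min t (1 - t).
have m0 : 0 < m by case/andP: t01 => ? ?; rewrite lt_min; apply/andP; split;
  lra.
have mle j' : j' <> j -> m <= bary j' x.
  rewrite /x edge_paramE /m ge_min.
  by case: (j); case: j' => //= _; apply/orP;
    [left|right|left|right|left|right]; lra.
pose B := `|w| + c * N; have B0 : 0 <= B by rewrite addr_ge0// mulr_ge0// ltW.
have N1 : 0 < N + 1 by lra.
have NN1 : N <= N + 1 by lra.
have B1 : 0 < 2 * B + 1 by lra.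
have BB1 : 2 * B <= 2 * B + 1 by lra.
have kap2 : `|kap| / 2 < `|kap| by lra.
have a0 := divr_gt0 d0 N1.
have b0 := divr_gt0 m0 B1.
near=> h => k kh.
have h0 : 0 < h by near: h; exact: nbhs_right_gt.
have hd : h * N < d.
  apply: (@le_lt_trans _ _ (h * (N + 1))); first by rewrite ler_pM2l.
  by rewrite -ltr_pdivlMr//; near: h; exact: nbhs_right_lt.
have hB : 2 * (h * B) < m.
  apply: (@le_lt_trans _ _ (h * (2 * B + 1))).
    by rewrite mulrCA ler_pM2l.
  by rewrite -ltr_pdivlMr//; near: h; exact: nbhs_right_lt.
pose y := F x + k *: rot90 tau.
have yx : y - F x = k *: rot90 tau by rewrite /y addrC addKr.
have [|FDy] := appr y; first by rewrite distrC yx normrZ kh.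
rewrite yx normrZ kh Jiw => Gy.
pose r := G y - x - k *: w.
have GyE : G y = x + (k *: w + r).
  by rewrite /r [k *: w + _]addrC subrK addrC subrK.
have bj : bary j (G y) = k * kap + bary_lin j r.
  by rewrite GyE baryD bary_edge add0r bary_linD bary_linZ.
have rb : `|bary_lin j r| < `|k * kap|.
  apply: (@le_lt_trans _ _ (2 * (c * (h * N)))); first exact: bary_lin_bound.
  rewrite normrM kh; apply: (@le_lt_trans _ _ (h * (`|kap| / 2))).
    have -> : 2 * (c * (h * N)) = h * (2 * (c * N)) by ring.
    by rewrite ler_pM2l.
  by rewrite ltr_pM2l.
have bo j' : j' <> j -> 0 < bary j' (G y).
  move=> j'j; rewrite GyE baryD.
  have : `|bary_lin j' (k *: w + r)| <= 2 * (h * B).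
    apply: bary_lin_bound; apply: (le_trans (ler_normD _ _)).
    rewrite normrZ kh /B mulrDr lerD2l; apply: (le_trans Gy).
    by rewrite mulrCA.
  have := mle j' j'j; rewrite ler_norml => h1 /andP[h2 _].
  rewrite -[X in X < _](subrr (2 * (h * B))); apply: ltr_leD => //.
  exact: lt_le_trans h1.
have sgn_kS : (k * S) * (kap * S) = (k * kap) * S ^+ 2 by ring.
have S2 : 0 < S ^+ 2.
  by rewrite exprn_even_gt0//=; apply/eqP => e; have := kapS;
    rewrite e mulr0 ltxx.
split => kS.
- have kk : 0 < k * kap by rewrite -(pmulr_lgt0 _ S2) -sgn_kS mulr_gt0.
  exists (G y); last by case: FDy => z Dz zE; rewrite -/y -zE FK.
  apply/open_Gamma_bary => j'; have [->|/eqP] := eqVneq j' j; last exact: bo.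
  rewrite bj; move: rb; rewrite (gtr0_norm kk) ltr_norml => /andP[+ _].
  by move: (k * kap) (bary_lin j r) => *; lra.
- have kk : k * kap < 0.
    by rewrite -(pmulr_llt0 _ S2) -sgn_kS pmulr_llt0.
  move=> [y' Gy' y'E]; have := (Gamma_bary y').1 Gy' j.
  have -> : y' = G y by rewrite /y -y'E FK//; exact: GD.
  rewrite bj; move: rb; rewrite (ltr0_norm kk) ltr_norml => /andP[_ +].
  by move: (k * kap) (bary_lin j r) => *; lra.
Unshelve. all: by end_near. Qed.

End Sides.

(** By uniqueness the choice of mates is an involution where [g] is non-zero; reindexing by it turns
    the sum into its negative. Later [r] is the sharing of an edge, [s] the side and [g] the common
    integrand at a fixed [t]. *)
Lemma sum_opposite_mates (R : realType) (I : finType) (s g : I -> R) (r : I ->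
  I -> Prop) :
  (forall i j, r i j -> r j i) -> (forall i j k, r i j -> r j k -> r i k) ->
  (forall i j, r i j -> g i = g j) ->
  (forall i, g i != 0 -> exists2 j, r i j & s j = - s i) ->
  (forall i j, g i != 0 -> r i j -> s j = s i -> j = i) ->
  \sum_i s i * g i = 0.
Proof.
move=> rsym rtrans rg mate uniq.
have hm i : exists j, g i != 0 -> r i j /\ s j = - s i.
  have [gi0|gi0] := eqVneq (g i) 0; first by exists i.
  by have [j ? ?] := mate i gi0; exists j.
have [m mP] := choice hm.
have gm i : g i != 0 -> g (m i) = g i by move=> /mP[/rg ->].
have mm i : g i != 0 -> m (m i) = i.
  move=> gi; have [r1 s1] := mP _ gi.
  have [|r2 s2] := mP (m i); first by rewrite gm.
  by apply: (uniq i) => //; [exact: rtrans r2|rewrite s2 s1 opprK].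
have E : \sum_i s i * g i = \sum_(i | g i != 0) s i * g i.
  rewrite [LHS](bigID (fun i => g i != 0))/= [X in _ + X]big1 ?addr0// => i.
  by rewrite negbK => /eqP ->; rewrite mulr0.
rewrite E; set S := \sum_(i | _) _.
suff SN : S = - S by lra.
rewrite {1}/S (reindex_onto m m)/=; last by move=> i; exact: mm.
rewrite /S -sumrN; apply: eq_big => [i|i /andP[gmi /eqP mmi]].
  apply/andP/idP => [[gmi /eqP mmi]|gi]; last by rewrite gm// mm.
  by rewrite -mmi gm.
have gi : g i != 0 by rewrite -mmi gm.
by have [_ ->] := mP i gi; rewrite gm// mulNr.
Qed.

(** * The elements on the two sides of a mesh edge *)

Section MeshSides.
Variable R : realType.
Local Notation Gamma := (@Gamma R).
Local Notation open_Gamma := (@open_Gamma R).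
Variable M : mesh R.
Implicit Types e : 'I_(nelt M).

Let GD e : Gamma `<=` dom e. Proof. exact: dom_Gamma. Qed.

Lemma ltW01 (t : R) : 0 < t < 1 -> 0 <= t <= 1.
Proof. by case/andP => ? ?; apply/andP; split; exact: ltW. Qed.

Lemma edge_paramD j (t h : R) :
  edge_param j (h + t) = h *: edge_vector R j + edge_param j t.
Proof.
by rewrite /edge_param /edge_vector !scale_pairE !add_pairE/=; congr pair; ring.
Qed.

(* The parametrisations of the edge by the two elements are the same curve. *)
Lemma tangent_shared e j e' j' (t : R) : shared_edge e j e' j' -> 0 < t < 1 ->
  mxapp (Jacobian (emap e) (edge_param j t)) (edge_vector R j) =
  mxapp (Jacobian (emap e') (edge_param j' t)) (edge_vector R j').
Proof.
move=> ee t01; have order := mesh_order ee.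
have dF e1 j1 : differentiable (emap e1) (edge_param j1 t).
  by case: (emap_C1 (@GD e1 _ (edge_param_Gamma j1 (ltW01 t01)))).
have cvF e1 j1 : (fun h : R => h^-1 *: (emap e1 (edge_param j1 (h + t)) -
    emap e1 (edge_param j1 t))) @ 0^' -->
    mxapp (Jacobian (emap e1) (edge_param j1 t)) (edge_vector R j1).
  rewrite -diff_mxapp// -deriveE//.
  have := diff_derivable (v := edge_vector R j1) (dF e1 j1).
  rewrite /derivable /derive.
  have -> : (fun h : R => h^-1 *: (emap e1 (edge_param j1 (h + t)) -
      emap e1 (edge_param j1 t))) = (fun h => h^-1 *: ((emap e1 \o
      shift (edge_param j1 t)) (h *: edge_vector R j1) - emap e1 (edge_param j1
        t))).
    by apply/funext => h /=; rewrite edge_paramD.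
  by [].
apply: (cvg_unique (@norm_hausdorff _ _) (cvF e j)).
apply: cvg_trans (cvF e' j'); apply: near_eq_cvg.
case/andP: t01 => t0 t1.
near=> h.
rewrite (order t) ?(ltW t0) ?(ltW t1)//.
have h1 : `|h| < Num.min t (1 - t).
  near: h; apply: (@dnbhs0_lt R R); by rewrite lt_min t0 subr_gt0.
move: h1; rewrite lt_min !ltr_norml => /andP[/andP[h1 h2] /andP[h3 h4]].
by rewrite order//; lra.
Unshelve. all: by end_near. Qed.

Lemma near_direction (P nu : R * R) (A : set (R * R)) : nbhs P A ->
  \forall h \near (0 : R)^'+, forall k : R, `|k| = h -> A (P + k *: nu).
Proof.
move=> /nbhs_ballP[d /= d0 PA].
have n0 : 0 < `|nu| + 1 by rewrite ltr_wpDl.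
have a0 := divr_gt0 d0 n0.
near=> h => k kh; apply: PA; rewrite -ball_normE /ball_/=.
rewrite opprD addrA subrr add0r normrN normrZ kh.
have h0 : 0 < h by near: h; exact: nbhs_right_gt.
apply: (@le_lt_trans _ _ (h * (`|nu| + 1))); first by rewrite ler_pM2l// lerDl.
by rewrite -ltr_pdivlMr//; near: h; exact: nbhs_right_lt.
Unshelve. all: by end_near. Qed.

Lemma element_compact e : compact (element e).
Proof.
apply: continuous_compact; last exact: compact_Gamma.
apply/continuous_in_subspaceT => x /set_mem /(@GD e) Dx.
by apply: differentiable_continuous; case: (emap_C1 Dx).
Qed.

Lemma element_closed e : closed (element e).
Proof. exact: (compact_closed (@norm_hausdorff _ _) (@element_compact e)). Qed.

Lemma open_Gamma_vertex i : ~ open_Gamma (vpt R i).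
Proof. by case: i => -[] /=; lra. Qed.

Lemma open_Gamma_edge j z : edge_set j z -> ~ open_Gamma z.
Proof.
by move=> /edge_setP[t _ ->] /open_Gamma_bary /(_ j); rewrite bary_edge ltxx.
Qed.

Lemma open_GammaS : open_Gamma `<=` Gamma.
Proof. by move=> x [x1 x2 x12]; split; exact: ltW. Qed.

(** Distinct elements of a conforming mesh meet only in images of boundary points of [Gamma]. *)
Lemma elements_no_overlap e e' z z' : open_Gamma z -> Gamma z' ->
  emap e z = emap e' z' -> e = e'.
Proof.
move=> oz Gz' zz'; have Gz := open_GammaS oz.
have [//|/eqP ee'] := eqVneq e e'; exfalso.
have Iz : (emap e @` Gamma `&` emap e' @` Gamma) (emap e z).
  by split; [exists z|exists z'].
have [I0|[i [i' [Ii _]]]|[j [j' [Ij _]]]] := mesh_conforming ee'.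
- by rewrite I0 in Iz.
- rewrite Ii in Iz; apply: (@open_Gamma_vertex i).
  by rewrite -(emap_inj Gz (vpt_Gamma _ i) Iz).
- rewrite Ij in Iz; have [y jy yz] := Iz.
  apply: (open_Gamma_edge jy).
  by rewrite (emap_inj (edge_set_Gamma jy) Gz yz).
Qed.

(** Two distinct elements that contain an inner point of [j] meet in more than a vertex, hence in a
    whole edge; for the first element this can only be [j]. *)
Lemma edge_neighbour e j e' (t : R) : 0 < t < 1 ->
  element e' (emap e (edge_param j t)) -> exists j', shared_edge e j e' j'.
Proof.
move=> t01 e'P; have Gx := edge_param_Gamma j (ltW01 t01).
have [<-|/eqP ee'] := eqVneq e e'; first by exists j.
have IP : (emap e @` Gamma `&` emap e' @` Gamma) (emap e (edge_param j t)).
  by split => //; exists (edge_param j t).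
have [I0|[i [i' [Ii _]]]|[j1 [j' [Ij Ij']]]] := mesh_conforming ee'.
- by rewrite I0 in IP.
- rewrite Ii in IP; exfalso.
  apply: (@edge_param_vertex R j i t t01).
  exact: (emap_inj Gx (vpt_Gamma _ i) IP).
- rewrite Ij in IP; have [y jy yx] := IP.
  have yE := emap_inj (edge_set_Gamma jy) Gx yx; rewrite yE in jy.
  exists j'; rewrite /shared_edge -Ij' Ij.
  by rewrite (edge_param_inner_edge t01 jy).
Qed.

(** The sign of the edge in the boundary terms. It is 1 if the element lies to the left of the edge
    run from its lower to its higher vertex, and -1 if it lies to the right. *)
Definition side_sign (i : 'I_(nelt M) * edge) : R :=
  orientation (emap i.1) * edge_sign R i.2.

Lemma side_signE e j x : Gamma x ->
  side_sign (e, j) = Num.sg (edge_sign R j * \det (Jacobian (emap e) x)).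
Proof.
move=> Gx.
have h1 z : Gamma z -> {for z, continuous (fun z => \det (Jacobian (emap e)
  z))}.
  by move=> /(@GD e); exact: (C1_det_continuous (@emap_C1 R M e)).
have h2 z : Gamma z -> \det (Jacobian (emap e) z) != 0.
  by move=> /(@GD e); exact: (diffeo_det_neq0 (mesh_diffeo e)).
have E : Num.sg (\det (Jacobian (emap e) x)) = orientation (emap e).
  exact: (sgr_const_Gamma h1 h2 Gx).
change (orientation (emap e) * edge_sign R j =
  Num.sg (edge_sign R j * \det (Jacobian (emap e) x))).
rewrite -E; move: (\det _) => d; rewrite sgrM mulrC; congr (_ * _).
by case: j; rewrite /edge_sign ?sgrN ?sgr1.
Qed.

(** Small steps from [P] along [nu] in both directions stay in the domain, so each ends in some
    element, which must share the edge; its side sign is the direction of the step. Two elements on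
    the same side would have a common interior point. *)
Lemma opposite_neighbour (i : 'I_(nelt M) * edge) (t : R) : 0 < t < 1 ->
  (mesh_domain M)° (emap i.1 (edge_param i.2 t)) ->
  (exists2 i', shared_edge i.1 i.2 i'.1 i'.2 & side_sign i' = - side_sign i) /\
  (forall i', shared_edge i.1 i.2 i'.1 i'.2 -> side_sign i' = side_sign i -> i'
    = i).
Proof.
case: i => e j /= t01 PA; set P := emap e (edge_param j t) in PA *.
have Gx j1 := edge_param_Gamma j1 (ltW01 t01).
pose nu := rot90 (mxapp (Jacobian (emap e) (edge_param j t)) (edge_vector R j)).
pose S (i : 'I_(nelt M) * edge) := edge_sign R i.2 *
  \det (Jacobian (emap i.1) (edge_param i.2 t)).
have sS i : side_sign i = Num.sg (S i).
  by case: i => e1 j1; exact: side_signE (Gx j1).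
have S0 i : S i != 0.
  apply: mulf_neq0; first by case: i.2; rewrite /edge_sign ?oppr_eq0 oner_eq0.
  exact: (diffeo_det_neq0 (mesh_diffeo i.1) (@GD i.1 _ (Gx i.2))).
have nA := near_direction nu PA.
(* Elements are closed and finite in number, so a small step cannot enter one that does not contain
   [P]. *)
have nF : \forall h \near (0 : R)^'+, forall e1, ~ element e1 P ->
    forall k : R, `|k| = h -> ~ element e1 (P + k *: nu).
  apply: filter_forall => e1.
  have [eP|neP] := pselect (element e1 P); first by apply: nearW => h /(_ eP).
  have : nbhs P (~` element e1).
    by apply: open_nbhs_nbhs; split => //; exact/closed_openC/element_closed.
  by move=> /(near_direction nu); apply: filterS => h H _.
have nS : \forall h \near (0 : R)^'+, forall i, shared_edge e j i.1 i.2 ->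
    forall k : R, `|k| = h ->
    (0 < k * S i -> (emap i.1 @` open_Gamma) (P + k *: nu)) /\
    (k * S i < 0 -> ~ element i.1 (P + k *: nu)).
  apply: filter_forall => i.
  have [ei|nei] := pselect (shared_edge e j i.1 i.2);
    last by apply: nearW => h /nei.
  have := side_of_edge i.2 (mesh_diffeo i.1) (@GD i.1) t01.
  rewrite /= -(tangent_shared ei t01) -/nu.
  by rewrite -(mesh_order ei (ltW01 t01)) -/P; apply: filterS => h H _.
clearbody S nu.
have nh : \forall h \near (0 : R)^'+, 0 < h by exact: nbhs_right_gt.
have [h [[h0 hS] [hF hA]]] := filter_ex (filterI (filterI nh nS) (filterI nF
  nA)).
have h00 : `|h| = h by rewrite gtr0_norm.
have hN : `|- h| = h by rewrite normrN.
have ex (k : R) : `|k| = h -> exists2 i', shared_edge e j i'.1 i'.2 & 0 < k * S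
  i'.
  move=> kh; have [e1 _ e1k] := hA k kh.
  have e1P : element e1 P by apply: contrapT => /hF /(_ k kh).
  have [j1 ej1] := edge_neighbour t01 e1P.
  exists (e1, j1); first exact: ej1.
  have [_ H] := hS (e1, j1) ej1 k kh.
  rewrite lt_neqAle eq_sym mulf_neq0 ?S0//=; last by rewrite -normr_gt0 kh.
  by rewrite leNgt; apply/negP => /H.
have uniq (k : R) i1 i2 : `|k| = h -> shared_edge e j i1.1 i1.2 ->
    shared_edge e j i2.1 i2.2 -> 0 < k * S i1 -> 0 < k * S i2 -> i1 = i2.
  case: i1 => e1 j1; case: i2 => e2 j2 kh sh1 sh2 k1 k2.
  have [/(_ k1)[z1 oz1 z1E] _] := hS _ sh1 k kh.
  have [/(_ k2)[z2 oz2 z2E] _] := hS _ sh2 k kh.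
  have e12 : e1 = e2.
    by apply: (elements_no_overlap oz1 (open_GammaS oz2)); rewrite z1E z2E.
  move: sh1 sh2 => /= sh1 sh2; rewrite -e12 in sh2 *.
  by rewrite (@shared_edge_inj _ _ e1 j1 j2)// /shared_edge -sh1.
have refl : shared_edge e j (e, j).1 (e, j).2 by [].
have := S0 (e, j); have := sS (e, j).
move=> -> Sn; split.
- have [Sp|Sm|Sz] := ltgtP 0 (S (e, j)).
  + have [i' sh kS] := ex (- h) hN; exists i'; first exact: sh.
    rewrite sS (gtr0_sg Sp); apply: ltr0_sg.
    by move: kS; rewrite mulNr oppr_gt0 pmulr_rlt0.
  + have [i' sh kS] := ex h h00; exists i'; first exact: sh.
    rewrite sS (ltr0_sg Sm) opprK; apply: gtr0_sg.
    by move: kS; rewrite pmulr_rgt0.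
  + by rewrite -Sz eqxx in Sn.
- move=> i' sh; rewrite sS => sgE.
  have [Sp|Sm|Sz] := ltgtP 0 (S (e, j)).
  + have k1 : 0 < h * S i' by rewrite (pmulr_rgt0 _ h0) -sgr_gt0 sgE sgr_gt0.
    have k2 : 0 < h * S (e, j) by rewrite (pmulr_rgt0 _ h0).
    exact: (uniq h i' (e, j) h00 sh refl k1 k2).
  + have k1 : 0 < - h * S i'.
      by rewrite mulNr oppr_gt0 (pmulr_rlt0 _ h0) -sgr_lt0 sgE sgr_lt0.
    have k2 : 0 < - h * S (e, j) by rewrite mulNr oppr_gt0 (pmulr_rlt0 _ h0).
    exact: (uniq (- h) i' (e, j) hN sh refl k1 k2).
  + by rewrite -Sz eqxx in Sn.
Qed.

End MeshSides.

(** * Assembly *)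

Section SquareIntegrable.
Context d {T : measurableType d} {R : realType}.
Variable mu : {measure set T -> \bar R}.

Lemma bounded_Lfun2 (E : set T) (f : T -> R) : measurable E -> (mu E < +oo)%E ->
  measurable_fun E f -> [bounded f x | x in E] -> f \_ E \in Lfun mu 2%:E.
Proof.
move=> mE muE mf bf; have mfE : measurable_fun setT (f \_ E).
  exact/(measurable_restrictT _ mE).
rewrite inE; apply/andP; split; first by rewrite inE.
rewrite inE /= /finite_norm unlock poweR_lty//.
apply: integrable_lty => //.
have -> : (fun x => (`|(EFin \o f \_ E) x| `^ 2)%E) =
    (EFin \o (fun x => `|f x| ^+ 2)) \_ E.
  apply/funext => x; rewrite /= !patchE; case: ifPn => _ /=.
    by rewrite powR_mulrn.
  by rewrite normr0 powR0.
apply/(integrable_mkcond _ mE); apply: measurable_bounded_integrable => //.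
  by apply: measurable_funX; exact: measurableT_comp.
have [K [_ fK]] := bf; exists (`|K + 1| ^+ 2); split; first exact: num_real.
move=> r Kr x Ex; rewrite /= normrX normr_id; apply: ltW; apply: le_lt_trans Kr.
rewrite lerXn2r ?nnegrE//.
by apply: (le_trans (fK (K + 1) _ x Ex)); rewrite ?ltrDl// ler_norm.
Qed.

End SquareIntegrable.

Section Assembly.
Variable R : realType.
Local Notation mu := (@plane_measure R).
Local Notation lam := (@lebesgue_measure R).
Local Notation Gamma := (@Gamma R).
Local Notation mR := (measurableTypeR R).
Variable M : mesh R.
Implicit Types e : 'I_(nelt M).

(** Neighbourhoods are pulled back by the continuity of the element map in one direction and of its
    inverse, on an open image, in the other. *)
Lemma interior_element e : (element e)° = emap e @` Gamma°.
Proof.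
have GD := @dom_Gamma R M e.
have FG := mesh_diffeo e.
apply/seteqP; split => [y ye|_ [x Gx <-]].
  have [x Gx xy] := interior_subset ye; exists x => //.
  rewrite -xy in ye.
  have cF : {for x, continuous (emap e)}.
    by apply: differentiable_continuous; case: (emap_C1 (GD _ Gx)).
  have nF : nbhs x (emap e @^-1` (element e)) by exact: cF ye.
  have nD : nbhs x (dom e).
    by apply: open_nbhs_nbhs; split; [exact: dom_open|exact: GD].
  apply: (filterS _ (filterI nF nD)) => z [[z' Gz' zz'] Dz].
  by rewrite -(emapK Dz) -zz' emapK//; exact: GD.
have Dx := GD _ (interior_subset Gx).
have cG : {for emap e x, continuous (einv e)}.
  by apply: differentiable_continuous;
    case: (@einv_C1 R M e (emap e x)) => //; exists x.
have nG : nbhs (emap e x) (einv e @^-1` Gamma).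
  by apply: cG; rewrite emapK.
have nD : nbhs (emap e x) (emap e @` dom e).
  by apply: open_nbhs_nbhs; split; [exact: emap_open|exists x].
apply: (filterS _ (filterI nG nD)) => y [Gy [z Dz zy]].
by exists z => //; move: Gy; rewrite /= -zy emapK.
Qed.

Lemma mesh_domain_measurable : measurable (mesh_domain M : set (mR * mR)).
Proof.
apply: countable_bigcupT_measurable; first exact: countableP.
by move=> e; apply: closed_plane_measurable; exact: element_closed.
Qed.

Variables (p : nat) (U : scalar_idx p -> R * R -> R).
Hypothesis U_basis : H1_conforming_basis U.
Variable c : 'I_(nelt M) -> idx p -> R.
Hypothesis c_same : forall e b e' b', same_idx e b e' b' -> c e b = c e' b'.

Lemma elt_field_C1 e (D : set (R * R)) i : open D ->
  C1_fun D (fun x => elt_field U (c e) x i 0).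
Proof.
move=> oD.
have -> : (fun x => elt_field U (c e) x i 0) = fun x =>
    \sum_s \sum_k (c e (s, k) * U s x) * tnth (template R s) k i 0.
  by apply/funext => x; rewrite elt_fieldE.
apply: C1_fun_sum => // s _; apply: C1_fun_sum => // k _.
apply: C1_funM => //; last exact: C1_fun_cst.
apply: C1_funM => //; first exact: C1_fun_cst.
exact: C1_fun_Ppoly (basis_poly U_basis s).
Qed.

(** Shared edges have one common parametrisation, so all terms can be put under a single integral
    over [t], whose integrand vanishes: for a given [t], an edge point where [phi] is non-zero is
    interior to the domain and has its opposite neighbour. *)
Lemma boundary_terms_cancel (phi : R * R -> R) :
  (forall y, differentiable phi y) ->
  (forall y, phi y != 0 -> (mesh_domain M)° y) ->
  \sum_e orientation (emap e) * \sum_j edge_sign R j * \int[lam]_(t in `[0, 1])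
    (phi (emap e (edge_param j t)) *
     dotv (tangent R j) (elt_field U (c e) (edge_param j t))) = 0.
Proof.
move=> dphi phiA.
pose g (i : 'I_(nelt M) * edge) (t : R) := phi (emap i.1 (edge_param i.2 t)) *
  dotv (tangent R i.2) (elt_field U (c i.1) (edge_param i.2 t)).
have cg i t : 0 <= t <= 1 -> {for t, continuous (g i)}.
  move=> t01; have Gx := edge_param_Gamma i.2 t01.
  apply: continuousM.
    apply: (@continuous_comp _ _ _ (edge_param i.2) (phi \o emap i.1)).
      exact: edge_param_continuous.
    apply: continuous_comp; last exact: differentiable_continuous.
    by apply: differentiable_continuous;
      case: (emap_C1 (@dom_Gamma R M i.1 _ Gx)).
  apply: (@continuous_comp _ _ _ (edge_param i.2)
      (fun x => dotv (tangent R i.2) (elt_field U (c i.1) x))).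
    exact: edge_param_continuous.
  have -> : (fun x => dotv (tangent R i.2) (elt_field U (c i.1) x)) = fun x =>
      (edge_vector R i.2).1 * elt_field U (c i.1) x 0 0 +
      (edge_vector R i.2).2 * elt_field U (c i.1) x 1 0.
    by apply/funext => x; rewrite /tangent dotvE.
  have cE k x : {for x, continuous (fun x => elt_field U (c i.1) x k 0)}.
    by have [/differentiable_continuous] := @elt_field_C1 i.1 setT k openT x I.
  by apply: continuousD; apply: continuousM; [exact: cvg_cst|exact: cE|
    exact: cvg_cst|exact: cE].
have ig i : lam.-integrable `[0, 1] (EFin \o g i).
  by apply: continuous01_integrable => t; exact: cg.
have m01 : measurable (`[0, 1]%classic : set mR) by exact: measurable_itv.
have -> : \sum_e orientation (emap e) * \sum_j edge_sign R j *
     \int[lam]_(t in `[0, 1]) (phi (emap e (edge_param j t)) *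
     dotv (tangent R j) (elt_field U (c e) (edge_param j t))) =
   \sum_i \int[lam]_(t in `[0, 1]) (side_sign i * g i t).
  under eq_bigr do rewrite mulr_sumr.
  rewrite pair_bigA /=; apply: eq_bigr => -[e j] _.
  by rewrite RintegralZl// mulrA.
have isg i : lam.-integrable `[0, 1] (EFin \o (fun t => side_sign i * g i t)).
  by apply: continuous01_integrable => t t01; apply: continuousM;
    [exact: cvg_cst|exact: cg].
rewrite -(Rintegral_sum _ m01 isg).
have isum : lam.-integrable `[0, 1] (EFin \o (fun t => \sum_i side_sign i * g i
  t)).
  have -> : EFin \o (fun t => \sum_i side_sign i * g i t) =
      (fun t => (\sum_i (side_sign i * g i t)%:E)%E).
    by apply/funext => t; rewrite /= sumEFin.
  by apply: integrable_sum => // i _; exact: isg.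
(* Both end points are removed, since the argument on the two sides of an edge fails at vertices. *)
have m01o : measurable (`[0, 1[%classic : set mR) by exact: measurable_itv.
rewrite -Rintegral_itv_bndo_bndc; last first.
  by apply: integrableS isum => //; apply: subset_itvl; rewrite bnd_simp.
rewrite -Rintegral_itv_obnd_cbnd; last first.
  apply: integrableS isum => //; exact: subset_itv_oo_cc.
rewrite (@eq_Rintegral _ _ _ _ _ (cst 0)); last first.
  move=> t /set_mem/=; rewrite in_itv/= => t01.
  apply: (@sum_opposite_mates R _ (@side_sign R M) (g^~ t)
    (fun i i' => shared_edge i.1 i.2 i'.1 i'.2)).
  - by move=> i i'; rewrite /shared_edge => ->.
  - by move=> i i' i''; rewrite /shared_edge => -> ->.
  - move=> i i' sh; rewrite /g (mesh_order sh (ltW01 t01)).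
    by rewrite (trace_shared U_basis c_same sh (ltW01 t01)).
  - move=> i gi; apply: (opposite_neighbour t01 _).1; apply: phiA.
    by apply: contraNneq gi => e0; rewrite /g e0 mul0r.
  - move=> i i' gi; apply: (opposite_neighbour t01 _).2; apply: phiA.
    by apply: contraNneq gi => e0; rewrite /g e0 mul0r.
by rewrite Rintegral_cst ?mul0r//; exact: measurable_itv.
Qed.

End Assembly.

(** * The assembled field and its weak curl *)

Section Conformity.
Variable R : realType.
Local Notation mu := (@plane_measure R).
Local Notation Gamma := (@Gamma R).
Local Notation mR := (measurableTypeR R).
Variable M : mesh R.
Implicit Types e : 'I_(nelt M).

Let E e : set (mR * mR) := (element e)°.

Let mE e : measurable (E e).
Proof. by apply: open_plane_measurable; exact: open_interior. Qed.

Let ES e : E e `<=` element e. Proof. exact: interior_subset. Qed.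

Let EA e : E e `<=` mesh_domain M.
Proof. by move=> x /ES ex; exists e. Qed.

Let elt_dom e : element e `<=` emap e @` dom e.
Proof. by apply: image_subset; exact: dom_Gamma. Qed.

Section ElementwiseFunction.
Variable k : 'I_(nelt M) -> R * R -> R.
Hypothesis ck : forall e y, (emap e @` dom e) y -> {for y, continuous (k e)}.

Let k_integrable e : mu.-integrable (E e) (EFin \o k e).
Proof.
apply: (compact_plane_integrable (@emap_open R M e) (@ck e) (@element_compact R
  M e)).
- exact: elt_dom.
- exact: ES.
- exact: mE.
Qed.

Let indicE e x : \1_((element e)°) x * k e x = (k e \_ (E e)) x.
Proof.
by rewrite patchE indicE; case: ifPn => _; rewrite ?mul1r ?mul0r.
Qed.

Lemma elementwise_Rintegral :
  \int[mu]_(x in mesh_domain M) (\sum_e \1_((element e)°) x * k e x) =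
  \sum_e \int[mu]_(x in (element e)°) k e x.
Proof.
have mA := @mesh_domain_measurable R M.
rewrite (@Rintegral_sum _ _ _ mu); [|exact: mA|].
- apply: eq_bigr => e _; rewrite -/(E e) [RHS]Rintegral_mkcond
    [LHS]Rintegral_mkcond.
  apply: eq_Rintegral => x _; rewrite patchE indicE.
  by rewrite patchE; case: ifPn => // xA;
    case: ifPn => // /set_mem/EA/mem_set xA';
    rewrite xA' in xA.
- move=> e; have -> : EFin \o (fun x => \1_((element e)°) x * k e x) =
      (EFin \o k e) \_ (E e).
    by apply/funext => x; rewrite /= indicE !patchE; case: ifPn.
  apply: (@integrableS _ _ _ mu setT) => //.
  by apply/(integrable_mkcond _ (mE e)); exact: k_integrable.
Qed.

Lemma elementwise_L2 : L2 (mesh_domain M) (fun x => \sum_e \1_((element e)°) x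
  * k e x).
Proof.
rewrite /L2.
have -> : (fun x => \sum_e \1_((element e)°) x * k e x) \_ (mesh_domain M) =
    \sum_e (k e \_ (E e)).
  apply/funext => x; rewrite fct_sumE patchE; case: ifPn => [_|nA].
    by apply: eq_bigr => e _; rewrite indicE.
  rewrite big1// => e _; rewrite patchE;
    case: ifPn => // /set_mem/EA/mem_set xA.
  by rewrite xA in nA.
have two : (1 <= 2%:E :> \bar R)%E by rewrite lee_fin ler1n.
have [L0 LD] := @Lfun_addr_closed _ _ R mu 2%:E two.
apply: (big_ind (fun f => f \in Lfun mu 2%:E)) => // e _.
apply: bounded_Lfun2.
- exact: mE.
- exact: compact_plane_finite (@element_compact R M e) (@ES e) (mE e).
- apply: (@measurable_funS _ _ _ _ (emap e @` dom e)).
  + by apply: open_plane_measurable; exact: emap_open.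
  + exact: subset_trans (@ES e) (@elt_dom e).
  + by apply: continuous_measurable_fun_on; [exact: emap_open|exact: ck].
- have cke : {within element e, continuous (k e)}.
    by apply/continuous_in_subspaceT => x /set_mem /elt_dom; exact: ck.
  have /compact_bounded[N [_ mrt]] := continuous_compact cke (@element_compact
    R M e).
  exists N; split; rewrite ?num_real// => r Nr x Ex; apply: mrt => //.
  by exists x => //; exact: ES.
Qed.

End ElementwiseFunction.

Variables (p : nat) (U : scalar_idx p -> R * R -> R).
Hypothesis U_basis : H1_conforming_basis U.
Variable c : 'I_(nelt M) -> idx p -> R.
Hypothesis c_same : forall e b e' b', same_idx e b e' b' -> c e b = c e' b'.

Let u e := covariant (emap e) (einv e) (elt_field U (c e)).

Lemma assembledE x i :
  assembled U c x i 0 = \sum_e \1_((element e)°) x * u e x i 0.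
Proof.
rewrite /assembled summxE; apply: eq_bigr => e _; rewrite mxE; congr (_ * _).
rewrite /u /covariant /elt_field mulmx_sumr; congr (fun_of_matrix _ i 0).
by apply: eq_bigr => b _; rewrite -scalemxAr.
Qed.

Lemma assembled_Hcurl : Hcurl (mesh_domain M) (assembled U c).
Proof.
have C1 e i : C1_fun (dom e) (fun x => elt_field U (c e) x i 0).
  by apply: elt_field_C1 => //; exact: dom_open.
have cu e i y : (emap e @` dom e) y -> {for y, continuous (fun y => u e y i 0)}.
  exact: (covariant_continuous (mesh_diffeo e) (C1 e 0) (C1 e 1)).
pose w e := covariant_curl (emap e) (einv e) (elt_field U (c e)).
have cw e y : (emap e @` dom e) y -> {for y, continuous (w e)}.
  exact: (covariant_curl_continuous (mesh_diffeo e) (C1 e 0) (C1 e 1)).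
split.
- rewrite (_ : (fun x => _) = fun x => \sum_e \1_((element e)°) x * u e x 0 0).
    by apply: elementwise_L2 => e y; exact: cu.
  by apply/funext => x; rewrite assembledE.
- rewrite (_ : (fun x => _) = fun x => \sum_e \1_((element e)°) x * u e x 1 0).
    by apply: elementwise_L2 => e y; exact: cu.
  by apply/funext => x; rewrite assembledE.
exists (fun x => \sum_e \1_((element e)°) x * w e x);
  first exact: elementwise_L2.
move=> phi [Cphi _ supp].
have [dphi Dphi] := Cphi 2.
have cDphi v : continuous ('D_v phi).
  by move=> y; apply: differentiable_continuous; case: (Dphi v).
have cphi : continuous phi by move=> y; exact: differentiable_continuous.
have phiA y : phi y != 0 -> (mesh_domain M)° y.
  by move=> y0; apply: supp; exact: subset_closure.
transitivity (\sum_e \int[mu]_(x in (element e)°)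
    (u e x 0 0 * 'D_(0, 1) phi x - u e x 1 0 * 'D_(1, 0) phi x)).
  rewrite -elementwise_Rintegral; last first.
    move=> e y ey; apply: continuousB; apply: continuousM;
      [exact: cu|exact: cDphi|exact: cu|exact: cDphi].
  apply: eq_Rintegral => x _; rewrite !assembledE !mulr_suml -sumrB.
  by apply: eq_bigr => e _; rewrite mulrBr !mulrA.
transitivity (\sum_e \int[mu]_(x in (element e)°) (w e x * phi x)).
  apply/eqP; rewrite -subr_eq0 -sumrB; apply/eqP.
  rewrite -[RHS]oppr0 -[X in _ = - X](boundary_terms_cancel U_basis c_same dphi
    phiA).
  rewrite -sumrN.
  apply: eq_bigr => e _; rewrite interior_element.
  rewrite (element_weak_curl (mesh_diffeo e) (@dom_Gamma R M e) (C1 e 0) (C1 e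
    1) dphi cDphi).
  by rewrite addrAC subrr add0r.
rewrite -elementwise_Rintegral; last first.
  by move=> e y ey; apply: continuousM; [exact: cw|exact: cphi].
by apply: eq_Rintegral => x _; rewrite mulr_suml; apply: eq_bigr => e _;
  rewrite mulrA.
Qed.

End Conformity.

(** * Linear independence of the products *)

Section Independence.
Variables (R : realType) (p : nat).

Lemma template_free (s : scalar_idx p) (a : 'I_2 -> R) :
  (forall i, \sum_k a k * tnth (template R s) k i 0 = 0) -> forall k, a k = 0.
Proof.
move=> h; have := h 1; have := h 0; rewrite !big_ord_recl !big_ord0 !addr0.
have -> : lift ord0 ord0 = 1 :> 'I_2 by apply/val_inj.
rewrite -[ord0]/(0 : 'I_2); move=> h0 h1.
suff [a0 a1] : a 0 = 0 /\ a 1 = 0.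
  by case=> -[|[|//]] lk; [rewrite -a0|rewrite -a1]; congr a; exact/val_inj.
move: (a 0) (a 1) h0 h1 {h} => b0 b1.
by case: s => [[[]|[[] ?]]|?]; rewrite /tnth /= !mxE /= => h0 h1; split; lra.
Qed.

(** In each Cartesian component a vanishing combination is one of the scalar base functions, whose
    coefficients combine the template vectors; these vanish, and each template set is a basis of the
    plane. *)
Lemma base_functions_indep (U : scalar_idx p -> R * R -> R) :
  lin_indep (U : scalar_idx p -> R * R -> R^o) -> lin_indep (base_function U).
Proof.
move=> indep c h [s k].
have hv i s1 : \sum_l c (s1, l) * tnth (template R s1) l i 0 = 0.
  apply: (indep (fun s1 => \sum_l c (s1, l) * tnth (template R s1) l i 0)) => x
    Gx.
  have := congr1 (fun v : 'cV[R]_2 => v i 0) (h x Gx).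
  rewrite -/(elt_field U c x) elt_fieldE mxE => e0; rewrite -[RHS]e0.
  apply: eq_bigr => s2 _; rewrite /GRing.scale/= mulr_suml.
  by apply: eq_bigr => l _; rewrite mulrAC.
by apply: (template_free (s := s) (a := fun l => c (s, l))) => i; exact: hv.
Qed.

End Independence.

(* The first conjunct is the directness of the sum of the products. *)
Theorem theorem3p2 (R : realType) (p : nat) (p_ge1 : (1 <= p)%N)
    (U : scalar_idx p -> R * R -> R) (U_basis : H1_conforming_basis U) :
  lin_indep (base_function U) /\ Hcurl_conforming U.
Proof.
split; first exact: base_functions_indep (basis_indep U_basis).
by move=> M c c_same; exact: assembled_Hcurl.
Qed.
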